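(* Let $M$ be a connected $2$-manifold (possibly with boundary) and let $f,\tilde f\colon M\to\mathbf{R}^3$ be $\mathcal{C}^{2,1}$ positively curved isometric immersions whose mean curvature vectors induce the same orientation on $M$. Suppose that there exist a curve segment $\Gamma$ in $M$ and a proper rigid motion $\rho\colon\mathbf{R}^3\to\mathbf{R}^3$ such that $f=\rho\circ\tilde f$ on $\Gamma$. Then $f=\rho\circ\tilde f$ on $M$.
   Context: Conventions. $M$ is a smooth $2$-manifold, which may have boundary $\partial M$ and arbitrary topological genus. A map is $\mathcal{C}^{2,1}$ if, in local coordinates, it is twice continuously differentiable with (locally) Lipschitz second derivatives. The immersions $f,\tilde f$ are isometric if they induce the same metric on $M$: $\langle df(v),df(w)\rangle=\langle d\tilde f(v),d\tilde f(w)\rangle$ for all $p\in M$ and all $v,w\in T_pM$, where $\langle\cdot,\cdot\rangle$ is the standard inner product of $\mathbf{R}^3$. Positively curved means that the Gauss curvature is positive at every point of $M$. The mean curvature vectors of $f$ and $\tilde f$ induce the same orientation on $M$ if, for every $p\in M$ and all linearly independent $v,w\in T_pM$, $df(v)\times df(w)$ is parallel to the mean curvature vector of $f$ at $p$ whenever $d\tilde f(v)\times d\tilde f(w)$ is parallel to the mean curvature vector of $\tilde f$ at $p$. Here parallel means pointing in the same direction (a positive scalar multiple), as opposed to antiparallel. A curve segment in $M$ is the image of a smooth embedding $(-\epsilon,\epsilon)\to M$ for some $\epsilon>0$ (it may be arbitrarily small, and may lie in $\partial M$). A proper rigid motion is an orientation-preserving isometry of $\mathbf{R}^3$. *)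

(* Defs.v *)
From HB Require Import structures.
From mathcomp Require Import all_boot all_order all_algebra.
From mathcomp Require Import all_classical all_reals all_analysis.
Set Implicit Arguments.
Unset Strict Implicit.
Unset Printing Implicit Defensive.
Import Order.TTheory GRing.Theory Num.Theory.
Import numFieldNormedType.Exports.
Local Open Scope classical_set_scope.
Local Open Scope ring_scope.

(* U is meant to be open. *)
Fixpoint Ck_open (R : realType) (V W : normedModType R) (k : nat)
    (U : set V) (g : V -> W) : Prop :=
  match k with
  | 0%N => forall x, U x -> {for x, continuous g}
  | k'.+1 => (forall x, U x -> differentiable g x) /\
             (forall v, Ck_open k' U (fun x => 'D_v g x))
  end.

Definition smooth_open (R : realType) (V W : normedModType R)
    (U : set V) (g : V -> W) : Prop :=
  forall k, Ck_open k U g.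

Definition C21_open (R : realType) (V W : normedModType R)
    (U : set V) (g : V -> W) : Prop :=
  Ck_open 2 U g /\
  forall v w, exists k : R, k.-lipschitz_U (fun x => 'D_v (fun y => 'D_w g y) x).

(* On a set A that need not be open (typically a relatively open subset of a
   half-plane), regularity means, as usual, the existence around each point of
   A of an extension of that regularity to an open set. *)
Definition locally_extends (R : realType) (V W : normedModType R)
    (reg : set V -> (V -> W) -> Prop) (A : set V) (g : V -> W) : Prop :=
  forall x, A x -> exists (U : set V) (G : V -> W),
    [/\ open U, U x, reg U G & forall y, A y -> U y -> G y = g y].

Definition smooth_on (R : realType) (V W : normedModType R)
    (A : set V) (g : V -> W) : Prop :=
  locally_extends (@smooth_open R V W) A g.

Definition C21_on (R : realType) (V W : normedModType R)
    (A : set V) (g : V -> W) : Prop :=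
  locally_extends (@C21_open R V W) A g.

(* Directional derivative of g relative to A: the increments h are restricted
   to those with x + h *: v in A.  It coincides with 'D_v g x when x is
   interior to A, and is one-sided when x is a boundary point of a half-plane
   and v is transverse to the boundary line. *)
Definition derive_in (R : realType) (V W : normedModType R)
    (A : set V) (v : V) (g : V -> W) (x : V) : W :=
  lim (h^-1 *: (g (x + h *: v) - g x)
       @[h --> within [set h : R | A (x + h *: v)] (0 : R)^']).

Definition half_plane (R : realType) : set 'rV[R]_2 :=
  [set x | 0 <= x ord0 ord0].

Record chart (R : realType) (M : topologicalType) := Chart {
  cdom : set M;
  cmap : M -> 'rV[R]_2;
  cinv : 'rV[R]_2 -> M;
  cdom_open : open cdom;
  cmap_relopen : exists2 O : set 'rV[R]_2,
    open O & cmap @` cdom = half_plane (R := R) `&` O;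
  cmapK : forall p, cdom p -> cinv (cmap p) = p;
  cmap_continuous : {within cdom, continuous cmap};
  cinv_continuous : {within cmap @` cdom, continuous cinv}
}.

Definition cimg (R : realType) (M : topologicalType) (c : chart R M) :
  set 'rV[R]_2 := cmap c @` cdom c.

(* A smooth 2-manifold, possibly with boundary; points of the boundary are
   those mapped by charts to the line x_0 = 0. *)
Record smooth_surface (R : realType) := SmoothSurface {
  carrier :> topologicalType;
  surface_hausdorff : hausdorff_space carrier;
  surface_second_countable : second_countable (T := carrier);
  atlas : set (chart R carrier);
  atlas_cover : forall p : carrier, exists2 c, atlas c & cdom c p;
  atlas_compat : forall c d, atlas c -> atlas d ->
    smooth_on (cmap c @` (cdom c `&` cdom d)) (cmap d \o cinv c)
}.

Definition chart_at (R : realType) (M : smooth_surface R) (p : M)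
    (c : chart R M) : Prop :=
  atlas c /\ cdom c p.

(* I is meant to be open; g' is the continuous inverse of g on its image. *)
Definition smooth_embedding (R : realType) (M : smooth_surface R)
    (I : set R) (g : R -> M) : Prop :=
  [/\ {within I, continuous g},
      forall c : chart R M, atlas c ->
        smooth_on (V := R^o) (I `&` g @^-1` cdom c) (cmap c \o g),
      forall (t : R) (c : chart R M), I t -> chart_at (g t) c ->
        'D_(1 : R^o) (cmap c \o g : R^o -> 'rV[R]_2) t != 0
    & exists2 g' : M -> R,
        (forall t, I t -> g' (g t) = t) & {within g @` I, continuous g'}].

Definition curve_segment (R : realType) (M : smooth_surface R)
    (Gamma : set M) : Prop :=
  exists (e : R) (g : R -> M),
    [/\ 0 < e, smooth_embedding `]- e, e[ g & Gamma = g @` `]- e, e[].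

Definition dot (R : realType) (u v : 'rV[R]_3) : R :=
  \sum_(i < 3) u ord0 i * v ord0 i.

Definition enorm (R : realType) (u : 'rV[R]_3) : R := Num.sqrt (dot u u).

(* Indices are added modulo 3. *)
Definition cross (R : realType) (u v : 'rV[R]_3) : 'rV[R]_3 :=
  \row_(i < 3) (u ord0 (i + 1) * v ord0 (i + 2%:R)
                - u ord0 (i + 2%:R) * v ord0 (i + 1)).

Definition parallel (R : realType) (u v : 'rV[R]_3) : Prop :=
  exists2 k : R, 0 < k & u = k *: v.

(* An isometry of R^3 is affine, so the Jacobian matrix below is the genuine
   one (the library's differential is total). *)
Definition proper_rigid_motion (R : realType)
    (rho : 'rV[R]_3 -> 'rV[R]_3) : Prop :=
  (forall x y, enorm (rho x - rho y) = enorm (x - y)) /\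
  (forall x, 0 < \det ('J rho x)).

Definition C21 (R : realType) (M : smooth_surface R)
    (f : M -> 'rV[R]_3) : Prop :=
  forall c : chart R M, atlas c -> C21_on (cimg c) (f \o cinv c).

(* Tangent vectors at p are represented by their coordinates in the chart c. *)
Section LocalGeometry.
Variables (R : realType) (M : smooth_surface R) (f : M -> 'rV[R]_3).
Variables (c : chart R M) (p : M).

Definition diff1 (v : 'rV[R]_2) : 'rV[R]_3 :=
  derive_in (cimg c) v (f \o cinv c) (cmap c p).

Definition diff2 (v w : 'rV[R]_2) : 'rV[R]_3 :=
  derive_in (cimg c) v (derive_in (cimg c) w (f \o cinv c)) (cmap c p).

Definition coord_vec (i : 'I_2) : 'rV[R]_2 := delta_mx ord0 i.

Definition unit_normal : 'rV[R]_3 :=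
  let n := cross (diff1 (coord_vec 0)) (diff1 (coord_vec 1)) in
  (enorm n)^-1 *: n.

Definition first_form : 'M[R]_2 :=
  \matrix_(i, j) dot (diff1 (coord_vec i)) (diff1 (coord_vec j)).

Definition second_form : 'M[R]_2 :=
  \matrix_(i, j) dot (diff2 (coord_vec i) (coord_vec j)) unit_normal.

(* For C^2 immersions the metric is only C^1, so the curvature is given by its
   extrinsic formula. *)
Definition gauss_curvature : R := \det second_form / \det first_form.

(* Unchanged if the unit normal is replaced by its opposite, as it also changes
   the sign of the second form. *)
Definition mean_curvature_vector : 'rV[R]_3 :=
  (2^-1 * \tr (invmx first_form *m second_form)) *: unit_normal.

End LocalGeometry.

Definition immersion (R : realType) (M : smooth_surface R)
    (f : M -> 'rV[R]_3) : Prop :=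
  forall (p : M) (c : chart R M), chart_at p c -> injective (diff1 f c p).

Definition positively_curved (R : realType) (M : smooth_surface R)
    (f : M -> 'rV[R]_3) : Prop :=
  forall (p : M) (c : chart R M), chart_at p c -> 0 < gauss_curvature f c p.

Definition isometric (R : realType) (M : smooth_surface R)
    (f ft : M -> 'rV[R]_3) : Prop :=
  forall (p : M) (c : chart R M), chart_at p c -> forall v w : 'rV[R]_2,
    dot (diff1 f c p v) (diff1 f c p w) =
    dot (diff1 ft c p v) (diff1 ft c p w).

Definition same_mean_curvature_orientation (R : realType)
    (M : smooth_surface R) (f ft : M -> 'rV[R]_3) : Prop :=
  forall (p : M) (c : chart R M), chart_at p c -> forall v w : 'rV[R]_2,
    free [:: v; w] ->
    parallel (cross (diff1 ft c p v) (diff1 ft c p w))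
             (mean_curvature_vector ft c p) ->
    parallel (cross (diff1 f c p v) (diff1 f c p w))
             (mean_curvature_vector f c p).

(* Main.v *)
(* Composing ft with rho, assume f and ft agree on Gamma. In a chart, let F and G
   be the coordinate expressions of f and ft, m = (F + G) / 2 and u = F - G.
   Isometry means <dm, du> = 0, so u is an infinitesimal isometric deformation of
   m and du = omega x dm for a rotation field omega. Where dF and dG are close,
   m is positively curved; the compatibility relations for omega, whose partial
   derivatives are tangent to m, then make a pair of components of omega a
   quasiregular map w. This only uses that F and G are C^2, with a weak form of
   the equality of mixed derivatives.

   If w vanishes on one side of a rectangle, it vanishes: by a Caccioppoli
   estimate log log (1 / |w|) has bounded energy, whereas it is infinite on a set
   of positive capacity. To avoid integration theory, Stokes' theorem and the
   capacity estimate are replaced by Riemann sums over fine grids.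

   Along Gamma, df = dft: the second derivatives of the curve f o Gamma have the
   same tangential part relative to both surfaces and a nonzero normal part, which
   determines the common tangent plane, and the mean curvature vectors determine
   its orientation. So f = ft near some point, and the interior of the coincidence
   set is closed by the same unique continuation. *)
Require Import Defs.
From HB Require Import structures.
From mathcomp Require Import all_boot all_order all_algebra.
From mathcomp Require Import all_classical all_reals all_analysis.
From mathcomp Require Import ring lra.
Set Implicit Arguments.
Unset Strict Implicit.
Unset Printing Implicit Defensive.
Import Order.TTheory GRing.Theory Num.Theory.
Import numFieldNormedType.Exports.
Local Open Scope classical_set_scope.
Local Open Scope ring_scope.

(** The linear system for omega has second derivatives of m as coefficients, hence merely continuous
    ones. A planar quasiregular map needs only bounds on them, so uniqueness is carried by an
    inequality, the squared gradient being at most a multiple of the Jacobian, rather than by a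
    differential equation. As both partial derivatives of omega are tangent to m, their cross
    product is normal: a coordinate in which the normal is nonzero singles out the other two
    components, and their Jacobian bounds the gradient of all three. The boundary shapes the rest. F
    and G are extensions across the line x_0 = 0, known to be isometric only on its nonnegative
    side; what needs differentiation is proved where x_0 > 0 and reaches the line by continuity.
    Since Gamma may lie in the boundary, uniqueness has to start from zero values on one side of a
    rectangle. There log log is infinite, so the argument is run with |w|^2 + eps and an energy
    bound independent of eps; eps is fixed before the grid is refined. *)

(* The derivative is sealed because conversion tests between two instances of
   the library's [derive] can take minutes. *)
HB.lock Definition pd (R : realType) (V : normedModType R) (v : V)
  (g : V -> R) (x : V) : R := 'D_v (g : V -> R^o) x.

(** * Scalar C^1 functions *)

Section C1_calculus.
Variables (R : realType) (V : normedModType R).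
Implicit Types (f g : V -> R) (U : set V) (x v : V).

Definition dif g x : Prop := differentiable (g : V -> R^o) x.
Definition cont g x : Prop := {for x, continuous (g : V -> R^o)}.

Definition C1 U g : Prop :=
  (forall x, U x -> dif g x) /\ (forall v x, U x -> cont (pd v g) x).

Lemma pdE v g x : pd v g x = 'D_v (g : V -> R^o) x.
Proof. by rewrite pd.unlock. Qed.

Lemma C1_dif U g x : C1 U g -> U x -> dif g x.
Proof. by move=> [+ _]; apply. Qed.

Lemma C1_pd_cont U g v x : C1 U g -> U x -> cont (pd v g) x.
Proof. by move=> [_ +]; apply. Qed.

Lemma dif_cont g x : dif g x -> cont g x.
Proof. exact: differentiable_continuous. Qed.

Lemma C1_cont U g x : C1 U g -> U x -> cont g x.
Proof. by move=> gC Ux; exact/dif_cont/(C1_dif gC). Qed.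

Lemma C1_subset U U' g : U' `<=` U -> C1 U g -> C1 U' g.
Proof. by move=> UU [gd gc]; split => [x /UU/gd//|v x /UU /gc]; apply. Qed.

Lemma cont_cst (a : R) x : cont (fun _ => a) x.
Proof. exact: cst_continuous. Qed.

Lemma contD f g x : cont f x -> cont g x -> cont (fun y => f y + g y) x.
Proof. exact: (@continuousD R R^o V). Qed.

Lemma contN f x : cont f x -> cont (fun y => - f y) x.
Proof. exact: (@continuousN R R^o V). Qed.

Lemma contB f g x : cont f x -> cont g x -> cont (fun y => f y - g y) x.
Proof. exact: (@continuousB R R^o V). Qed.

Lemma contM f g x : cont f x -> cont g x -> cont (fun y => f y * g y) x.
Proof. exact: (@continuousM R V). Qed.

Lemma dif_cst (a : R) x : dif (fun _ => a) x.
Proof. exact: differentiable_cst. Qed.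

Lemma difD f g x : dif f x -> dif g x -> dif (fun y => f y + g y) x.
Proof. exact: differentiableD. Qed.

Lemma difB f g x : dif f x -> dif g x -> dif (fun y => f y - g y) x.
Proof. exact: differentiableB. Qed.

Lemma difM f g x : dif f x -> dif g x -> dif (fun y => f y * g y) x.
Proof. exact: differentiableM. Qed.

Lemma pd_cst v (a : R) x : pd v (fun _ => a) x = 0.
Proof. by rewrite pdE; exact: derive_cst. Qed.

Lemma pdD v f g x : dif f x -> dif g x ->
  pd v (fun y => f y + g y) x = pd v f x + pd v g x.
Proof.
by rewrite !pdE => df dg; apply: (@deriveD _ _ _ (f : V -> R^o) g); apply: diff_derivable.
Qed.

Lemma pdB v f g x : dif f x -> dif g x ->
  pd v (fun y => f y - g y) x = pd v f x - pd v g x.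
Proof.
by rewrite !pdE => df dg; apply: (@deriveB _ _ _ (f : V -> R^o) g); apply: diff_derivable.
Qed.

Lemma pdM v f g x : dif f x -> dif g x ->
  pd v (fun y => f y * g y) x = f x * pd v g x + g x * pd v f x.
Proof.
by rewrite !pdE => df dg; apply: (@deriveM _ _ (f : V -> R^o) g); apply: diff_derivable.
Qed.

Lemma derive_compE (V' W' : normedModType R) (h : V -> V') (k : V' -> W') x v :
  differentiable h x -> differentiable k (h x) ->
  'D_v (fun y => k (h y)) x = 'D_('D_v h x) k (h x).
Proof.
move=> dh dk; rewrite (deriveE _ dk) (deriveE _ dh).
rewrite deriveE; last exact: (differentiable_comp dh dk).
by have -> := diff_comp dh dk.
Qed.

Lemma pdZ g x v (k : R) : dif g x -> pd (k *: v) g x = k * pd v g x.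
Proof. by move=> dg; rewrite !pdE !deriveE// linearZ. Qed.

Lemma pdDv g x v w : dif g x -> pd (v + w) g x = pd v g x + pd w g x.
Proof. by move=> dg; rewrite !pdE !deriveE// linearD. Qed.

Lemma pd_compR (k : R -> R) (k' : R) v g x :
  dif g x -> is_derive (g x) 1 (k : R^o -> R^o) k' ->
  pd v (fun y => k (g y)) x = k' * pd v g x.
Proof.
move=> dg dk; have dk' : differentiable (k : R^o -> R^o) (g x : R^o).
  by apply/derivable1_diffP; case: dk.
rewrite !pdE (derive_compE _ dg dk').
rewrite -[X in 'D_X _ _]mulr1 (@deriveE _ _ _ (k : R^o -> R^o))// linearZ/=.
by rewrite -(deriveE (1:R^o) dk') (@derive_val _ _ _ _ _ _ _ dk) mulrC.
Qed.

Lemma C1_cst U (a : R) : C1 U (fun _ => a).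
Proof.
split => [x _|v x _]; first exact: dif_cst.
have -> : pd v (fun _ : V => a) = cst 0 by apply/funext => y; exact: pd_cst.
exact: cst_continuous.
Qed.

Variable U : set V.
Hypothesis Uopen : open U.

Lemma near_open x : U x -> \forall y \near x, U y.
Proof. by move=> Ux; exact: open_nbhs_nbhs. Qed.

Lemma cont_near_eq f g x : U x -> (forall y, U y -> f y = g y) -> cont f x -> cont g x.
Proof.
move=> Ux fg; rewrite /cont /prop_for /continuous_at -fg// => fc.
apply: cvg_trans fc; apply: near_eq_cvg.
by near do apply: fg; exact: near_open.
Unshelve. all: by end_near. Qed.

Lemma pd_near_eq f g v x : U x -> (forall y, U y -> f y = g y) -> pd v f x = pd v g x.
Proof.
move=> Ux fg; rewrite !pdE; apply: near_eq_derive.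
by near do apply: fg; exact: near_open.
Unshelve. all: by end_near. Qed.

Lemma C1D f g : C1 U f -> C1 U g -> C1 U (fun y => f y + g y).
Proof.
move=> fC gC; have fd := @C1_dif _ f _ fC; have gd := @C1_dif _ g _ gC.
split => [x Ux|v x Ux]; first by apply: difD; [exact: fd|exact: gd].
apply: (@cont_near_eq (fun y => pd v f y + pd v g y)) => //.
  by move=> y Uy; rewrite pdD//; [exact: fd|exact: gd].
by apply: contD; [exact: (C1_pd_cont fC)|exact: (C1_pd_cont gC)].
Qed.

Lemma C1M f g : C1 U f -> C1 U g -> C1 U (fun y => f y * g y).
Proof.
move=> fC gC; have fd := @C1_dif _ f _ fC; have gd := @C1_dif _ g _ gC.
split => [x Ux|v x Ux]; first by apply: difM; [exact: fd|exact: gd].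
apply: (@cont_near_eq (fun y => f y * pd v g y + g y * pd v f y)) => //.
  by move=> y Uy; rewrite pdM//; [exact: fd|exact: gd].
apply: contD; apply: contM.
- exact: (C1_cont fC).
- exact: (C1_pd_cont gC).
- exact: (C1_cont gC).
- exact: (C1_pd_cont fC).
Qed.

Lemma C1N f : C1 U f -> C1 U (fun y => - f y).
Proof.
move=> fC; have := C1M (C1_cst U (-1)) fC.
by have -> : (fun y => -1 * f y) = (fun y => - f y) by apply/funext => y; rewrite mulN1r.
Qed.

Lemma C1B f g : C1 U f -> C1 U g -> C1 U (fun y => f y - g y).
Proof. by move=> fC gC; exact: (C1D fC (C1N gC)). Qed.

Lemma C1_comp (k k' : R -> R) g : C1 U g ->
  (forall x, U x -> is_derive (g x) 1 (k : R^o -> R^o) (k' (g x))) ->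
  (forall x, U x -> {for g x, continuous (k' : R^o -> R^o)}) ->
  C1 U (fun y => k (g y)).
Proof.
move=> gC kd k'c; have gd := @C1_dif _ g _ gC.
have dk x : U x -> differentiable (k : R^o -> R^o) (g x : R^o).
  by move=> Ux; apply/derivable1_diffP; case: (kd x Ux).
split => [x Ux|v x Ux].
  by apply: (@differentiable_comp _ _ R^o R^o g k); [exact: gd|exact: dk].
apply: (@cont_near_eq (fun y => k' (g y) * pd v g y)) => //.
  by move=> y Uy; have /esym := pd_compR v (gd y Uy) (kd y Uy).
apply: contM; last exact: (C1_pd_cont gC).
by apply: (@continuous_comp _ R^o R^o g k'); [exact: (C1_cont gC)|exact: k'c].
Qed.

Lemma C1V f : C1 U f -> (forall x, U x -> f x != 0) -> C1 U (fun y => (f y)^-1).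
Proof.
move=> fC f0; apply: (@C1_comp GRing.inv (fun y => - y ^- 2)) => // x Ux; last first.
  apply: (@continuousN R R^o R^o); apply: (@continuousV R R^o).
    by rewrite expf_neq0// f0.
  exact: exprn_continuous.
have d1 : is_derive (f x : R^o) 1 (id : R^o -> R) 1 by exact: is_derive_id.
by have := is_deriveV (f0 _ Ux) d1; rewrite scaler1.
Qed.

End C1_calculus.

(** * Expansions along lines and equality of mixed derivatives *)

Lemma differentiable_id (R : realType) (V : normedModType R) (x : V) :
  differentiable (fun y : V => y) x.
Proof. by have [] := @is_diff_id R V x. Qed.

Section line.
Variables (R : realType) (V : normedModType R).
Implicit Types (g : V -> R) (U : set V) (x v : V).

Lemma differentiable_line x v (t : R) :
  differentiable (fun s : R^o => x + s *: v) t.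
Proof.
apply: differentiableD; first exact: differentiable_cst.
by apply: (@differentiableZl _ R^o V (id : R^o -> R) v t); exact: differentiable_id.
Qed.

Lemma derive_line x v (t : R) :
  'D_(1 : R^o) (fun s : R^o => x + s *: v) t = v.
Proof.
rewrite deriveD; last 2 first.
- exact: derivable_cst.
- by apply/diff_derivable/(@differentiableZl _ R^o V (id : R^o -> R) v t); exact: differentiable_id.
rewrite derive_cst add0r deriveE; last first.
  by apply/(@differentiableZl _ R^o V (id : R^o -> R) v t); exact: differentiable_id.
rewrite (@diffZl _ R^o V (id : R^o -> R) v t); last exact: differentiable_id.
by have [_ ->] := @is_diff_id R R^o t; rewrite scale1r.
Qed.

Lemma is_derive_line g x v (t : R) : dif g (x + t *: v) ->
  is_derive (t : R^o) 1 (fun s : R^o => g (x + s *: v) : R^o) (pd v g (x + t *: v)).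
Proof.
move=> dg; have dl := differentiable_line x v t.
have dc : differentiable (fun s : R^o => g (x + s *: v) : R^o) t.
  exact: (@differentiable_comp _ R^o V R^o (fun s : R^o => x + s *: v) g).
apply: DeriveDef; first exact: diff_derivable.
by rewrite pdE (@derive_compE _ R^o V R^o (fun s : R^o => x + s *: v) g)// derive_line.
Qed.

Lemma line_MVT g x v : (forall t : R, 0 <= t <= 1 -> dif g (x + t *: v)) ->
  exists2 t : R, 0 < t < 1 & g (x + v) - g x = pd v g (x + t *: v).
Proof.
move=> dg.
have [||t] := @MVT R (fun s => g (x + s *: v)) (fun s => pd v g (x + s *: v)) 0 1 ltr01.
- move=> t; rewrite in_itv/= => /andP[t0 t1]; apply: is_derive_line.
  by apply: dg; rewrite !ltW.
- apply: derivable_within_continuous => t; rewrite in_itv/= => t01.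
  by have [] := is_derive_line (dg _ t01).
rewrite in_itv/= => t01; rewrite scale1r scale0r addr0 subr0 mulr1 => E.
by exists t.
Qed.

Lemma dif_eps g p (e : R) : dif g p -> 0 < e ->
  exists2 d : R, 0 < d & forall k : V, `|k| < d ->
    `|g (p + k) - g p - pd k g p| <= e * `|k|.
Proof.
move=> dg e0; have /eqaddoP /(_ _ e0) := diff_locally dg.
move=> /nbhs_normP[d /= d0 H].
exists d => // k kd; have := H k; rewrite /ball_/= sub0r normrN => /(_ kd).
rewrite -![(_ + _ : _ -> _) _]/(_ + _) -![(- _ : _ -> _) _]/(- _) /=.
by rewrite pdE (deriveE _ dg) opprD addrA (addrC k p).
Qed.

(* [D] is the derivative of [pd v g] at [p]. *)
Lemma second_difference (U : set V) g p v w (D : V -> R) (e : R) : open U -> U p ->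
  (forall x, U x -> dif g x) ->
  (forall x y, D (x + y) = D x + D y) -> (forall (k : R) x, D (k *: x) = k * D x) ->
  (forall e : R, 0 < e -> exists2 d : R, 0 < d & forall k : V, `|k| < d ->
    `|pd v g (p + k) - pd v g p - D k| <= e * `|k|) ->
  0 < e ->
  exists2 d : R, 0 < d & forall h : R, 0 < h < d ->
   `|g (p + h *: v + h *: w) - g (p + h *: v) - g (p + h *: w) + g p
     - h ^+ 2 * D w| <= e * h ^+ 2.
Proof.
move=> Uo Up dg DD DZ Dexp e0.
have /nbhs_normP[r /= r0 rU] := open_nbhs_nbhs (conj Uo Up).
(* [h * C] dominates the lengths of the displacements [t *: (h *: v) + h *: w] and [t *: (h *: v)]
   together, hence the sum of the two errors below. *)
pose C := 2 * `|v| + `|w| + 1.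
have C0 : 0 < C by rewrite ltr_wpDl// addr_ge0// mulr_ge0.
have [d1 d10 Hd] := Dexp _ (divr_gt0 e0 C0).
exists (Num.min r d1 / C); first by rewrite divr_gt0// lt_min r0.
move=> h /andP[h0]; rewrite ltr_pdivlMr// lt_min => /andP[hr hd].
have small k (a b : R) : 0 <= a <= 1 -> 0 <= b <= 1 -> h * C < k ->
    `|a *: (h *: v) + b *: (h *: w)| < k.
  move=> /andP[a0 a1] /andP[b0 b1]; apply: le_lt_trans.
  apply: le_trans (ler_normD _ _) _; rewrite !normrZ !ger0_norm//; last exact: ltW.
  have nv := normr_ge0 v; have nw := normr_ge0 w.
  rewrite /C; rewrite !(mulrCA _ h) -mulrDr ler_pM2l//.
  have : a * `|v| <= 1 * `|v| by rewrite ler_wpM2r.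
  have : b * `|w| <= 1 * `|w| by rewrite ler_wpM2r.
  by lra.
have inU (a b : R) : 0 <= a <= 1 -> 0 <= b <= 1 ->
    U (p + (a *: (h *: v) + b *: (h *: w))).
  by move=> a1 b1; apply: rU => /=; rewrite opprD addrA subrr sub0r normrN small.
have i1 : 0 <= (1:R) <= 1 by lra.
have i0 : 0 <= (0:R) <= 1 by lra.
have trd x : differentiable (fun y : V => y + h *: w) x.
  by apply: differentiableD; [exact: differentiable_id|exact: differentiable_cst].
have Dtr x k : 'D_k (fun y : V => y + h *: w) x = k.
  by rewrite deriveD// derive_cst addr0 derive_id.
have gd1 (t : R) : 0 <= t <= 1 -> dif g (p + t *: (h *: v)).
  by move=> t1; apply: dg; have := inU t 0 t1 i0; rewrite scale0r addr0.
have gd2' (t : R) : 0 <= t <= 1 -> dif g (p + t *: (h *: v) + h *: w).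
  by move=> t1; apply: dg; have := inU t 1 t1 i1; rewrite scale1r addrA.
have gd2 (t : R) : 0 <= t <= 1 -> dif (fun y => g (y + h *: w)) (p + t *: (h *: v)).
  move=> t1; apply: (@differentiable_comp _ V V R^o (fun y => y + h *: w) g) => //.
  exact: gd2'.
(* The mean value theorem is applied to the difference of two parallel rows, so that both values of
   [pd v g] occur for the same [t] and the contribution of [t *: (h *: v)] cancels. *)
have [|t t01] := @line_MVT (fun y => g (y + h *: w) - g y) p (h *: v).
  by move=> t t1; apply: difB; [exact: gd2|exact: gd1].
have t01' : 0 <= t <= 1 by lra.
rewrite (pdB _ (gd2 _ t01') (gd1 _ t01')).
have -> : pd (h *: v) (fun y => g (y + h *: w)) (p + t *: (h *: v)) =
          pd (h *: v) g (p + t *: (h *: v) + h *: w).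
  rewrite !pdE (@derive_compE _ V V R^o (fun y => y + h *: w) g)//; last exact: gd2'.
  by rewrite Dtr.
rewrite (pdZ _ _ (gd2' _ t01')) (pdZ _ _ (gd1 _ t01')) => E.
have k1 := small _ t 1 t01' i1 hd; have k0 := small _ t 0 t01' i0 hd.
rewrite (_ : _ - _ + _ = g (p + h *: v + h *: w) - g (p + h *: v) - (g (p + h *: w) - g p)); last by ring.
rewrite {}E.
have := Hd _ k1; have := Hd _ k0.
rewrite scale0r addr0 scale1r !addrA DD (DZ h w).
move: (pd v g _) (pd v g (_ + _ + _)) (pd v g p) => A B D0.
set X := D (t *: _); set Y := D w => H0 H1.
have Hs : `|B - A - h * Y| <= e * h.
  have -> : B - A - h * Y = (B - D0 - (X + h * Y)) - (A - D0 - X) by ring.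
  apply: le_trans (ler_normB _ _) _; apply: le_trans (lerD H1 H0) _.
  rewrite -mulrDr mulrAC ler_pdivrMr// -mulrA ler_pM2l//.
  have nv := normr_ge0 v; have nw := normr_ge0 w.
  have tv : `|t *: (h *: v)| <= h * `|v|.
    rewrite !normrZ (gtr0_norm h0) ger0_norm; last by case/andP: t01'.
    by rewrite ler_piMl ?mulr_ge0 ?(ltW h0)//; case/andP: t01'.
  apply: le_trans (lerD (le_trans (ler_normD _ _) (lerD tv (lexx _))) tv) _.
  by rewrite normrZ (gtr0_norm h0) /C -mulrDr -mulrDr ler_pM2l//; lra.
have -> : h * B - h * A - h ^+ 2 * Y = h * (B - A - h * Y) by ring.
by rewrite normrM gtr0_norm// (_ : e * h ^+ 2 = h * (e * h)); [rewrite ler_pM2l|ring].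
Qed.

(** The second difference is symmetric in [v] and [w], so its two limits after division by [h ^+ 2]
    coincide. The derivatives at [p] enter as linear maps with an expansion, the form in which
    [Young_form] can supply them. *)
Lemma Young_expansion (U : set V) g p v w (D D' : V -> R) : open U -> U p ->
  (forall x, U x -> dif g x) ->
  (forall x y, D (x + y) = D x + D y) -> (forall (k : R) x, D (k *: x) = k * D x) ->
  (forall e : R, 0 < e -> exists2 d : R, 0 < d & forall k : V, `|k| < d ->
    `|pd v g (p + k) - pd v g p - D k| <= e * `|k|) ->
  (forall x y, D' (x + y) = D' x + D' y) -> (forall (k : R) x, D' (k *: x) = k * D' x) ->
  (forall e : R, 0 < e -> exists2 d : R, 0 < d & forall k : V, `|k| < d ->
    `|pd w g (p + k) - pd w g p - D' k| <= e * `|k|) ->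
  D w = D' v.
Proof.
move=> Uo Up dg DD DZ Dv DD' DZ' Dw; apply/eqP; rewrite -subr_eq0 -normr_le0.
apply/ler_addgt0Pl => e e0; rewrite addr0.
have e20 : 0 < e / 2 by rewrite divr_gt0.
have aux (S S' T T' G X Y h : R) : 0 < h ->
    `|S - T - T' + G - h ^+ 2 * X| <= e / 2 * h ^+ 2 ->
    `|S' - T' - T + G - h ^+ 2 * Y| <= e / 2 * h ^+ 2 -> S = S' -> `|X - Y| <= e.
  move=> h0 A B E; rewrite -E in B; rewrite -(ler_pM2l (exprn_gt0 2 h0)).
  rewrite -[X in X * _](gtr0_norm (exprn_gt0 2 h0)) -normrM.
  have -> : h ^+ 2 * (X - Y) = (S - T' - T + G - h ^+ 2 * Y) - (S - T - T' + G - h ^+ 2 * X) by ring.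
  by apply: le_trans (ler_normB _ _) _; apply: le_trans (lerD B A) _; lra.
have [d d0 Hd] := second_difference w Uo Up dg DD DZ Dv e20.
have [d' d'0 Hd'] := second_difference v Uo Up dg DD' DZ' Dw e20.
pose h := Num.min d d' / 2.
have m0 : 0 < Num.min d d' by rewrite lt_min d0.
have h0 : 0 < h by rewrite divr_gt0.
have hm : h < Num.min d d' by rewrite /h; lra.
have [hd hd'] : h < d /\ h < d' by move: hm; rewrite lt_min => /andP[].
have := Hd h; rewrite h0 hd => /(_ isT) A.
have := Hd' h; rewrite h0 hd' => /(_ isT) B.
by apply: (aux _ _ _ _ _ _ _ _ h0 A B); rewrite (addrAC p).
Qed.

Lemma Young (U : set V) g p v w : open U -> U p -> (forall x, U x -> dif g x) ->
  dif (pd v g) p -> dif (pd w g) p -> pd w (pd v g) p = pd v (pd w g) p.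
Proof.
move=> Uo Up dg dv dw.
apply: (Young_expansion (g := g) (D := fun k => pd k (pd v g) p)
   (D' := fun k => pd k (pd w g) p) Uo Up dg).
- by move=> x y; rewrite pdDv.
- by move=> k x; rewrite pdZ.
- by move=> e e0; exact: (dif_eps dv).
- by move=> x y; rewrite pdDv.
- by move=> k x; rewrite pdZ.
- by move=> e e0; exact: (dif_eps dw).
Qed.

(** Continuity of [c] suffices because the other factor vanishes at [p]: the term in which [c] would
    be differentiated is multiplied by zero. *)
Lemma increment_mul_expansion (a c : V -> R) p (e : R) :
  dif a p -> cont c p -> 0 < e ->
  exists2 d : R, 0 < d & forall k : V, `|k| < d ->
    `|(a (p + k) - a p) * c (p + k) - pd k a p * c p| <= e * `|k|.
Proof.
move=> da cc e0; have [M M0 HM] := linear_lipschitz (diff_continuous da).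
pose C := `|c p| + 1.
have C0 : 0 < C by rewrite ltr_wpDl.
have e1 : 0 < e / 2 / C by rewrite !divr_gt0.
have e2 : 0 < Num.min 1 (e / 2 / M) by rewrite lt_min ltr01 !divr_gt0.
have [d d0 Hd] := dif_eps da e1.
have /cvgrPdist_lt /(_ _ e2) /nbhs_normP[d' /= d'0 Hc] := cc.
exists (Num.min d d') => [|k]; first by rewrite lt_min d0.
rewrite lt_min => /andP[kd kd'].
have {}Hd := Hd _ kd.
have {Hc} := Hc (p + k); rewrite /= opprD addrA subrr sub0r normrN => /(_ kd').
rewrite lt_min distrC => /andP[c1 c2].
have Dk : `|pd k a p| <= M * `|k| by rewrite pdE (deriveE _ da); exact: HM.
rewrite (_ : _ - _ = (a (p + k) - a p - pd k a p) * c (p + k) +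
   pd k a p * (c (p + k) - c p)); last by ring.
apply: le_trans (ler_normD _ _) _; rewrite !normrM.
have cC : `|c (p + k)| <= C.
  rewrite /C -[c (p + k)](subrK (c p)) addrC.
  by apply: le_trans (ler_normD _ _) _; rewrite lerD2l ltW.
apply: le_trans (lerD (ler_pM _ _ Hd cC) (ler_pM _ _ Dk (ltW c2))) _ => //.
have -> : e / 2 / C * `|k| * C = e / 2 * `|k| by field; exact: lt0r_neq0.
have -> : M * `|k| * (e / 2 / M) = e / 2 * `|k| by field; exact: lt0r_neq0.
by have := normr_ge0 k; lra.
Qed.

(* Equality of mixed derivatives of [phi], for the form [d phi = sum a_k d b_k]
   with [a_k, b_k] only C^1, so that [phi] need not be C^2: subtracting
   [sum a_k(p) b_k] makes the partial derivatives differentiable at [p]. *)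
Lemma Young_form (U : set V) (phi a0 a1 a2 b0 b1 b2 : V -> R) p v w :
  open U -> U p -> (forall x, U x -> dif phi x) ->
  C1 U a0 -> C1 U a1 -> C1 U a2 -> C1 U b0 -> C1 U b1 -> C1 U b2 ->
  (forall u, u = v \/ u = w -> forall x, U x ->
     pd u phi x = a0 x * pd u b0 x + a1 x * pd u b1 x + a2 x * pd u b2 x) ->
  pd w a0 p * pd v b0 p + pd w a1 p * pd v b1 p + pd w a2 p * pd v b2 p =
  pd v a0 p * pd w b0 p + pd v a1 p * pd w b1 p + pd v a2 p * pd w b2 p.
Proof.
move=> Uo Up dphi a0C a1C a2C b0C b1C b2C E.
have da0 := C1_dif a0C Up; have da1 := C1_dif a1C Up; have da2 := C1_dif a2C Up.
pose psi x := phi x - (a0 p * b0 x + a1 p * b1 x + a2 p * b2 x).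
pose cb (a b : V -> R) := fun x => a p * b x.
have dcb a b x : C1 U b -> U x -> dif (cb a b) x.
  by move=> bC Ux; apply: difM; [exact: dif_cst|exact: (C1_dif bC)].
have Dcb a b x u : C1 U b -> U x -> pd u (cb a b) x = a p * pd u b x.
  move=> bC Ux; rewrite (pdM _ (dif_cst (a p) x) (C1_dif bC Ux)).
  by rewrite pd_cst mulr0 addr0.
have d01 x : U x -> dif (fun y => cb a0 b0 y + cb a1 b1 y) x.
  by move=> Ux; apply: difD; exact: dcb.
have d012 x : U x -> dif (fun y => (cb a0 b0 y + cb a1 b1 y) + cb a2 b2 y) x.
  by move=> Ux; apply: difD; [exact: d01|exact: dcb].
have dpsi x : U x -> dif psi x.
  by move=> Ux; apply: difB; [exact: dphi|exact: d012].
have Dpsi x u : u = v \/ u = w -> U x -> pd u psi x = (a0 x - a0 p) * pd u b0 x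
     + (a1 x - a1 p) * pd u b1 x + (a2 x - a2 p) * pd u b2 x.
  move=> uvw Ux; rewrite (@pdB _ _ _ phi (fun y => (cb a0 b0 y + cb a1 b1 y) + cb a2 b2 y)).
  - rewrite (@pdD _ _ _ (fun y => cb a0 b0 y + cb a1 b1 y) (cb a2 b2)).
    + rewrite (@pdD _ _ _ (cb a0 b0) (cb a1 b1)).
      * by rewrite !Dcb// (E u uvw)//; ring.
      * exact: dcb.
      * exact: dcb.
    + exact: d01.
    + exact: dcb.
  - exact: dphi.
  - exact: d012.
pose D u k := pd k a0 p * pd u b0 p + pd k a1 p * pd u b1 p + pd k a2 p * pd u b2 p.
have DD u x y : D u (x + y) = D u x + D u y.
  by rewrite /D (pdDv _ _ da0) (pdDv _ _ da1) (pdDv _ _ da2); ring.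
have DZ u (k : R) x : D u (k *: x) = k * D u x.
  by rewrite /D (pdZ _ _ da0) (pdZ _ _ da1) (pdZ _ _ da2); ring.
have sum3 (x y z x' y' z' c n : R) : `|x - x'| <= c / 3 * n -> `|y - y'| <= c / 3 * n ->
    `|z - z'| <= c / 3 * n -> `|x + y + z - (x' + y' + z')| <= c * n.
  move=> hx hy hz; have -> : x + y + z - (x' + y' + z') = x - x' + (y - y') + (z - z') by ring.
  apply: le_trans (ler_normD _ _) _.
  by apply: le_trans (lerD (le_trans (ler_normD _ _) (lerD hx hy)) hz) _; lra.
have Dexp u (e : R) : u = v \/ u = w -> 0 < e -> exists2 d : R, 0 < d & forall k : V, `|k| < d ->
    `|pd u psi (p + k) - pd u psi p - D u k| <= e * `|k|.
  move=> uvw e0; have e3 : 0 < e / 3 by rewrite divr_gt0.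
  have /nbhs_normP[r /= r0 rU] := open_nbhs_nbhs (conj Uo Up).
  have [d0 d00 H0] := increment_mul_expansion da0 (C1_pd_cont (v := u) b0C Up) e3.
  have [d1 d10 H1] := increment_mul_expansion da1 (C1_pd_cont (v := u) b1C Up) e3.
  have [d2 d20 H2] := increment_mul_expansion da2 (C1_pd_cont (v := u) b2C Up) e3.
  exists (Num.min r (Num.min d0 (Num.min d1 d2))) => [|k]; first by rewrite !lt_min r0 d00 d10.
  rewrite !lt_min => /and4P[kr k0 k1 k2].
  have Upk : U (p + k) by apply: rU => /=; rewrite opprD addrA subrr sub0r normrN.
  rewrite !(Dpsi _ _ uvw)// !subrr !mul0r !addr0 subr0.
  exact: (sum3 _ _ _ _ _ _ _ _ (H0 _ k0) (H1 _ k1) (H2 _ k2)).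
by apply: (Young_expansion (D := D v) (D' := D w) Uo Up dpsi (DD v) (DZ v) _ (DD w) (DZ w) _)
  => e; apply: Dexp; [left|right].
Qed.
End line.

(** * The coordinate plane with the sup norm, and uniform first-order expansions *)

Section plane.
Variable R : realType.
Notation plane := 'rV[R]_2.
Implicit Types (g : plane -> R) (x v : plane) (U K : set plane).

Definition pt (s t : R) : plane := \row_i (if i == 0 then s else t).
Definition e0 : plane := coord_vec R 0.
Definition e1 : plane := coord_vec R 1.

Lemma pt0 s t : pt s t ord0 0 = s. Proof. by rewrite mxE. Qed.
Lemma pt1 s t : pt s t ord0 1 = t. Proof. by rewrite mxE. Qed.

Lemma plane_eqP x v : x ord0 0 = v ord0 0 -> x ord0 1 = v ord0 1 -> x = v.
Proof.
move=> h0 h1; apply/rowP => -[[|[|//]] Hi].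
- by rewrite (_ : Ordinal Hi = 0); [|exact/val_inj].
- by rewrite (_ : Ordinal Hi = 1); [|exact/val_inj].
Qed.

Lemma e00 : e0 ord0 0 = 1. Proof. by rewrite !mxE. Qed.
Lemma e01 : e0 ord0 1 = 0. Proof. by rewrite !mxE. Qed.
Lemma e10 : e1 ord0 0 = 0. Proof. by rewrite !mxE. Qed.
Lemma e11 : e1 ord0 1 = 1. Proof. by rewrite !mxE. Qed.
Definition eE := (e00, e01, e10, e11, pt0, pt1).

Lemma plane_expand x : x = x ord0 0 *: e0 + x ord0 1 *: e1.
Proof.
by apply: plane_eqP; rewrite !mxE /= ?mulr1 ?mulr0 ?addr0 ?add0r.
Qed.

Lemma ptK x : pt (x ord0 0) (x ord0 1) = x.
Proof. by apply: plane_eqP; rewrite mxE. Qed.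

Lemma pd_plane v g x : dif g x ->
  pd v g x = v ord0 0 * pd e0 g x + v ord0 1 * pd e1 g x.
Proof.
by move=> dg; rewrite {1}(plane_expand v) (pdDv _ _ dg) !(pdZ _ _ dg).
Qed.

Lemma plane_norm_le x (r : R) : 0 <= r ->
  (`|x| <= r) = (`|x ord0 0| <= r) && (`|x ord0 1| <= r).
Proof.
move=> r0; rewrite /Num.Def.normr/= mx_normrE; apply/idP/andP => [H|[H0 H1]].
  by split; apply: le_trans H;
    [exact: (le_bigmax _ _ ((ord0 : 'I_1), (0 : 'I_2)))|exact: (le_bigmax _ _ ((ord0 : 'I_1), (1 : 'I_2)))].
apply: bigmax_le => // -[i [[|[|//]] Hj]] _ /=; rewrite ord1.
- by rewrite (_ : Ordinal Hj = 0); [|exact/val_inj].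
- by rewrite (_ : Ordinal Hj = 1); [|exact/val_inj].
Qed.

Lemma plane_norm_lt x (r : R) :
  (`|x| < r) = (`|x ord0 0| < r) && (`|x ord0 1| < r).
Proof.
have [r0|r0] := ltP 0 r; last first.
  rewrite !ltNge !(le_trans r0)//.
apply/idP/andP => [H|[H0 H1]].
  have := lexx `|x|; rewrite plane_norm_le// => /andP[h0 h1].
  by split; [exact: le_lt_trans h0 H|exact: le_lt_trans h1 H].
apply: (@le_lt_trans _ _ (Num.max `|x ord0 0| `|x ord0 1|)).
  by rewrite plane_norm_le ?le_max ?normr_ge0// lexx/= lexx orbT.
by rewrite gt_max H0.
Qed.

Lemma coord0_le x : `|x ord0 0| <= `|x|.
Proof. by have := lexx `|x|; rewrite plane_norm_le// => /andP[]. Qed.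

Lemma coord1_le x : `|x ord0 1| <= `|x|.
Proof. by have := lexx `|x|; rewrite plane_norm_le// => /andP[]. Qed.

(** The base point [z] moves: by the mean value theorem the error is governed by the gradients at an
    intermediate point and at [z], both close to the gradient at [x]. This is the form that
    compactness makes uniform. *)
Lemma C1_strict U g x (e : R) : open U -> C1 U g -> U x -> 0 < e ->
  exists2 d : R, 0 < d & forall y z, `|y - x| < d -> `|z - x| < d ->
    `|g y - g z - pd (y - z) g z| <= e * `|y - z|.
Proof.
move=> Uo gC Ux ep.
have /nbhs_normP[r /= r0 rU] := open_nbhs_nbhs (conj Uo Ux).
have e4 : 0 < e / 4 by rewrite divr_gt0.
have /cvgrPdist_lt /(_ _ e4) /nbhs_normP[d0 /= d00 H0] := C1_pd_cont (v := e0) gC Ux.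
have /cvgrPdist_lt /(_ _ e4) /nbhs_normP[d1 /= d10 H1] := C1_pd_cont (v := e1) gC Ux.
exists (Num.min r (Num.min d0 d1)) => [|y z]; first by rewrite !lt_min r0 d00.
rewrite !lt_min => /and3P[yr y0 y1] /and3P[zr z0 z1].
have conv (k t : R) : `|y - x| < k -> `|z - x| < k -> 0 <= t <= 1 ->
    `|x - (z + t *: (y - z))| < k.
  move=> yk zk /andP[t0 t1].
  have -> : x - (z + t *: (y - z)) = - (t *: (y - x) + (1 - t) *: (z - x)).
    by apply: plane_eqP; rewrite !mxE; ring.
  rewrite normrN; apply: le_lt_trans (ler_normD _ _) _; rewrite !normrZ !ger0_norm ?subr_ge0//.
  have [t0'|t0'] := eqVneq t 0; first by rewrite t0' mul0r add0r subr0 mul1r.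
  have tp : 0 < t by rewrite lt_neqAle eq_sym t0'.
  have h1 : t * `|y - x| < t * k by rewrite ltr_pM2l.
  have h2 : (1 - t) * `|z - x| <= (1 - t) * k by rewrite ler_wpM2l ?subr_ge0// ltW.
  by lra.
have dg (t : R) : 0 <= t <= 1 -> dif g (z + t *: (y - z)).
  by move=> t01; apply: (C1_dif gC); apply: rU => /=; exact: conv.
have [t t01] := line_MVT dg; rewrite (addrC z (y - z)) subrK => ->.
have t01' : 0 <= t <= 1 by lra.
have i0 : 0 <= (0:R) <= 1 by lra.
have dz : dif g z by have := dg _ i0; rewrite scale0r addr0.
rewrite (pd_plane _ (dg _ t01')) (pd_plane _ dz).
have := H0 _ (conv _ _ y0 z0 t01'); have := H0 _ (conv _ _ y0 z0 i0).
have := H1 _ (conv _ _ y1 z1 t01'); have := H1 _ (conv _ _ y1 z1 i0).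
rewrite scale0r addr0.
move: (pd e0 g (z + _)) (pd e1 g (z + _)) (pd e0 g z) (pd e1 g z) (pd e0 g x) (pd e1 g x) => B0 B1 A0 A1 C0 C1.
move=> k1 k2 k3 k4.
have b0 : `|B0 - A0| <= e / 2.
  have -> : B0 - A0 = (C0 - A0) - (C0 - B0) by ring.
  by apply: le_trans (ler_normB _ _) _; apply: le_trans (lerD (ltW k3) (ltW k4)) _; lra.
have b1 : `|B1 - A1| <= e / 2.
  have -> : B1 - A1 = (C1 - A1) - (C1 - B1) by ring.
  by apply: le_trans (ler_normB _ _) _; apply: le_trans (lerD (ltW k1) (ltW k2)) _; lra.
have -> : (y - z) ord0 0 * B0 + (y - z) ord0 1 * B1 - ((y - z) ord0 0 * A0 + (y - z) ord0 1 * A1)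
   = (y - z) ord0 0 * (B0 - A0) + (y - z) ord0 1 * (B1 - A1) by ring.
apply: le_trans (ler_normD _ _) _; rewrite !normrM.
apply: le_trans (lerD (ler_pM _ _ (coord0_le _) b0) (ler_pM _ _ (coord1_le _) b1)) _ => //.
by lra.
Qed.

Lemma C1_uniform U K g (e : R) : open U -> C1 U g -> compact K -> K `<=` U -> 0 < e ->
  exists2 d : R, 0 < d & forall z y, K z -> `|y - z| < d ->
    `|g y - g z - pd (y - z) g z| <= e * `|y - z|.
Proof.
move=> Uo gC /compact_near_coveringP cK KU ep.
have [] := cK R (0 : R)^'+ (fun d z => forall y, `|y - z| < d ->
    `|g y - g z - pd (y - z) g z| <= e * `|y - z|).
  move=> x Kx; have [d d0 Hd] := C1_strict Uo gC (KU _ Kx) ep.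
  exists ([set z | `|z - x| < d / 2], [set t : R | t < d / 2]).
    split => /=.
      have H : \forall z \near x, `|z - x| < d / 2.
        by apply/nbhs_normP; exists (d / 2); rewrite /= ?divr_gt0// => z /=; rewrite distrC.
      exact: H.
    by apply: nbhs_right_lt; rewrite divr_gt0.
  move=> [z t] /= [zd td] y yz; apply: Hd.
    rewrite -[y](subrK z) -addrA; apply: le_lt_trans (ler_normD _ _) _; lra.
  by apply: lt_trans zd _; rewrite ltr_pdivrMr//; lra.
move=> d /= d0 Hd; exists (d / 2); first by rewrite divr_gt0.
by move=> z y Kz; apply: (Hd (d / 2)) => //=; rewrite ?sub0r ?normrN ?gtr0_norm//; lra.
Qed.

Lemma cont_bounded K g : compact K -> (forall x, K x -> cont g x) ->
  exists2 M : R, 0 < M & forall x, K x -> `|g x| <= M.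
Proof.
move=> cK gc; have cgK : {within K, continuous g}.
  by apply: continuous_in_subspaceT => x /set_mem /gc.
have [M [_ HM]] := compact_bounded (continuous_compact cgK cK).
exists (Num.max 1 (M + 1)) => [|x Kx]; first by rewrite lt_max ltr01.
by apply: HM => /=; [rewrite lt_max ltrDl ltr01 orbT|exists x].
Qed.

End plane.

(** * Discrete Stokes formula and capacity estimate on a grid *)

Section discrete.
Variable R : realType.
Implicit Types (a b : nat -> nat -> R) (N : nat).

(* Shoelace formula for the image under (a, b) of a grid cell. *)
Definition cell_area a b (i j : nat) : R :=
  ((a i.+1 j.+1 - a i j) * (b i j.+1 - b i.+1 j)
   - (b i.+1 j.+1 - b i j) * (a i j.+1 - a i.+1 j)) / 2.

(** A cell area is the circulation of [a db] around the cell, with the trapezoidal rule on its edges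
    ([Ex] horizontal, [Ey] vertical). Inner edges are traversed twice in opposite directions, and on
    outer edges [a] vanishes. *)
Lemma sum_cell_area a b N :
  (forall i, (i <= N)%N -> [/\ a i 0%N = 0, a i N = 0, a 0%N i = 0 & a N i = 0]) ->
  \sum_(0 <= i < N) \sum_(0 <= j < N) cell_area a b i j = 0.
Proof.
move=> a0.
pose Ex i j := (a i j + a i.+1 j) * (b i.+1 j - b i j) / 2.
pose Ey i j := (a i j + a i j.+1) * (b i j.+1 - b i j) / 2.
have E i j : cell_area a b i j = - (Ex i j.+1 - Ex i j) + (Ey i.+1 j - Ey i j).
  by rewrite /cell_area /Ex /Ey; field.
under eq_bigr do under eq_bigr do rewrite E.
under eq_bigr do rewrite big_split /=.
rewrite big_split /= [X in _ + X]exchange_big /=.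
rewrite [X in X + _]big_nat_cond [X in _ + X]big_nat_cond.
rewrite [X in X + _]big1 => [|i /andP[/andP[_ iN] _]]; last first.
  rewrite sumrN telescope_sumr// /Ex.
  have [-> -> _ _] := a0 _ (ltnW iN); have [-> -> _ _] := a0 _ iN.
  by rewrite !addr0 !mul0r subrr oppr0.
rewrite add0r big1 => // j /andP[/andP[_ jN] _].
rewrite telescope_sumr// /Ey.
have [_ _ -> ->] := a0 _ (ltnW jN); have [_ _ -> ->] := a0 _ jN.
by rewrite !addr0 !mul0r subrr.
Qed.

(** For affine [a] and [b] the shoelace formula is exactly [h ^+ 2] times the Jacobian; what is left
    is the effect of first-order errors on a product. *)
Lemma cell_area_estimate a b i j (ax ay bx by' h e M : R) :
  0 <= h -> 0 <= e <= 1 -> `|ax| <= M -> `|ay| <= M -> `|bx| <= M -> `|by'| <= M ->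
  `|a i.+1 j - a i j - h * ax| <= e * h -> `|a i j.+1 - a i j - h * ay| <= e * h ->
  `|a i.+1 j.+1 - a i j - (h * ax + h * ay)| <= e * h ->
  `|b i.+1 j - b i j - h * bx| <= e * h -> `|b i j.+1 - b i j - h * by'| <= e * h ->
  `|b i.+1 j.+1 - b i j - (h * bx + h * by')| <= e * h ->
  `|cell_area a b i j - h ^+ 2 * (ax * by' - ay * bx)| <= (6 * M + 2) * e * h ^+ 2.
Proof.
move=> h0 /andP[ep e1] axM ayM bxM byM; rewrite /cell_area.
move: (a i j) (b i j) (a i.+1 j) (b i.+1 j) (a i j.+1) (b i j.+1) (a i.+1 j.+1) (b i.+1 j.+1).
move=> aA bA aB bB aD bD aC bC ra rb rc sa sb sc.
(* In the constant, [4 * M] and [2 * M] come from one error times a main term of size [2 * M * h],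
   and [2] from the product of the two errors, using [e <= 1]. *)
have prod (X Y r s : R) : `|X| <= 2 * M * h -> `|Y| <= 2 * M * h ->
    `|r| <= e * h -> `|s| <= 2 * e * h ->
    `|(X + r) * (Y + s) - X * Y| <= (6 * M + 2) * e * h ^+ 2.
  move=> XM YM rM sM.
  rewrite (_ : _ - _ = X * s + (r * Y + r * s)); last by ring.
  apply: le_trans (ler_normD _ _) _.
  apply: (@le_trans _ _ ((2 * M * h) * (2 * e * h) + ((e * h) * (2 * M * h) + (e * h) * (2 * e * h)))).
    rewrite !normrM lerD ?ler_pM//.
    by apply: le_trans (ler_normD _ _) _; rewrite !normrM lerD ?ler_pM.
  rewrite -subr_ge0 (_ : _ - _ = 2 * (e * h ^+ 2) * (1 - e)); last by ring.
  by rewrite mulr_ge0 ?subr_ge0// mulr_ge0// mulr_ge0// exprn_ge0.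
have M2 (x y : R) : `|x| <= M -> `|y| <= M -> `|h * x + h * y| <= 2 * M * h.
  move=> xM yM; rewrite -mulrDr normrM (ger0_norm h0) mulrC ler_wpM2r//.
  by apply: le_trans (ler_normD _ _) _; lra.
have M2' (x y : R) : `|x| <= M -> `|y| <= M -> `|h * x - h * y| <= 2 * M * h.
  by move=> xM yM; rewrite -mulrN; apply: M2; rewrite ?normrN.
have d2 (x y : R) : `|x| <= e * h -> `|y| <= e * h -> `|x - y| <= 2 * e * h.
  by move=> xM yM; apply: le_trans (ler_normB _ _) _; apply: le_trans (lerD xM yM) _; lra.
have P1 := prod _ _ _ _ (M2 _ _ axM ayM) (M2' _ _ byM bxM) rc (d2 _ _ sb sa).
have P2 := prod _ _ _ _ (M2 _ _ bxM byM) (M2' _ _ ayM axM) sc (d2 _ _ rb ra).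
have -> : ((aC - aA) * (bD - bB) - (bC - bA) * (aD - aB)) / 2 - h ^+ 2 * (ax * by' - ay * bx) =
  (((h * ax + h * ay + (aC - aA - (h * ax + h * ay))) *
     (h * by' - h * bx + (bD - bA - h * by' - (bB - bA - h * bx))) -
     (h * ax + h * ay) * (h * by' - h * bx))
  - ((h * bx + h * by' + (bC - bA - (h * bx + h * by'))) *
     (h * ay - h * ax + (aD - aA - h * ay - (aB - aA - h * ax))) -
     (h * bx + h * by') * (h * ay - h * ax))) / 2 by field.
rewrite normrM (@ger0_norm _ 2^-1)// ler_pdivrMr//.
by apply: le_trans (ler_normB _ _) _; apply: le_trans (lerD P1 P2) _; lra.
Qed.

(* A discrete version of the fact that a segment has positive capacity: a
   function that drops by [D] along each of [n] lines has energy at least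
   of order [D]. *)
Lemma discrete_capacity (v p eta : nat -> nat -> R) (h D eta0 C : R) N i0 j0 n :
  0 <= h -> N%:R * h = 1 -> (i0 <= N)%N -> (j0 + n <= N)%N -> 0 <= eta0 ->
  (forall i j, (i < N)%N -> (j < N)%N -> v i j - v i.+1 j <= h * (`|p i j| + 1)) ->
  (forall j, (j0 <= j < j0 + n)%N -> D <= v 0%N j - v i0 j) ->
  (forall i j, (i < i0)%N -> (j0 <= j < j0 + n)%N -> eta0 <= eta i j) ->
  \sum_(0 <= i < N) \sum_(0 <= j < N) h ^+ 2 * ((eta i j) ^+ 2 * (p i j) ^+ 2) <= C ->
  eta0 ^+ 2 * (n%:R * h) * (D - 2) <= C.
Proof.
move=> h0 Nh i0N jN eta00 vp vD etaP; apply: le_trans.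
have H0 i j : 0 <= h ^+ 2 * ((eta i j) ^+ 2 * (p i j) ^+ 2).
  by rewrite mulr_ge0 ?sqr_ge0// mulr_ge0 ?sqr_ge0.
rewrite exchange_big /=.
have jN' : (j0 <= N)%N by apply: leq_trans jN; rewrite leq_addr.
rewrite (@big_cat_nat _ _ _ j0)//= (@big_cat_nat _ _ _ (j0 + n) j0 N)//= ?leq_addr//.
apply: (@le_trans _ _ (\sum_(j0 <= j < j0 + n) \sum_(0 <= i < N) h ^+ 2 * (eta i j ^+ 2 * p i j ^+ 2))); last first.
  apply: ler_wpDl; first by apply: sumr_ge0 => j _; apply: sumr_ge0.
  by apply: ler_wpDr => //; apply: sumr_ge0 => j _; apply: sumr_ge0.
apply: (@le_trans _ _ (\sum_(j0 <= j < j0 + n) eta0 ^+ 2 * h * (D - 2))).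
  rewrite sumr_const_nat addKn -mulr_natl.
  by rewrite le_eqVlt; apply/orP; left; apply/eqP; ring.
apply: ler_sum_nat => j jj.
have jltN : (j < N)%N by case/andP: jj => _ /leq_trans; apply.
rewrite (@big_cat_nat _ _ _ i0)//=; apply: ler_wpDr; first exact: sumr_ge0.
(* The inequality [|p| + 1 <= 2 + p ^+ 2] replaces Cauchy-Schwarz. A line has length at most
   [N%:R * h = 1], so the constant costs at most 2; this is the origin of [D - 2]. *)
have DD : D <= \sum_(0 <= i < i0) (h * (2 + p i j ^+ 2)).
  apply: le_trans (vD _ jj) _.
  have -> : v 0%N j - v i0 j = \sum_(0 <= i < i0) (v i j - v i.+1 j).
    under eq_bigr do rewrite -opprB.
    by rewrite sumrN (telescope_sumr (fun i => v i j))// opprB.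
  apply: ler_sum_nat => i /andP[_ ii].
  apply: le_trans (vp _ _ (leq_trans ii i0N) jltN) _; rewrite ler_wpM2l//.
  rewrite -(real_normK (num_real (p i j))).
  by have := sqr_ge0 (`|p i j| - 1 / 2); set q := `|_|; rewrite sqrrB; lra.
have DD2 : D - 2 <= \sum_(0 <= i < i0) (h * p i j ^+ 2).
  rewrite lerBlDl; apply: le_trans DD _.
  under eq_bigr do rewrite mulrDr.
  rewrite big_split /= lerD2r sumr_const_nat subn0 -mulr_natr.
  have : i0%:R * h <= N%:R * h by rewrite ler_wpM2r// ler_nat.
  by rewrite Nh; lra.
apply: le_trans (ler_wpM2l _ DD2) _; first by rewrite mulr_ge0// sqr_ge0.
rewrite mulr_sumr; apply: ler_sum_nat => i /andP[_ ii].
have -> : eta0 ^+ 2 * h * (h * p i j ^+ 2) = h ^+ 2 * (eta0 ^+ 2 * p i j ^+ 2) by ring.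
rewrite ler_wpM2l ?sqr_ge0// ler_wpM2r ?sqr_ge0// ler_sqr ?nnegrE//; first exact: etaP.
by apply: le_trans (etaP _ _ ii jj).
Qed.
End discrete.

(** * Stokes' theorem on the unit square by Riemann sums *)

Section square.
Variable R : realType.
Notation plane := 'rV[R]_2.
Implicit Types (g a b : plane -> R) (x v : plane) (U : set plane).
Notation e0 := (e0 R).
Notation e1 := (e1 R).

Definition square : set plane :=
  [set x | (0 <= x ord0 0 <= 1) /\ (0 <= x ord0 1 <= 1)].

Lemma square_compact : compact square.
Proof.
have := @rV_compact R 2 (fun=> `[0 : R, 1]%classic) (fun=> @segment_compact R 0 1).
congr compact; apply/seteqP; split => x /=.
  by move=> H; split; [have := H 0|have := H 1]; rewrite in_itv.
move=> [H0 H1] [[|[|//]] Hi].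
- by rewrite (_ : Ordinal Hi = 0) ?in_itv//; exact/val_inj.
- by rewrite (_ : Ordinal Hi = 1) ?in_itv//; exact/val_inj.
Qed.

Definition node (N i j : nat) : plane := pt (i%:R / N%:R : R) (j%:R / N%:R).

Lemma node_square N i j : (0 < N)%N -> (i <= N)%N -> (j <= N)%N -> square (node N i j).
Proof.
move=> N0 iN jN; rewrite /square /node /= pt0 pt1.
have N0' : (0 : R) < N%:R by rewrite ltr0n.
by split; rewrite divr_ge0//= ler_pdivrMr// mul1r ler_nat.
Qed.

Definition jac a b x : R := pd e0 a x * pd e1 b x - pd e1 a x * pd e0 b x.

Lemma grid_increment U g (e : R) : open U -> square `<=` U -> C1 U g -> 0 < e ->
  exists N0 : nat, forall N, (N0 <= N)%N -> (0 < N)%N ->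
  forall i j, (i < N)%N -> (j < N)%N ->
  [/\ `|g (node N i.+1 j) - g (node N i j) - N%:R^-1 * pd e0 g (node N i j)| <= e * N%:R^-1,
      `|g (node N i j.+1) - g (node N i j) - N%:R^-1 * pd e1 g (node N i j)| <= e * N%:R^-1 &
      `|g (node N i.+1 j.+1) - g (node N i j) -
        (N%:R^-1 * pd e0 g (node N i j) + N%:R^-1 * pd e1 g (node N i j))| <= e * N%:R^-1].
Proof.
move=> Uo KU gC ep.
have [d d0 Hd] := C1_uniform Uo gC square_compact KU ep.
exists (Num.bound d^-1) => N NN N0 i j iN jN.
have N0' : (0 : R) < N%:R by rewrite ltr0n.
have hd : N%:R^-1 < d.
  rewrite -[d]invrK ltf_pV2 ?posrE ?invr_gt0//.
  apply: lt_le_trans (archi_boundP _) _; first by rewrite invr_ge0 ltW.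
  by rewrite ler_nat.
have Kz := node_square N0 (ltnW iN) (ltnW jN).
have dg : dif g (node N i j) by apply: (C1_dif gC); exact: KU.
have step (s t : nat) (y : plane) : (s <= 1)%N -> (t <= 1)%N -> y = node N (i + s)%N (j + t)%N ->
    `|g y - g (node N i j) - (s%:R * N%:R^-1 * pd e0 g (node N i j)
       + t%:R * N%:R^-1 * pd e1 g (node N i j))| <= e * N%:R^-1.
  move=> s1 t1 yE.
  have y0 : (y - node N i j) ord0 0 = s%:R * N%:R^-1.
    by rewrite yE !mxE/= natrD; ring.
  have y1 : (y - node N i j) ord0 1 = t%:R * N%:R^-1.
    by rewrite yE !mxE/= natrD; ring.
  have st (k : nat) : (k <= 1)%N -> `|k%:R * N%:R^-1 : R| <= N%:R^-1.
    move=> k1; rewrite ger0_norm ?mulr_ge0 ?invr_ge0 ?ler0n//.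
    by rewrite ler_piMl ?invr_ge0 ?ler0n// -[1]/(1%:R) ler_nat.
  have yn : `|y - node N i j| <= N%:R^-1.
    by rewrite plane_norm_le ?invr_ge0 ?ler0n// y0 y1 !st.
  have := Hd _ y Kz (le_lt_trans yn hd).
  rewrite (pd_plane _ dg) y0 y1 => /le_trans; apply.
  by rewrite ler_pM2l.
split.
- have := step 1%N 0%N _ isT isT erefl; rewrite addn1 addn0 mul1r mul0r mul0r addr0; exact.
- have := step 0%N 1%N _ isT isT erefl; rewrite addn1 addn0 mul1r mul0r mul0r add0r; exact.
- have := step 1%N 1%N _ isT isT erefl; rewrite !addn1 !mul1r; exact.
Qed.

Lemma square_cont_bounded U g : square `<=` U -> (forall x, U x -> cont g x) ->
  exists2 M : R, 0 < M & forall x, square x -> `|g x| <= M.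
Proof. by move=> KU gc; apply: cont_bounded square_compact _ => x /KU; exact: gc. Qed.

(* Stokes' theorem for [a db] on the square, with [a] vanishing on the boundary;
   it holds for [b] merely C^1 because it is exact on the shoelace areas. *)
Lemma grid_Stokes U a b (e : R) : open U -> square `<=` U -> C1 U a -> C1 U b -> 0 < e ->
  (forall x, square x -> x ord0 0 = 0 \/ x ord0 0 = 1 \/ x ord0 1 = 0 \/ x ord0 1 = 1 -> a x = 0) ->
  exists N0 : nat, forall N, (N0 <= N)%N -> (0 < N)%N ->
  `|\sum_(0 <= i < N) \sum_(0 <= j < N) (N%:R^-1) ^+ 2 * jac a b (node N i j)| <= e.
Proof.
move=> Uo KU aC bC ep abd.
have [A A0 HA] := square_cont_bounded KU (fun x => C1_pd_cont (v := e0) aC).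
have [B B0 HB] := square_cont_bounded KU (fun x => C1_pd_cont (v := e1) aC).
have [A' A0' HA'] := square_cont_bounded KU (fun x => C1_pd_cont (v := e0) bC).
have [B' B0' HB'] := square_cont_bounded KU (fun x => C1_pd_cont (v := e1) bC).
pose M := A + B + (A' + B').
have M0 : 0 < M by rewrite !addr_gt0.
have C0 : 0 < 6 * M + 2 by lra.
(* The [N * N] cells contribute an error of [(6 * M + 2) * d / N ^ 2] each, at most [e] in total;
   the minimum with 1 serves [cell_area_estimate]. *)
have dp : 0 < Num.min 1 (e / (6 * M + 2)) by rewrite lt_min ltr01 divr_gt0.
have [Na Ha] := grid_increment Uo KU aC dp.
have [Nb Hb] := grid_increment Uo KU bC dp.
set d := Num.min _ _ in dp Ha Hb.
have d01 : 0 <= d <= 1 by rewrite ltW//= ge_min lexx.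
exists (maxn Na Nb) => N; rewrite geq_max => /andP[NNa NNb] N0.
have N0' : (0 : R) < N%:R by rewrite ltr0n.
pose an i j := a (node N i j); pose bn i j := b (node N i j).
have cell i j : (i < N)%N -> (j < N)%N ->
   `|cell_area an bn i j - N%:R^-1 ^+ 2 * jac a b (node N i j)| <= (6 * M + 2) * d * N%:R^-1 ^+ 2.
  move=> iN jN; have [a1 a2 a3] := Ha _ NNa N0 _ _ iN jN.
  have [b1 b2 b3] := Hb _ NNb N0 _ _ iN jN.
  have Kz := node_square N0 (ltnW iN) (ltnW jN).
  have hi : (0 : R) <= N%:R^-1 by rewrite invr_ge0 ler0n.
  apply: (cell_area_estimate hi d01) => //.
  - by apply: le_trans (HA _ Kz) _; rewrite /M; clear - A0 B0 A0' B0'; lra.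
  - by apply: le_trans (HB _ Kz) _; rewrite /M; clear - A0 B0 A0' B0'; lra.
  - by apply: le_trans (HA' _ Kz) _; rewrite /M; clear - A0 B0 A0' B0'; lra.
  - by apply: le_trans (HB' _ Kz) _; rewrite /M; clear - A0 B0 A0' B0'; lra.
have Z : \sum_(0 <= i < N) \sum_(0 <= j < N) cell_area an bn i j = 0.
  have NN1 : N%:R / N%:R = 1 :> R by rewrite divff// lt0r_neq0.
  apply: sum_cell_area => i iN; rewrite /an; split; apply: abd;
    rewrite ?pt0 ?pt1 ?mul0r ?NN1; try (exact: node_square); by tauto.
rewrite -normrN -[X in `|X|]add0r -{1}Z -sumrB.
under eq_bigr do rewrite -sumrB.
apply: le_trans (ler_norm_sum _ _ _) _.
apply: (@le_trans _ _ (\sum_(0 <= i < N) \sum_(0 <= j < N) ((6 * M + 2) * d * N%:R^-1 ^+ 2))).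
  apply: ler_sum_nat => i /andP[_ iN]; apply: le_trans (ler_norm_sum _ _ _) _.
  by apply: ler_sum_nat => j /andP[_ jN]; exact: cell.
rewrite !sumr_const_nat subn0 -[_ *+ N *+ N]mulr_natr -[_ *+ N]mulr_natr.
have -> : (6 * M + 2) * d * N%:R^-1 ^+ 2 * N%:R * N%:R = (6 * M + 2) * d.
  by field; exact: lt0r_neq0.
by rewrite mulrC -ler_pdivlMr// ge_min lexx orbT.
Qed.
End square.

(** * Pointwise energy inequality and cutoff function *)

Section energy.
Variable R : realType.
Notation plane := 'rV[R]_2.
Implicit Types (x v : plane) (U : set plane).
Notation e0 := (e0 R).
Notation e1 := (e1 R).

Lemma coord_dif (i : 'I_2) x : dif (fun y : plane => y ord0 i) x.
Proof. exact: differentiable_coord. Qed.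

Lemma pd_coord (i : 'I_2) v x : pd v (fun y : plane => y ord0 i) x = v ord0 i.
Proof.
rewrite pdE /derive; apply: lim_near_cst => //.
near=> h.
have h0 : h != 0 by near: h; exact: nbhs_dnbhs_neq.
by rewrite /= !mxE addrK -[_ *: _]/(h^-1 * (h * v ord0 i)) mulrA mulVf ?mul1r.
Unshelve. all: by end_near. Qed.

Lemma C1_coord U (i : 'I_2) : C1 U (fun y : plane => y ord0 i).
Proof.
split => [x _|v x _]; first exact: coord_dif.
have -> : pd v (fun y : plane => y ord0 i) = cst (v ord0 i).
  by apply/funext => y; exact: pd_coord.
exact: cst_continuous.
Qed.

(** Integrand of the Caccioppoli estimate at one point, for the test map [eta ^+ 2 * kap] times [w];
    [kd] is the derivative of [kap = 1 / (T * L)]. Differentiating [kap] turns the coefficient [kap]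
    of the Jacobian into [kap ^+ 2 * (S + eps * L)]: without the logarithmic factor [L], the summand
    [S], which controls the energy, would cancel. The term with the gradient [n0, n1] of [eta] is
    absorbed at the price of [4 / c], which is independent of [eps]. *)
Lemma energy_density (w1 w2 w10 w11 w20 w21 eta n0 n1 T L kap eps c : R) :
  let S := w1 * w1 + w2 * w2 in
  let kd w1i w2i := - (kap * kap * (L - 1)) * (2 * (w1 * w1i + w2 * w2i)) in
  let d w wi ni w1i w2i :=
    2 * eta * ni * (w * kap) + eta * eta * (w * kd w1i w2i + kap * wi) in
  let a10 := d w1 w10 n0 w10 w20 in let a11 := d w1 w11 n1 w11 w21 in
  let a20 := d w2 w20 n0 w10 w20 in let a21 := d w2 w21 n1 w11 w21 in
  T = S + eps -> 0 < eps -> 1 <= L -> kap * (T * L) = 1 -> 0 < c ->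
  `|n0| <= 1 -> `|n1| <= 1 ->
  c * (w10 * w10 + w11 * w11 + w20 * w20 + w21 * w21) <= w10 * w21 - w11 * w20 ->
  c / 4 * (eta ^+ 2 * (- kap * (2 * (w1 * w10 + w2 * w20))) ^+ 2) - 4 / c <=
  (a10 * w21 - a11 * w20) - (a20 * w11 - a21 * w10).
Proof.
move=> S kd d a10 a11 a20 a21 TE eps0 L1 kapE c0 n01 n11 QR.
set E := w10 * w10 + w11 * w11 + w20 * w20 + w21 * w21 in QR *.
set J := w10 * w21 - w11 * w20 in QR *.
have S0 : 0 <= S by rewrite addr_ge0 -?expr2 ?sqr_ge0.
have E0 : 0 <= E by rewrite !addr_ge0 -?expr2 ?sqr_ge0.
have k' : kap - kap * kap * (L - 1) * S = kap ^+ 2 * S + kap ^+ 2 * (eps * L).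
  have -> : kap - kap * kap * (L - 1) * S = kap * (kap * (T * L)) - kap * kap * (L - 1) * S.
    by rewrite kapE mulr1.
  by rewrite TE; ring.
pose X := n0 * (w1 * w21 - w2 * w11) - n1 * (w1 * w20 - w2 * w10).
have I : (a10 * w21 - a11 * w20) - (a20 * w11 - a21 * w10) =
   2 * eta ^+ 2 * (kap ^+ 2 * S + kap ^+ 2 * (eps * L)) * J + 2 * eta * kap * X.
  by rewrite -k' /a10 /a11 /a20 /a21 /d /kd /X /J /S; ring.
have n0s : n0 ^+ 2 <= 1 by rewrite -[n0 ^+ 2]real_normK ?num_real// expr_le1.
have n1s : n1 ^+ 2 <= 1 by rewrite -[n1 ^+ 2]real_normK ?num_real// expr_le1.
have X2 : X ^+ 2 <= 2 * (S * E).
  pose p := w1 * w21 - w2 * w11; pose q := w1 * w20 - w2 * w10.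
  have pq : p ^+ 2 + q ^+ 2 <= S * E.
    rewrite -subr_ge0 (_ : _ - _ = (w1 * w11 + w2 * w21) ^+ 2 + (w1 * w10 + w2 * w20) ^+ 2).
      by rewrite addr_ge0 ?sqr_ge0.
    by rewrite /S /E /p /q; ring.
  have : X ^+ 2 <= 2 * (p ^+ 2 + q ^+ 2).
    have h1 : n0 ^+ 2 * p ^+ 2 <= p ^+ 2 by rewrite ler_piMl ?sqr_ge0.
    have h2 : n1 ^+ 2 * q ^+ 2 <= q ^+ 2 by rewrite ler_piMl ?sqr_ge0.
    have h3 := sqr_ge0 (n0 * p + n1 * q).
    have h4 : X ^+ 2 + (n0 * p + n1 * q) ^+ 2 = 2 * (n0 ^+ 2 * p ^+ 2 + n1 ^+ 2 * q ^+ 2).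
      by rewrite /X /p /q; ring.
    by lra.
  by lra.
have v2 : (- kap * (2 * (w1 * w10 + w2 * w20))) ^+ 2 <= 4 * (kap ^+ 2 * (S * E)).
  rewrite -subr_ge0 (_ : _ - _ = 4 * (kap ^+ 2 * ((w1 * w11 + w2 * w21) ^+ 2
     + (w1 * w20 - w2 * w10) ^+ 2 + (w1 * w21 - w2 * w11) ^+ 2))).
    by rewrite mulr_ge0// mulr_ge0 ?sqr_ge0// addr_ge0 ?sqr_ge0// addr_ge0 ?sqr_ge0.
  by rewrite /S /E; ring.
rewrite I.
set P := eta ^+ 2 * (kap ^+ 2 * (S * E)).
have P0 : 0 <= P by rewrite mulr_ge0 ?sqr_ge0// mulr_ge0 ?sqr_ge0// mulr_ge0.
have main : 2 * c * P <= 2 * eta ^+ 2 * (kap ^+ 2 * S + kap ^+ 2 * (eps * L)) * J.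
  have -> : 2 * c * P = 2 * eta ^+ 2 * (kap ^+ 2 * S) * (c * E) by rewrite /P; ring.
  have e2 : 0 <= 2 * eta ^+ 2 by rewrite mulr_ge0 ?sqr_ge0.
  have kS : 0 <= kap ^+ 2 * S by rewrite mulr_ge0 ?sqr_ge0.
  apply: ler_pM => //; [exact: mulr_ge0|by rewrite mulr_ge0// ltW|].
  rewrite ler_wpM2l// lerDl mulr_ge0 ?sqr_ge0// mulr_ge0 ?(ltW eps0)//.
  exact: le_trans ler01 L1.
(* AM-GM *)
have cross_term : - (c * P + 4 / c) <= 2 * eta * kap * X.
  rewrite lerNl -mulNr; apply: (@le_trans _ _ `|- (2 * eta * kap) * X|); first exact: ler_norm.
  have cP : 0 <= c * P + 4 / c.
    by apply: addr_ge0; [exact: mulr_ge0 (ltW c0) P0|exact: divr_ge0 (ltW c0)].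
  rewrite -ler_sqr ?nnegrE//.
  rewrite real_normK ?num_real//.
  have h : (- (2 * eta * kap) * X) ^+ 2 <= 8 * P.
    have -> : (- (2 * eta * kap) * X) ^+ 2 = 4 * (eta ^+ 2 * (kap ^+ 2 * X ^+ 2)) by ring.
    have -> : 8 * P = 4 * (eta ^+ 2 * (kap ^+ 2 * (2 * (S * E)))) by rewrite /P; ring.
    by rewrite !ler_wpM2l ?sqr_ge0.
  apply: le_trans h _.
  have -> : (c * P + 4 / c) ^+ 2 = (c * P - 4 / c) ^+ 2 + 16 * P by field; exact: lt0r_neq0.
  by have := sqr_ge0 (c * P - 4 / c); lra.
have le_cP : c / 4 * (eta ^+ 2 * (- kap * (2 * (w1 * w10 + w2 * w20))) ^+ 2) <= c * P.
  have -> : c * P = c / 4 * (eta ^+ 2 * (4 * (kap ^+ 2 * (S * E)))) by rewrite /P; field.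
  by rewrite ler_wpM2l ?divr_ge0 ?(ltW c0)// ler_wpM2l ?sqr_ge0.
apply: le_trans (lerD main cross_term).
have -> : 2 * c * P - (c * P + 4 / c) = c * P - 4 / c by ring.
by rewrite lerD2r.
Qed.

(** It vanishes on three sides only. On the fourth, [x_0 = 0], the map itself vanishes, and the
    cutoff has to stay positive inside that side because the capacity estimate uses the lines that
    start there. *)
Definition cutoff x : R := (1 - x ord0 0) * (x ord0 1 * (1 - x ord0 1)).

Lemma C1_cutoff U : open U -> C1 U cutoff.
Proof.
move=> Uo; have c0 := @C1_coord U 0; have c1 := @C1_coord U 1.
have o := C1_cst U (1 : R).
exact: (C1M Uo (C1B Uo o c0) (C1M Uo c1 (C1B Uo o c1))).
Qed.

Lemma pd_cutoff v x : pd v cutoff x =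
  (1 - x ord0 0) * ((1 - 2 * x ord0 1) * v ord0 1) - x ord0 1 * (1 - x ord0 1) * v ord0 0.
Proof.
have c0 := coord_dif 0 x; have c1 := coord_dif 1 x; have o := dif_cst (1 : R) x.
rewrite (pdM _ (difB o c0) (difM c1 (difB o c1))) (pdM _ c1 (difB o c1)).
by rewrite (pdB _ o c0) (pdB _ o c1) pd_cst !pd_coord; ring.
Qed.
End energy.

(** * The log log energy and unique continuation from one side of a square *)

Section log_calculus.
Variables (R : realType) (V : normedModType R).
Implicit Types (g : V -> R) (U : set V) (x v : V).

Lemma pdV v g x : dif g x -> g x != 0 ->
  pd v (fun y => (g y)^-1) x = - (g x) ^- 2 * pd v g x.
Proof.
move=> dg g0; apply: pd_compR => //.
have d1 : is_derive (g x : R^o) 1 (id : R^o -> R) 1 by exact: is_derive_id.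
by have := is_deriveV g0 d1; rewrite scaler1.
Qed.

Lemma pd_ln v g x : dif g x -> 0 < g x -> pd v (fun y => ln (g y)) x = (g x)^-1 * pd v g x.
Proof. by move=> dg g0; apply: pd_compR => //; exact: is_derive1_ln. Qed.

Lemma C1_ln U g : open U -> C1 U g -> (forall x, U x -> 0 < g x) -> C1 U (fun y => ln (g y)).
Proof.
move=> Uo gC g0; apply: (C1_comp Uo (k' := GRing.inv)) => // x Ux.
  by apply: is_derive1_ln; exact: g0.
by apply: (@continuousV R R^o id); [exact: lt0r_neq0 (g0 _ Ux)|exact: cvg_id].
Qed.
End log_calculus.

Section unique_continuation.
Variable R : realType.
Notation plane := 'rV[R]_2.
Implicit Types (x v : plane) (U : set plane).
Notation e0 := (e0 R).
Notation e1 := (e1 R).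
Notation square := (@square R).
Notation cutoff := (@cutoff R).

Definition grad2 (w1 w2 : plane -> R) x : R :=
  pd e0 w1 x * pd e0 w1 x + pd e1 w1 x * pd e1 w1 x
  + pd e0 w2 x * pd e0 w2 x + pd e1 w2 x * pd e1 w2 x.

Definition sqn (w1 w2 : plane -> R) x : R := w1 x * w1 x + w2 x * w2 x.

(** Regularization of log log (1 / |w|^2): where [sqn w1 w2 x < M + 1] and [eps <= 1], the constants
    keep the argument of the outer logarithm at least 1. *)
Definition loglog (w1 w2 : plane -> R) (M eps : R) x : R :=
  ln (1 + ln (M + 2) - ln (sqn w1 w2 x + eps)).

(* Caccioppoli estimate for [log log (1 / |w|)], uniform in the regularization
   parameter [eps]: test the Jacobian against [eta^2 w / (|w|^2 log (1 / |w|^2))]. *)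
Lemma loglog_energy U (w1 w2 : plane -> R) (c M eps : R) :
  open U -> square `<=` U -> C1 U w1 -> C1 U w2 -> 0 < c -> 0 < M -> 0 < eps <= 1 ->
  (forall x, U x -> sqn w1 w2 x < M + 1) ->
  (forall x, square x -> c * grad2 w1 w2 x <= jac w1 w2 x) ->
  (forall x, square x -> x ord0 0 = 0 -> w1 x = 0 /\ w2 x = 0) ->
  C1 U (loglog w1 w2 M eps) /\
  exists N0 : nat, forall N, (N0 <= N)%N -> (0 < N)%N ->
    \sum_(0 <= i < N) \sum_(0 <= j < N) (N%:R^-1) ^+ 2 *
      (cutoff (node R N i j) ^+ 2 * pd e0 (loglog w1 w2 M eps) (node R N i j) ^+ 2)
    <= (1 + 4 / c) * (4 / c).
Proof.
move=> Uo KU w1C w2C c0 M0 /andP[eps0 eps1] SM QR w0.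
pose S := sqn w1 w2.
pose T x := S x + eps.
pose L x := 1 + ln (M + 2) - ln (T x).
pose kap x := (T x * L x)^-1.
have S0 x : 0 <= S x by rewrite addr_ge0// -expr2 sqr_ge0.
have T0 x : 0 < T x by apply: lt_le_trans eps0 _; rewrite lerDr.
have L1 x : U x -> 1 <= L x.
  move=> Ux; rewrite /L -addrA lerDl subr_ge0 ler_ln ?posrE//; last by lra.
  by have := SM _ Ux; rewrite /T /S; lra.
have L0 x : U x -> 0 < L x by move=> Ux; exact: lt_le_trans ltr01 (L1 _ Ux).
have TL0 x : U x -> T x * L x != 0 by move=> Ux; rewrite lt0r_neq0// mulr_gt0// L0.
have SC : C1 U S := C1D Uo (C1M Uo w1C w1C) (C1M Uo w2C w2C).
have TC : C1 U T := C1D Uo SC (C1_cst U eps).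
have lnTC : C1 U (fun x => ln (T x)) by apply: C1_ln => // x _; exact: T0.
have LC : C1 U L := C1B Uo (C1_cst U _) lnTC.
have kapC : C1 U kap := C1V Uo (C1M Uo TC LC) TL0.
have vC : C1 U (loglog w1 w2 M eps) by apply: C1_ln.
split=> //.
pose D u x := 2 * (w1 x * pd u w1 x + w2 x * pd u w2 x).
have TD u x : U x -> pd u T x = D u x.
  move=> Ux; have d1 := C1_dif w1C Ux; have d2 := C1_dif w2C Ux.
  rewrite (pdD u (difD (difM d1 d1) (difM d2 d2)) (dif_cst eps x)) pd_cst addr0.
  by rewrite (pdD u (difM d1 d1) (difM d2 d2)) !pdM// /D; ring.
have LD u x : U x -> pd u L x = - (T x)^-1 * D u x.
  move=> Ux; rewrite (pdB u (dif_cst _ x) (C1_dif lnTC Ux)) pd_cst.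
  by rewrite (pd_ln u (C1_dif TC Ux) (T0 x)) TD// sub0r mulNr.
have vD u x : U x -> pd u (loglog w1 w2 M eps) x = - kap x * D u x.
  move=> Ux; rewrite (@pd_ln _ _ u L x (C1_dif LC Ux) (L0 _ Ux)) LD// /kap invfM; ring.
have kapD u x : U x -> pd u kap x = - (kap x * kap x * (L x - 1)) * D u x.
  move=> Ux; rewrite (pdV u (C1_dif (C1M Uo TC LC) Ux) (TL0 _ Ux)).
  rewrite (pdM u (C1_dif TC Ux) (C1_dif LC Ux)) TD// LD// /kap.
  by field; rewrite !lt0r_neq0// L0.
pose a (w : plane -> R) x := cutoff x * cutoff x * (w x * kap x).
have cC : C1 U cutoff := C1_cutoff Uo.
have aC w : C1 U w -> C1 U (a w).
  by move=> wC; exact: (C1M Uo (C1M Uo cC cC) (C1M Uo wC kapC)).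
have aD u w x : U x -> C1 U w -> pd u (a w) x =
    2 * cutoff x * pd u cutoff x * (w x * kap x) +
    cutoff x * cutoff x * (w x * (- (kap x * kap x * (L x - 1)) * D u x) + kap x * pd u w x).
  move=> Ux wC; have dc := C1_dif cC Ux; have dw := C1_dif wC Ux; have dk := C1_dif kapC Ux.
  by rewrite (pdM u (difM dc dc) (difM dw dk)) (pdM u dc dc) (pdM u dw dk) kapD//; ring.
(* The grid sums for [a_1 dw_2] and [a_2 dw_1] are each at most 1/2 in absolute value, so their
   difference is at most 1. *)
have half0 : (0 : R) < 1 / 2 by rewrite divr_gt0.
have bd w x : square x -> (x ord0 0 = 0 -> w x = 0) ->
    x ord0 0 = 0 \/ x ord0 0 = 1 \/ x ord0 1 = 0 \/ x ord0 1 = 1 -> a w x = 0.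
  move=> Kx wx; rewrite /a /cutoff => -[/wx ->|[->|[->|->]]];
  by rewrite ?subrr ?mul0r ?mulr0 ?mul0r.
have [N1 H1] := grid_Stokes Uo KU (aC _ w1C) w2C half0
  (fun x Kx => @bd w1 x Kx (fun h => proj1 (w0 _ Kx h))).
have [N2 H2] := grid_Stokes Uo KU (aC _ w2C) w1C half0
  (fun x Kx => @bd w2 x Kx (fun h => proj2 (w0 _ Kx h))).
exists (maxn N1 N2) => N; rewrite geq_max => /andP[NN1 NN2] N0.
have N0' : (0 : R) < N%:R by rewrite ltr0n.
have := lerD (H1 _ NN1 N0) (H2 _ NN2 N0).
set A := \sum_(0 <= i < N) _; set B := \sum_(0 <= i < N) _ => AB.
have {}AB : A - B <= 1.
  by apply: le_trans (ler_norm _) _; apply: le_trans (ler_normB _ _) _; lra.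
have {}AB : \sum_(0 <= i < N) \sum_(0 <= j < N) (N%:R^-1) ^+ 2 *
    (c / 4 * (cutoff (node R N i j) ^+ 2 * pd e0 (loglog w1 w2 M eps) (node R N i j) ^+ 2) - 4 / c) <= 1.
  apply: le_trans AB; rewrite -sumrB; apply: ler_sum_nat => i /andP[_ iN].
  rewrite -sumrB; apply: ler_sum_nat => j /andP[_ jN].
  rewrite -mulrBr ler_wpM2l ?sqr_ge0//.
  have Kx := node_square R N0 (ltnW iN) (ltnW jN).
  move: (node R N i j) Kx => x Kx; have Ux := KU _ Kx.
  rewrite /jac !aD// vD//.
  apply: (@energy_density R (w1 x) (w2 x) _ _ _ _ (cutoff x) _ _ (T x) (L x) (kap x) eps) => //.
  - exact: L1.
  - by rewrite /kap mulVf// TL0.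
  - rewrite pd_cutoff e00 e01 !mulr0 add0r mulr1 normrN.
    by case: Kx => _ /andP[x0 x1]; rewrite ger0_norm ?mulr_ge0 ?subr_ge0//; nra.
  - rewrite pd_cutoff e10 e11 mulr0 subr0 mulr1 normrM.
    case: Kx => /andP[y0 y1] /andP[x0 x1]; apply: mulr_ile1 => //.
      by rewrite ger0_norm ?subr_ge0//; lra.
    by rewrite ler_norml; apply/andP; split; lra.
  - exact: QR.
set Q := (X in X <= _).
have : c / 4 * Q - 4 / c <= 1.
  apply: le_trans AB; rewrite /Q mulr_sumr.
  have E : 4 / c = \sum_(0 <= i < N) \sum_(0 <= j < N) (N%:R^-1) ^+ 2 * (4 / c).
    rewrite !sumr_const_nat subn0 -[_ *+ N *+ N]mulr_natr -[_ *+ N]mulr_natr.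
    by field; rewrite !lt0r_neq0.
  rewrite {1}E -sumrB; apply: ler_sum_nat => i _; rewrite mulr_sumr -sumrB.
  apply: ler_sum_nat => j _.
  by rewrite le_eqVlt; apply/orP; left; apply/eqP; ring.
rewrite lerBlDr => H.
have c4 : 0 < c / 4 by rewrite divr_gt0.
rewrite -(ler_pM2l c4); apply: le_trans H _.
by rewrite le_eqVlt; apply/orP; left; apply/eqP; field; exact: lt0r_neq0.
Qed.
End unique_continuation.

Section square_unique_continuation.
Variable R : realType.
Notation plane := 'rV[R]_2.
Implicit Types (x v : plane) (U : set plane).
Notation e0 := (e0 R).
Notation e1 := (e1 R).
Notation square := (@square R).
Notation cutoff := (@cutoff R).

Lemma open_sublevel U (g : plane -> R) (a : R) : open U ->
  (forall x, U x -> cont g x) -> open [set x | U x /\ g x < a].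
Proof.
move=> Uo gc; rewrite openE => x [Ux gx].
have gap : 0 < a - g x by rewrite subr_gt0.
have /cvgrPdist_lt /(_ _ gap) H := gc x Ux.
near=> y; split; first by near: y; exact: (near_open Uo Ux).
have : `|g x - g y| < a - g x by near: y; exact: H.
by rewrite distrC => /ltr_normlW; rewrite ltrBlDr subrK.
Unshelve. all: by end_near. Qed.

(** Near a point where [w] is nonzero, [loglog] stays below some [B] independent of [eps], whereas
    on the side [x_0 = 0] it exceeds any given [Z] for small [eps]. All grid lines through a fixed
    neighborhood then drop by [Z - B], which costs more energy than [loglog_energy] allows. *)
Lemma square_unique_continuation U (w1 w2 : plane -> R) (c : R) :
  open U -> square `<=` U -> C1 U w1 -> C1 U w2 -> 0 < c ->
  (forall x, square x -> c * grad2 w1 w2 x <= jac w1 w2 x) ->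
  (forall x, square x -> x ord0 0 = 0 -> w1 x = 0 /\ w2 x = 0) ->
  forall x, square x -> x ord0 0 < 1 -> 0 < x ord0 1 < 1 -> w1 x = 0 /\ w2 x = 0.
Proof.
move=> Uo KU w1C w2C c0 QR w0 x Kx s1 /andP[t0 t1].
have [s0 t01] := Kx.
set s := x ord0 0 in s0 s1 *; set t := x ord0 1 in t0 t1 t01 *.
have SC : C1 U (sqn w1 w2) := C1D Uo (C1M Uo w1C w1C) (C1M Uo w2C w2C).
have S0 y : 0 <= sqn w1 w2 y by rewrite addr_ge0// -expr2 sqr_ge0.
have [] := ltP 0 (sqn w1 w2 x); last first.
  move=> Sx; have : sqn w1 w2 x == 0 by rewrite eq_le Sx S0.
  rewrite /sqn paddr_eq0 -?expr2 ?sqr_ge0// !sqrf_eq0.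
  by move=> /andP[/eqP ? /eqP ?].
move=> Sx; exfalso.
have [M M0 SM] := square_cont_bounded KU (fun y => C1_cont SC).
pose U' := [set y | U y /\ sqn w1 w2 y < M + 1].
have U'o : open U' by apply: open_sublevel => // y Uy; exact: C1_cont SC Uy.
have U'U : U' `<=` U by move=> y [].
have KU' : square `<=` U'.
  move=> y Ky; split; first exact: KU.
  by apply: le_lt_trans (ler_norm _) _; apply: le_lt_trans (SM _ Ky) _; rewrite ltrDl.
have SU' y : U' y -> sqn w1 w2 y < M + 1 by case.
pose del := sqn w1 w2 x / 2.
have del0 : 0 < del by rewrite divr_gt0.
have /cvgrPdist_lt /(_ _ del0) /nbhs_normP[r /= r0 Hr] := C1_cont SC (KU _ Kx).
have {}Hr y : `|x - y| < r -> del < sqn w1 w2 y.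
  move=> /Hr /= /ltr_normlW; rewrite /del; lra.
(* Within distance [q] of [x], [sqn] exceeds [del] and the second coordinate keeps half of its
   distance to 0 and to 1. *)
pose q := Num.min r (Num.min (t / 2) ((1 - t) / 2)).
have q0 : 0 < q by rewrite !lt_min r0 !divr_gt0// subr_gt0.
pose m := (Num.bound q^-1).+1.
have m0 : (0 : R) < m%:R by rewrite ltr0n.
have mq : m%:R^-1 < q.
  rewrite -[q]invrK ltf_pV2 ?posrE ?invr_gt0//.
  apply: lt_le_trans (archi_boundP _) _; first by rewrite invr_ge0 ltW.
  by rewrite ler_nat.
(* The coarse cell of side [1 / m] that contains [x]. The fine grid has [m * n] steps, so row [j1]
   carries [n] fine lines and column [i1] is reached after [i1 * n] steps: [n] can grow while the
   fraction [1 / m] of lines is fixed. *)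
pose i1 := Num.truncn (s * m%:R); pose j1 := Num.truncn (t * m%:R).
have /andP[s0' _] := s0.
have sm0 : 0 <= s * m%:R by rewrite mulr_ge0// ltW.
have tm0 : 0 <= t * m%:R by rewrite mulr_ge0// ltW.
have /andP[i1l i1u] := truncn_itv sm0; have /andP[j1l j1u] := truncn_itv tm0.
have i1m : (i1 < m)%N.
  by rewrite -(ltr_nat R); apply: le_lt_trans i1l _; rewrite gtr_pMl.
have j1m : (j1 < m)%N.
  by rewrite -(ltr_nat R); apply: le_lt_trans j1l _; rewrite gtr_pMl.
(* Lower bound of the cutoff on the parts of these lines with first coordinate at most [s]. *)
pose eta0 := (1 - s) * ((t / 2) * ((1 - t) / 2)).
have eta00 : 0 < eta0 by rewrite !mulr_gt0 ?subr_gt0// divr_gt0 ?subr_gt0.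
pose C0 := (1 + 4 / c) * (4 / c).
pose B := ln (1 + ln (M + 2) - ln del).
(* Makes the capacity bound [eta0 ^+ 2 / m * (Z - B - 2)] equal to [eta0 ^+ 2 / m + C0], more than
   the energy bound [C0]. *)
pose Z := B + 3 + C0 * m%:R / eta0 ^+ 2.
(* On the side [x_0 = 0], [loglog] is the logarithm of a quantity that is at least
   [- ln eps = expR Z]. *)
pose eps : R := expR (- expR Z).
have eps01 : 0 < eps <= 1.
  by rewrite expR_gt0/= -expR0 ler_expR oppr_le0 expR_ge0.
have [vC [N1 HN1]] := loglog_energy U'o KU' (C1_subset U'U w1C) (C1_subset U'U w2C)
  c0 M0 eps01 SU' QR w0.
have [N2 HN2] := grid_increment U'o KU' vC ltr01.
pose n := (maxn N1 N2).+1; pose N := (m * n)%N.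
have nN : (n <= N)%N by rewrite leq_pmull.
have N0 : (0 < N)%N by apply: leq_trans nN.
have NN1 : (N1 <= N)%N by apply: leq_trans nN; rewrite leqW// leq_maxl.
have NN2 : (N2 <= N)%N by apply: leq_trans nN; rewrite leqW// leq_maxr.
have Npos : (0 : R) < N%:R by rewrite ltr0n.
have npos : (0 : R) < n%:R by rewrite ltr0n.
have NE : N%:R = m%:R * n%:R :> R by rewrite natrM.
set v := loglog w1 w2 M eps in vC HN1 HN2.
have jn j : (j1 * n <= j < j1 * n + n)%N -> (j <= N)%N.
  move=> /andP[_ jn]; apply: leq_trans (ltnW jn) _.
  by rewrite addnC -mulSn leq_mul2r j1m orbT.
have coordj j : (j1 * n <= j < j1 * n + n)%N -> `|t - j%:R / N%:R| <= m%:R^-1.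
  move=> /andP[ja jb]; rewrite NE.
  have jl : j1%:R * n%:R <= j%:R :> R by rewrite -natrM ler_nat.
  have ju : j%:R <= (j1%:R + 1) * n%:R :> R.
    by rewrite natr1 -natrM ler_nat mulSn addnC ltnW.
  have jd : j%:R / (m%:R * n%:R) = (j%:R / n%:R) / m%:R :> R.
    by field; rewrite !lt0r_neq0.
  have jl' : j1%:R <= j%:R / n%:R :> R by rewrite ler_pdivlMr.
  have ju' : j%:R / n%:R <= j1%:R + 1 :> R by rewrite ler_pdivrMr.
  rewrite jd -(ler_pM2r m0) mulVf ?lt0r_neq0// -[X in _ * X](gtr0_norm m0) -normrM.
  rewrite mulrBl divfK ?lt0r_neq0// ler_norml.
  by rewrite -natr1 in j1u; clear - jl' ju' j1l j1u; apply/andP; split; lra.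
have i1n : (i1 * n <= N)%N by rewrite leq_mul2r (ltnW i1m) orbT.
have coordi : `|s - (i1 * n)%:R / N%:R| <= m%:R^-1.
  have -> : (i1 * n)%:R / N%:R = i1%:R / m%:R :> R.
    by rewrite NE natrM; field; rewrite !lt0r_neq0.
  rewrite -(ler_pM2r m0) mulVf ?lt0r_neq0// -[X in _ * X](gtr0_norm m0) -normrM.
  rewrite mulrBl divfK ?lt0r_neq0// ler_norml.
  by rewrite -natr1 in i1u; clear - i1l i1u; apply/andP; split; lra.
have qr : q <= r by rewrite ge_min lexx.
have qt : q <= t / 2 by rewrite !ge_min lexx orbT.
have qt' : q <= (1 - t) / 2 by rewrite !ge_min lexx !orbT.
have h0 : (0 : R) <= N%:R^-1 by rewrite invr_ge0 ltW.
have drop j : (j1 * n <= j < j1 * n + n)%N ->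
    Z - B <= v (node R N 0 j) - v (node R N (i1 * n) j).
  move=> jj; have jN := jn _ jj.
  have K0 := node_square R N0 (leq0n N) jN.
  have K1 := node_square R N0 i1n jN.
  apply: lerB.
    have [z1 z2] : w1 (node R N 0 j) = 0 /\ w2 (node R N 0 j) = 0.
      by apply: w0 => //; rewrite pt0 mul0r.
    rewrite /v /loglog /sqn z1 z2 mul0r !add0r /eps expRK opprK.
    rewrite -[X in X <= _](expRK Z) ler_ln ?posrE ?expR_gt0//.
      by rewrite lerDr addr_ge0// ln_ge0//; clear - M0; lra.
    by rewrite ltr_wpDl ?expR_gt0// addr_ge0// ln_ge0//; clear - M0; lra.
  have Sdel : del < sqn w1 w2 (node R N (i1 * n) j).
    apply: Hr; rewrite plane_norm_lt !mxE/=; apply/andP; split.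
      by apply: le_lt_trans coordi _; apply: lt_le_trans mq qr.
    by apply: le_lt_trans (coordj _ jj) _; apply: lt_le_trans mq qr.
  have [_ SM1] := KU' _ K1.
  case/andP: eps01 => eps0 eps1.
  have ln2 : ln (sqn w1 w2 (node R N (i1 * n) j) + eps) <= ln (M + 2).
    rewrite ler_ln ?posrE; [by move: SM1 => /=; clear - eps1; lra|by rewrite ltr_wpDl|by clear - M0; lra].
  have ln3 : ln del <= ln (sqn w1 w2 (node R N (i1 * n) j) + eps).
    by rewrite ler_ln ?posrE//; [clear - Sdel eps0; lra|rewrite ltr_wpDl].
  by rewrite /v /loglog /B ler_ln ?posrE; clear - ln2 ln3; lra.
have := @discrete_capacity R (fun i j => v (node R N i j)) (fun i j => pd e0 v (node R N i j))
  (fun i j => cutoff (node R N i j)) (N%:R^-1) (Z - B) eta0 C0 N (i1 * n)%N (j1 * n)%N n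
  h0 _ i1n _ (ltW eta00) _ drop _ (HN1 _ NN1 N0).
have -> : n%:R / N%:R = m%:R^-1 :> R by rewrite NE; field; rewrite !lt0r_neq0.
have -> : Z - B - 2 = 1 + C0 * m%:R / eta0 ^+ 2 by rewrite /Z; ring.
rewrite mulrDr mulr1.
have -> : eta0 ^+ 2 / m%:R * (C0 * m%:R / eta0 ^+ 2) = C0.
  by field; rewrite !lt0r_neq0.
have pos : 0 < eta0 ^+ 2 / m%:R by rewrite divr_gt0// exprn_gt0.
move=> H; suff : eta0 ^+ 2 / m%:R + C0 <= C0 by clear - pos; lra.
apply: H.
- by rewrite divff// lt0r_neq0.
- by rewrite addnC -mulSn leq_mul2r j1m orbT.
- move=> i j iN jN; have [+ _ _] := HN2 _ NN2 N0 _ _ iN jN.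
  rewrite mul1r; set V1 := v _; set V0 := v _; set P := pd _ _ _ => H.
  have : - (V1 - V0 - N%:R^-1 * P) <= N%:R^-1 by apply: le_trans (ler_norm _) _; rewrite normrN.
  have : N%:R^-1 * - P <= N%:R^-1 * `|P| by rewrite ler_wpM2l// -normrN ler_norm.
  by rewrite mulrDr mulr1 mulrN; clear; lra.
- move=> i j ii jj; rewrite /eta0 /cutoff pt0 pt1.
  have := coordj _ jj; rewrite ler_norml => /andP[k1 k2].
  have is' : i%:R / N%:R <= s.
    rewrite ler_pdivrMr//; apply: (@le_trans _ _ (i1 * n)%:R); first by rewrite ler_nat ltnW.
    by rewrite NE natrM mulrA ler_wpM2r// ltW.
  apply: ler_pM; rewrite ?mulr_ge0 ?subr_ge0 ?divr_ge0 ?subr_ge0 ?(ltW s1) ?(ltW t0) ?(ltW t1)//.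
    by rewrite lerD2l lerN2.
  apply: ler_pM; rewrite ?divr_ge0 ?subr_ge0 ?(ltW t0) ?(ltW t1)//; clear - k1 k2 mq qt qt' t0 t1; lra.
Qed.
End square_unique_continuation.

(** * Vector algebra in space: rotation fields, ellipticity, frames along a curve *)

Section space.
Variable R : realType.
Notation vec := 'rV[R]_3.
Implicit Types (u v w a b : vec).

Notation i0 := (0 : 'I_3).
Notation i1 := (1 : 'I_3).
Notation i2 := (2%:R : 'I_3).

Lemma ord3P (i : 'I_3) : [\/ i = i0, i = i1 | i = i2].
Proof.
case: i => [[|[|[|//]]] Hi]; [apply: Or31|apply: Or32|apply: Or33]; exact/val_inj.
Qed.

Lemma vec_eqP u v : u ord0 i0 = v ord0 i0 -> u ord0 i1 = v ord0 i1 ->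
  u ord0 i2 = v ord0 i2 -> u = v.
Proof. by move=> h0 h1 h2; apply/rowP => i; case: (ord3P i) => ->. Qed.

Lemma dotE u v : dot u v = u ord0 i0 * v ord0 i0 + u ord0 i1 * v ord0 i1 + u ord0 i2 * v ord0 i2.
Proof.
rewrite /dot !big_ord_recl big_ord0 addr0 addrA.
by congr (_ * _ + _ * _ + _ * _); congr fun_of_matrix; exact/val_inj.
Qed.

Lemma cross0E u v : cross u v ord0 i0 = u ord0 i1 * v ord0 i2 - u ord0 i2 * v ord0 i1.
Proof. by rewrite mxE !add0r. Qed.

Lemma cross1E u v : cross u v ord0 i1 = u ord0 i2 * v ord0 i0 - u ord0 i0 * v ord0 i2.
Proof.
rewrite mxE (_ : i1 + 1 = i2); last exact/val_inj.
by rewrite (_ : i1 + 2%:R = i0)//; exact/val_inj.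
Qed.

Lemma cross2E u v : cross u v ord0 i2 = u ord0 i0 * v ord0 i1 - u ord0 i1 * v ord0 i0.
Proof.
rewrite mxE (_ : i2 + 1 = i0); last exact/val_inj.
by rewrite (_ : i2 + 2%:R = i1)//; exact/val_inj.
Qed.

Definition vecE := (dotE, cross0E, cross1E, cross2E, mxE).

Lemma dotC u v : dot u v = dot v u. Proof. by rewrite !dotE; ring. Qed.
Lemma dotDl u v w : dot (u + v) w = dot u w + dot v w.
Proof. by rewrite !vecE; ring. Qed.
Lemma dotZr (k : R) u v : dot u (k *: v) = k * dot u v.
Proof. by rewrite !vecE; ring. Qed.

Lemma dot_ge0 u : 0 <= dot u u.
Proof. by rewrite dotE !addr_ge0// -expr2 sqr_ge0. Qed.

Lemma dot_eq0 u : dot u u = 0 -> u = 0.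
Proof.
move=> /eqP; rewrite dotE -!expr2 !paddr_eq0 ?addr_ge0 ?sqr_ge0// !sqrf_eq0.
by move=> /andP[/andP[/eqP h0 /eqP h1] /eqP h2]; apply: vec_eqP; rewrite mxE.
Qed.

Lemma crossC u v : cross u v = - cross v u.
Proof. by apply: vec_eqP; rewrite !vecE; ring. Qed.

(* The rotation field [omega] of an infinitesimal isometric deformation with
   partial derivatives [u1, u2] of a surface with tangent frame [m1, m2]. *)
Definition rotation (m1 m2 u1 u2 : vec) : vec :=
  let nu := cross m1 m2 in
  (dot nu nu)^-1 *: (dot u2 nu *: m1 - dot u1 nu *: m2 + dot u1 m2 *: nu).

Lemma rotationE m1 m2 u1 u2 : dot (cross m1 m2) (cross m1 m2) != 0 ->
  dot u1 m1 = 0 -> dot u2 m2 = 0 -> dot u1 m2 + dot u2 m1 = 0 ->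
  cross (rotation m1 m2 u1 u2) m1 = u1 /\ cross (rotation m1 m2 u1 u2) m2 = u2.
Proof.
move=> nu0 h11 h22 h12; set nu := cross m1 m2 in nu0 *.
have {}h12 : dot u2 m1 = - dot u1 m2 by apply/eqP; rewrite -addr_eq0 addrC h12.
have decomp w : dot nu nu *: w = dot w nu *: nu +
    (dot w m1 * dot m2 m2 - dot w m2 * dot m1 m2) *: m1 +
    (dot w m2 * dot m1 m1 - dot w m1 * dot m1 m2) *: m2.
  by apply: vec_eqP; rewrite /nu !vecE; ring.
have crossZ (k : R) w w' : cross (k *: w) w' = k *: cross w w'.
  by apply: vec_eqP; rewrite !vecE; ring.
split; apply: (scalerI nu0); rewrite [RHS]decomp /rotation crossZ scalerA divff// scale1r.
  rewrite h11.
  by apply: vec_eqP; rewrite /nu !vecE; ring.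
rewrite h22 h12.
by apply: vec_eqP; rewrite /nu !vecE; ring.
Qed.

Lemma rotation_eq0 m1 m2 : rotation m1 m2 0 0 = 0.
Proof.
have d0 w : dot 0 w = 0 by rewrite !vecE; ring.
by rewrite /rotation !d0 !scale0r subrr addr0 scaler0.
Qed.

(* The two compatibility relations of the derivatives [a, b] of the rotation
   field make its matrix in the frame [m1, m2] trace-free and orthogonal to the
   second fundamental form. *)
Lemma rotation_derivative m1 m2 m11 m12 m22 a b :
  let nu := cross m1 m2 in
  dot nu nu != 0 -> cross a m2 = cross b m1 ->
  dot a (cross m12 m2 + cross m1 m22) = dot b (cross m11 m2 + cross m1 m12) ->
  exists al be ga : R, [/\ a = al *: m1 + be *: m2, b = ga *: m1 - al *: m2 &
    dot m11 nu * ga = 2 * dot m12 nu * al + dot m22 nu * be].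
Proof.
move=> nu nu0 R1 R2.
(* Pairing the first relation with [m1], and then with [m2], kills one of its sides, so [a] and [b]
   are tangent. *)
have aN : dot a nu = 0.
  have -> : dot a nu = - dot (cross a m2) m1 by rewrite /nu !vecE; ring.
  by rewrite R1 !vecE; ring.
have bN : dot b nu = 0.
  have -> : dot b nu = dot (cross b m1) m2 by rewrite /nu !vecE; ring.
  by rewrite -R1 !vecE; ring.
have decomp w : dot w nu = 0 -> w = (dot (cross w m2) nu / dot nu nu) *: m1
    + (dot (cross m1 w) nu / dot nu nu) *: m2.
  move=> wN; have E : dot nu nu *: w = dot (cross w m2) nu *: m1 + dot (cross m1 w) nu *: m2
      + dot w nu *: nu by apply: vec_eqP; rewrite /nu !vecE; ring.
  apply: (scalerI nu0); rewrite E wN scale0r addr0 scalerDr !scalerA.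
  by rewrite ![dot nu nu * _]mulrC !divfK.
exists (dot (cross a m2) nu / dot nu nu), (dot (cross m1 a) nu / dot nu nu),
  (dot (cross b m2) nu / dot nu nu).
set al := _ / _; set be := _ / _; set ga := _ / _.
have aE : a = al *: m1 + be *: m2 by exact: decomp.
have bE : b = ga *: m1 - al *: m2.
  rewrite (decomp b bN) -/ga; congr (_ + _); rewrite -scaleNr; congr (_ *: _).
  rewrite /al R1 -mulNr; congr (_ / _).
  by rewrite (crossC b m1) !vecE; ring.
split=> //.
move: R2; rewrite aE bE => R2.
apply/eqP; rewrite -subr_eq0; apply/eqP.
transitivity (dot (al *: m1 + be *: m2) (cross m12 m2 + cross m1 m22)
  - dot (ga *: m1 - al *: m2) (cross m11 m2 + cross m1 m12)); last by rewrite R2 subrr.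
by rewrite /nu !vecE; ring.
Qed.

(** The relation is eliminated by multiplying [X = al ^+ 2 + be * ga] by [L ^+ 2] and by [L * N]:
    completing the square leaves [L * N - M ^+ 2] times [be ^+ 2], respectively [al ^+ 2]. The bound
    on [ga] comes from the relation itself together with [d ^+ 2 <= L ^+ 2 * K ^+ 2]. In the
    denominator, [al] and [be] contribute [K ^+ 2 * d ^+ 2] each, and [ga] contributes
    [10 * K ^+ 6]. *)
Lemma ellipticity (L M N al be ga K d : R) : 0 < d -> 0 < K ->
  `|L| <= K -> `|M| <= K -> `|N| <= K -> d <= L * N - M ^+ 2 ->
  L * ga = 2 * M * al + N * be ->
  (d ^+ 3 / (10 * K ^+ 6 + 2 * K ^+ 2 * d ^+ 2)) * (al ^+ 2 + be ^+ 2 + ga ^+ 2) <=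
    al ^+ 2 + be * ga.
Proof.
move=> d0 K0 LK MK NK dLMN E.
have sq (x : R) : `|x| <= K -> x ^+ 2 <= K ^+ 2.
  by move=> xK; rewrite -[x ^+ 2]real_normK ?num_real// ler_sqr ?nnegrE// ltW.
have L2 := sq _ LK; have M2 := sq _ MK; have N2 := sq _ NK.
set X := al ^+ 2 + be * ga.
have LQ : L ^+ 2 * X = (L * al + M * be) ^+ 2 + (L * N - M ^+ 2) * be ^+ 2.
  have -> : L ^+ 2 * X = L ^+ 2 * al ^+ 2 + L * be * (L * ga) by rewrite /X; ring.
  by rewrite E; ring.
have NQ : L * N * X = (M * al + N * be) ^+ 2 + (L * N - M ^+ 2) * al ^+ 2.
  have -> : L * N * X = L * N * al ^+ 2 + N * be * (L * ga) by rewrite /X; ring.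
  by rewrite E; ring.
have LN : d <= L * N by have := sqr_ge0 M; lra.
have LN0 : 0 < L * N by apply: lt_le_trans LN.
have LN2 : L * N <= K ^+ 2.
  apply: le_trans (ler_norm _) _; rewrite normrM expr2.
  exact: ler_pM.
have be2 : d * be ^+ 2 <= L ^+ 2 * X.
  rewrite LQ; apply: ler_wpDl; first exact: sqr_ge0.
  by rewrite ler_wpM2r ?sqr_ge0.
have al2 : d * al ^+ 2 <= L * N * X.
  rewrite NQ; apply: ler_wpDl; first exact: sqr_ge0.
  by rewrite ler_wpM2r ?sqr_ge0.
have X0 : 0 <= X.
  by rewrite -(pmulr_rge0 _ LN0); apply: le_trans al2; rewrite mulr_ge0 ?sqr_ge0// ltW.
have al2' : d * al ^+ 2 <= K ^+ 2 * X by apply: le_trans al2 _; rewrite ler_wpM2r.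
have be2' : d * be ^+ 2 <= K ^+ 2 * X by apply: le_trans be2 _; rewrite ler_wpM2r.
have d2 : d ^+ 2 <= L ^+ 2 * K ^+ 2.
  apply: (@le_trans _ _ ((L * N) ^+ 2)); first by rewrite ler_sqr ?nnegrE// ltW.
  by rewrite exprMn ler_wpM2l ?sqr_ge0.
have ga2 : d ^+ 2 * ga ^+ 2 <= K ^+ 2 * (8 * K ^+ 2 * al ^+ 2 + 2 * K ^+ 2 * be ^+ 2).
  apply: (@le_trans _ _ (K ^+ 2 * (L * ga) ^+ 2)).
    have -> : K ^+ 2 * (L * ga) ^+ 2 = L ^+ 2 * K ^+ 2 * ga ^+ 2 by ring.
    by rewrite ler_wpM2r ?sqr_ge0.
  rewrite ler_wpM2l ?sqr_ge0// E.
  have h := sqr_ge0 (2 * M * al - N * be).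
  have h1 : M ^+ 2 * al ^+ 2 <= K ^+ 2 * al ^+ 2 by rewrite ler_wpM2r ?sqr_ge0.
  have h2 : N ^+ 2 * be ^+ 2 <= K ^+ 2 * be ^+ 2 by rewrite ler_wpM2r ?sqr_ge0.
  have -> : (2 * M * al + N * be) ^+ 2 =
    8 * (M ^+ 2 * al ^+ 2) + 2 * (N ^+ 2 * be ^+ 2) - (2 * M * al - N * be) ^+ 2 by ring.
  by lra.
have ga3 : d ^+ 3 * ga ^+ 2 <= 10 * K ^+ 6 * X.
  have -> : d ^+ 3 * ga ^+ 2 = d * (d ^+ 2 * ga ^+ 2) by ring.
  apply: (@le_trans _ _ (d * (K ^+ 2 * (8 * K ^+ 2 * al ^+ 2 + 2 * K ^+ 2 * be ^+ 2)))).
    by rewrite ler_wpM2l// ltW.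
  have -> : d * (K ^+ 2 * (8 * K ^+ 2 * al ^+ 2 + 2 * K ^+ 2 * be ^+ 2)) =
    K ^+ 4 * (8 * (d * al ^+ 2) + 2 * (d * be ^+ 2)) by ring.
  have -> : 10 * K ^+ 6 * X = K ^+ 4 * (8 * (K ^+ 2 * X) + 2 * (K ^+ 2 * X)) by ring.
  by rewrite ler_wpM2l ?exprn_ge0 ?(ltW K0)//; lra.
have den : 0 < 10 * K ^+ 6 + 2 * K ^+ 2 * d ^+ 2.
  by rewrite addr_gt0 ?mulr_gt0 ?exprn_gt0.
rewrite mulrAC ler_pdivrMr// mulrDr mulrDr.
have d3 (y : R) : d * y ^+ 2 <= K ^+ 2 * X -> d ^+ 3 * y ^+ 2 <= d ^+ 2 * (K ^+ 2 * X).
  move=> h; have -> : d ^+ 3 * y ^+ 2 = d ^+ 2 * (d * y ^+ 2) by ring.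
  by rewrite ler_wpM2l ?sqr_ge0.
apply: le_trans (lerD (lerD (d3 _ al2') (d3 _ be2')) ga3) _.
by rewrite le_eqVlt; apply/orP; left; apply/eqP; ring.
Qed.

(** The cross term is the mixed discriminant, which is positive for definite forms of the same sign;
    [0 < L * L'] compares the signs. *)
Lemma definite_sum (L M N L' M' N' : R) : 0 < L * N - M ^+ 2 -> 0 < L' * N' - M' ^+ 2 ->
  0 < L * L' -> 0 < (L + L') * (N + N') - (M + M') ^+ 2.
Proof.
move=> h h' hL.
have L0 : L != 0 by apply: contraTneq hL => ->; rewrite mul0r ltxx.
have L0' : L' != 0 by apply: contraTneq hL => ->; rewrite mulr0 ltxx.
have mixed : 0 < L * N' + L' * N - 2 * M * M'.
  rewrite -(pmulr_rgt0 _ hL).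
  have -> : L * L' * (L * N' + L' * N - 2 * M * M') =
    L ^+ 2 * (L' * N' - M' ^+ 2) + L' ^+ 2 * (L * N - M ^+ 2) + (L * M' - L' * M) ^+ 2 by ring.
  by rewrite ltr_wpDr ?sqr_ge0// addr_gt0// mulr_gt0// exprn_even_gt0.
have -> : (L + L') * (N + N') - (M + M') ^+ 2 =
  (L * N - M ^+ 2) + (L' * N' - M' ^+ 2) + (L * N' + L' * N - 2 * M * M') by ring.
by rewrite addr_gt0// addr_gt0.
Qed.

(* [F] and [G] stand for two isometric immersions agreeing along a curve with
   velocity [(p, q)] and acceleration [(p', q')] in coordinates. *)
Lemma frames_agree (F1 F2 F11 F12 F22 G1 G2 G11 G12 G22 : vec) (p q p' q' : R) :
  dot F1 F1 = dot G1 G1 -> dot F1 F2 = dot G1 G2 -> dot F2 F2 = dot G2 G2 ->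
  dot F11 F1 = dot G11 G1 -> dot F11 F2 = dot G11 G2 ->
  dot F12 F1 = dot G12 G1 -> dot F12 F2 = dot G12 G2 ->
  dot F22 F1 = dot G22 G1 -> dot F22 F2 = dot G22 G2 ->
  0 < dot F11 (cross F1 F2) * dot F22 (cross F1 F2) - dot F12 (cross F1 F2) ^+ 2 ->
  0 < dot G11 (cross G1 G2) * dot G22 (cross G1 G2) - dot G12 (cross G1 G2) ^+ 2 ->
  0 < dot F11 (cross F1 F2) * dot G11 (cross G1 G2) ->
  (p != 0) || (q != 0) ->
  p *: F1 + q *: F2 = p *: G1 + q *: G2 ->
  p ^+ 2 *: F11 + (2 * p * q) *: F12 + q ^+ 2 *: F22 + p' *: F1 + q' *: F2 =
  p ^+ 2 *: G11 + (2 * p * q) *: G12 + q ^+ 2 *: G22 + p' *: G1 + q' *: G2 ->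
  F1 = G1 /\ F2 = G2.
Proof.
move=> E11 E12 E22 C111 C112 C121 C122 C221 C222 dF dG LL pq tE XE.
set X := p ^+ 2 *: F11 + _ + _ + _ + _ in XE.
set t := p *: F1 + q *: F2 in tE.
have XF1 : dot X F1 = p ^+ 2 * dot F11 F1 + 2 * p * q * dot F12 F1 + q ^+ 2 * dot F22 F1
   + p' * dot F1 F1 + q' * dot F1 F2 by rewrite /X !vecE; ring.
have XG1 : dot X G1 = p ^+ 2 * dot G11 G1 + 2 * p * q * dot G12 G1 + q ^+ 2 * dot G22 G1
   + p' * dot G1 G1 + q' * dot G1 G2 by rewrite XE !vecE; ring.
have XF2 : dot X F2 = p ^+ 2 * dot F11 F2 + 2 * p * q * dot F12 F2 + q ^+ 2 * dot F22 F2
   + p' * dot F1 F2 + q' * dot F2 F2 by rewrite /X !vecE; ring.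
have XG2 : dot X G2 = p ^+ 2 * dot G11 G2 + 2 * p * q * dot G12 G2 + q ^+ 2 * dot G22 G2
   + p' * dot G1 G2 + q' * dot G2 G2 by rewrite XE !vecE; ring.
have X1 : dot X F1 = dot X G1 by rewrite XF1 XG1 C111 C121 C221 E11 E12.
have X2 : dot X F2 = dot X G2 by rewrite XF2 XG2 C112 C122 C222 E22 E12.
pose II (L M N : R) := p ^+ 2 * L + 2 * p * q * M + q ^+ 2 * N.
have XnF : dot X (cross F1 F2) = II (dot F11 (cross F1 F2)) (dot F12 (cross F1 F2)) (dot F22 (cross F1 F2)).
  by rewrite /II /X !vecE; ring.
have XnG : dot X (cross G1 G2) = II (dot G11 (cross G1 G2)) (dot G12 (cross G1 G2)) (dot G22 (cross G1 G2)).
  by rewrite /II XE !vecE; ring.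
have gram a b w : dot w (cross a b) ^+ 2 =
    dot w w * (dot a a * dot b b - dot a b ^+ 2)
    - dot w a * (dot w a * dot b b - dot w b * dot a b)
    + dot w b * (dot w a * dot a b - dot w b * dot a a) by rewrite !vecE; ring.
have XX : dot X (cross F1 F2) ^+ 2 = dot X (cross G1 G2) ^+ 2.
  by rewrite !gram X1 X2 E11 E12 E22.
(* A definite form takes values of the sign of its first coefficient. By [LL] these signs are equal
   for the two surfaces, which excludes opposite products of [X] with the normals. *)
have pos (L M N : R) : 0 < L * N - M ^+ 2 -> 0 < L * II L M N.
  move=> h; have -> : L * II L M N = (p * L + q * M) ^+ 2 + q ^+ 2 * (L * N - M ^+ 2).
    by rewrite /II; ring.
  have [q0|q0] := eqVneq q 0.
    move: pq; rewrite q0 eqxx orbF => p0; rewrite mul0r addr0 expr0n/= mul0r addr0.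
    rewrite exprMn mulr_gt0// exprn_even_gt0//=.
    by apply: contraTneq h => ->; rewrite mul0r sub0r -leNgt oppr_le0 sqr_ge0.
  by rewrite ltr_wpDl ?sqr_ge0// mulr_gt0// exprn_even_gt0.
have XF0 := pos _ _ _ dF; have XG0 := pos _ _ _ dG.
rewrite -XnF in XF0; rewrite -XnG in XG0.
have nn : dot X (cross F1 F2) = dot X (cross G1 G2).
  move/eqP: XX; rewrite eqf_sqr => /orP[/eqP//|/eqP h].
  rewrite h in XF0; have := mulr_gt0 XF0 XG0.
  move: LL XF0 XG0; set A := dot X _; set B := dot F11 _; set C := dot G11 _ => BC h1 h2 _.
  have := mulr_gt0 h1 h2; rewrite (_ : _ * _ = - (B * C * A ^+ 2)); last by ring.
  by rewrite oppr_gt0 pmulr_rlt0// ltNge sqr_ge0.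
have Xn0 : dot X (cross F1 F2) != 0 by apply: contraTneq XF0 => ->; rewrite mulr0 ltxx.
have tF1 : dot t F1 = p * dot F1 F1 + q * dot F1 F2 by rewrite /t !vecE; ring.
have tF2 : dot t F2 = p * dot F1 F2 + q * dot F2 F2 by rewrite /t !vecE; ring.
have tG1 : dot t G1 = p * dot G1 G1 + q * dot G1 G2 by rewrite tE !vecE; ring.
have tG2 : dot t G2 = p * dot G1 G2 + q * dot G2 G2 by rewrite tE !vecE; ring.
have t1 : dot t F1 = dot t G1 by rewrite tF1 tG1 E11 E12.
have t2 : dot t F2 = dot t G2 by rewrite tF2 tG2 E12 E22.
(* [F1] and [G1], like [F2] and [G2], have the same products with [t], [X] and [cross t X], a basis
   because the normal part of the acceleration is nonzero. *)
have c1 : dot (cross t X) F1 = dot (cross t X) G1.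
  have -> : dot (cross t X) F1 = q * dot X (cross F1 F2) by rewrite /t !vecE; ring.
  by rewrite nn tE !vecE; ring.
have c2 : dot (cross t X) F2 = dot (cross t X) G2.
  have -> : dot (cross t X) F2 = - (p * dot X (cross F1 F2)) by rewrite /t !vecE; ring.
  by rewrite nn tE !vecE; ring.
have tX0 : dot (cross t X) (cross t X) != 0.
  apply/eqP => /dot_eq0 h.
  have k1 : dot (cross t X) F2 = - (p * dot X (cross F1 F2)) by rewrite /t !vecE; ring.
  have k2 : dot (cross t X) F1 = q * dot X (cross F1 F2) by rewrite /t !vecE; ring.
  have d0 w : dot 0 w = 0 by rewrite !vecE; ring.
  move: k1 k2 pq; rewrite h !d0 => /esym/eqP; rewrite oppr_eq0 mulf_eq0 (negbTE Xn0) orbF => ->.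
  by move=> /esym/eqP; rewrite mulf_eq0 (negbTE Xn0) orbF => ->.
have ortho w : dot t w = 0 -> dot X w = 0 -> dot (cross t X) w = 0 -> w = 0.
  move=> w1 w2 w3.
  have E : dot (cross t X) (cross t X) *: w = dot (cross t X) w *: cross t X +
    (dot t w * dot X X - dot X w * dot t X) *: t + (dot X w * dot t t - dot t w * dot t X) *: X.
    by move: t X {tE XE XF1 XG1 XF2 XG2 X1 X2 XnF XnG XX XF0 XG0 nn Xn0 tF1 tF2 tG1 tG2 t1 t2 c1 c2 tX0 w1 w2 w3} => t X; apply: vec_eqP; rewrite !vecE; ring.
  by apply: (scalerI tX0); rewrite E w1 w2 w3 !mul0r !subrr !scale0r !addr0 scaler0.
have dB a b w : dot w (a - b) = dot w a - dot w b by rewrite !vecE; ring.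
split; apply/eqP; rewrite -subr_eq0; apply/eqP; apply: ortho; rewrite dB.
- by rewrite t1 subrr.
- by rewrite X1 subrr.
- by rewrite c1 subrr.
- by rewrite t2 subrr.
- by rewrite X2 subrr.
- by rewrite c2 subrr.
Qed.
End space.

(** * Vector-valued C^1 and C^2 maps, and limits at the boundary line *)

Lemma dif_near_eq (R : realType) (V : normedModType R) (U : set V) (f g : V -> R) (x : V) :
  open U -> U x -> (forall y, U y -> f y = g y) -> dif f x -> dif g x.
Proof.
move=> Uo Ux fg df.
have H : (g : V -> R^o) \o shift x = cst (g x) + 'd (f : V -> R^o) x +o_ (0 : V) id.
  apply/eqaddoP => _/posnumP[e].
  have /eqaddoP/(_ _ (gt0 e)) /nbhs_normP[d /= d0 h] := diff_locally df.
  have /nbhs_normP[r /= r0 rU] := near_open Uo Ux.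
  apply/nbhs_normP; exists (Num.min r d) => [|k] /=; first by rewrite lt_min r0.
  rewrite /ball_/= sub0r normrN lt_min => /andP[kr kd].
  have Uk : U (k + x) by apply: rU => /=; rewrite opprD addrCA subrr addr0 normrN.
  have := h k; rewrite /ball_/= sub0r normrN => /(_ kd).
  rewrite -![(_ + _ : _ -> _) _]/(_ + _) -![(- _ : _ -> _) _]/(- _) /= /shift/=.
  by rewrite (fg _ Ux) (fg _ Uk).
apply/diff_locallyP; rewrite (diff_unique (diff_continuous df) H).
by split=> //; exact: diff_continuous df.
Qed.
Section vector_fields.
Variable R : realType.
Notation plane := 'rV[R]_2.
Notation vec := 'rV[R]_3.
Implicit Types (x v w : plane) (U : set plane) (F G : plane -> vec).
Notation e0 := (e0 R).
Notation e1 := (e1 R).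

Definition comp F (k : 'I_3) x : R := F x ord0 k.

Definition C1v U F : Prop := forall k, C1 U (comp F k).

Definition vpd v F x : vec := \row_k pd v (comp F k) x.

Definition C2v U F : Prop := C1v U F /\ forall v, C1v U (vpd v F).

Lemma comp_vpd v F k : comp (vpd v F) k = pd v (comp F k).
Proof. by apply/funext => x; rewrite /comp mxE. Qed.

Lemma vpdE v F x k : vpd v F x ord0 k = pd v (comp F k) x.
Proof. by rewrite mxE. Qed.

Lemma C1v_subset U U' F : U' `<=` U -> C1v U F -> C1v U' F.
Proof. by move=> UU FC k; exact: C1_subset UU (FC k). Qed.

Lemma C2v_subset U U' F : U' `<=` U -> C2v U F -> C2v U' F.
Proof. by move=> UU [F1 F2]; split => [|v]; [exact: C1v_subset F1|exact: C1v_subset (F2 v)]. Qed.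

Lemma C2v_C1v U F v : C2v U F -> C1v U (vpd v F). Proof. by case. Qed.

Variable U : set plane.
Hypothesis Uo : open U.

Lemma C1_dot F G : C1v U F -> C1v U G -> C1 U (fun x => dot (F x) (G x)).
Proof.
move=> FC GC.
have -> : (fun x => dot (F x) (G x)) = fun x => comp F 0 x * comp G 0 x
   + comp F 1 x * comp G 1 x + comp F 2%:R x * comp G 2%:R x.
  by apply/funext => x; rewrite dotE.
by apply: C1D => //; [apply: C1D => //|]; apply: C1M.
Qed.

Lemma pd_dot v F G x : C1v U F -> C1v U G -> U x ->
  pd v (fun x => dot (F x) (G x)) x = dot (vpd v F x) (G x) + dot (F x) (vpd v G x).
Proof.
move=> FC GC Ux.
have -> : (fun x => dot (F x) (G x)) = fun x => comp F 0 x * comp G 0 x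
   + comp F 1 x * comp G 1 x + comp F 2%:R x * comp G 2%:R x.
  by apply/funext => y; rewrite dotE.
have dF k := C1_dif (FC k) Ux; have dG k := C1_dif (GC k) Ux.
have dm k := difM (dF k) (dG k).
rewrite (pdD v (difD (dm 0) (dm 1)) (dm 2%:R)) (pdD v (dm 0) (dm 1)) !pdM//.
by rewrite !dotE !vpdE /comp; ring.
Qed.

Lemma C1v_cross F G : C1v U F -> C1v U G -> C1v U (fun x => cross (F x) (G x)).
Proof.
move=> FC GC k.
have -> : comp (fun x => cross (F x) (G x)) k = fun x =>
   comp F (k + 1) x * comp G (k + 2%:R) x - comp F (k + 2%:R) x * comp G (k + 1) x.
  by apply/funext => x; rewrite /comp /cross mxE.
by apply: C1B => //; apply: C1M.
Qed.

Lemma vpd_cross v F G x : C1v U F -> C1v U G -> U x ->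
  vpd v (fun x => cross (F x) (G x)) x = cross (vpd v F x) (G x) + cross (F x) (vpd v G x).
Proof.
move=> FC GC Ux; apply/rowP => k; rewrite !mxE.
have -> : comp (fun x => cross (F x) (G x)) k = fun x =>
   comp F (k + 1) x * comp G (k + 2%:R) x - comp F (k + 2%:R) x * comp G (k + 1) x.
  by apply/funext => y; rewrite /comp /cross mxE.
have dF i := C1_dif (FC i) Ux; have dG i := C1_dif (GC i) Ux.
rewrite (pdB v (difM (dF _) (dG _)) (difM (dF _) (dG _))) !pdM// /comp.
by ring.
Qed.

Lemma C1v_scale (a : plane -> R) F : C1 U a -> C1v U F -> C1v U (fun x => a x *: F x).
Proof.
move=> aC FC k; have -> : comp (fun x => a x *: F x) k = fun x => a x * comp F k x.
  by apply/funext => x; rewrite /comp mxE.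
exact: C1M.
Qed.

Lemma C1v_add F G : C1v U F -> C1v U G -> C1v U (fun x => F x + G x).
Proof.
move=> FC GC k; have -> : comp (fun x => F x + G x) k = fun x => comp F k x + comp G k x.
  by apply/funext => x; rewrite /comp mxE.
exact: C1D.
Qed.

Lemma C1v_sub F G : C1v U F -> C1v U G -> C1v U (fun x => F x - G x).
Proof.
move=> FC GC k; have -> : comp (fun x => F x - G x) k = fun x => comp F k x - comp G k x.
  by apply/funext => x; rewrite /comp !mxE.
exact: C1B.
Qed.

Lemma vpd_add v F G x : C1v U F -> C1v U G -> U x ->
  vpd v (fun x => F x + G x) x = vpd v F x + vpd v G x.
Proof.
move=> FC GC Ux; apply/rowP => k; rewrite !mxE.
have -> : comp (fun x => F x + G x) k = fun x => comp F k x + comp G k x.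
  by apply/funext => y; rewrite /comp mxE.
by rewrite (pdD v (C1_dif (FC k) Ux) (C1_dif (GC k) Ux)).
Qed.

Lemma vpd_sub v F G x : C1v U F -> C1v U G -> U x ->
  vpd v (fun x => F x - G x) x = vpd v F x - vpd v G x.
Proof.
move=> FC GC Ux; apply/rowP => k; rewrite !mxE.
have -> : comp (fun x => F x - G x) k = fun x => comp F k x - comp G k x.
  by apply/funext => y; rewrite /comp !mxE.
by rewrite (pdB v (C1_dif (FC k) Ux) (C1_dif (GC k) Ux)).
Qed.

Lemma vpd_near_eq v F G x : U x -> (forall y, U y -> F y = G y) -> vpd v F x = vpd v G x.
Proof.
move=> Ux FG; apply/rowP => k; rewrite !mxE; apply: (pd_near_eq Uo) => // y Uy.
by rewrite /comp FG.
Qed.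

Lemma C1_eq (f g : plane -> R) : (forall y, U y -> f y = g y) -> C1 U f -> C1 U g.
Proof.
move=> fg fC; split => [x Ux|v x Ux].
  exact: (dif_near_eq Uo Ux fg (C1_dif fC Ux)).
apply: (cont_near_eq Uo Ux _ (C1_pd_cont (v := v) fC Ux)) => y Uy.
exact: (pd_near_eq Uo).
Qed.

Lemma vpd_Young v w F x : C2v U F -> U x -> vpd w (vpd v F) x = vpd v (vpd w F) x.
Proof.
move=> [FC FC2] Ux; apply/rowP => k; rewrite !vpdE !comp_vpd.
apply: (Young Uo Ux); first by move=> y Uy; exact: (C1_dif (FC k)).
- by rewrite -comp_vpd; exact: (C1_dif (FC2 v k)).
- by rewrite -comp_vpd; exact: (C1_dif (FC2 w k)).
Qed.

(** Points of the closed half-plane are limits of points [x + t *: e0] of the open one. Thus closed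
    conditions derived by differentiation where [x_0 > 0] hold on the boundary line too. *)
Lemma halfplane_ge0 (g : plane -> R) x : cont g x -> U x -> 0 <= x ord0 0 ->
  (forall y, U y -> 0 < y ord0 0 -> 0 <= g y) -> 0 <= g x.
Proof.
move=> gc Ux x0 H; rewrite leNgt; apply/negP => gx.
have gap : 0 < - g x by rewrite oppr_gt0.
have /cvgrPdist_lt /(_ _ gap) /nbhs_normP[r /= r0 Hr] := gc.
have /nbhs_normP[d /= d0 Hd] := near_open Uo Ux.
pose t := Num.min r d / 2.
have m0 : 0 < Num.min r d by rewrite lt_min r0.
have t0 : 0 < t by rewrite divr_gt0.
have tm : t < Num.min r d by rewrite /t; lra.
have [tr td] : t < r /\ t < d by move: tm; rewrite lt_min => /andP[].
pose y := x + t *: e0.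
have xy : `|x - y| <= t.
  rewrite /y opprD addrA subrr sub0r normrN normrZ (gtr0_norm t0) ger_pMr//.
  by rewrite plane_norm_le// !eE normr1 normr0 lexx ler01.
have := Hr y (le_lt_trans xy tr); have := H y (Hd y (le_lt_trans xy td)).
rewrite /y !mxE !eqxx mulr1 => /(_ (ltr_wpDl x0 t0)) gy.
by rewrite distrC => /ltr_normlW; rewrite /y; lra.
Qed.

Lemma halfplane_eq0 (g : plane -> R) x : cont g x -> U x -> 0 <= x ord0 0 ->
  (forall y, U y -> 0 < y ord0 0 -> g y = 0) -> g x = 0.
Proof.
move=> gc Ux x0 H; apply/eqP; rewrite eq_le; apply/andP; split; last first.
  by apply: halfplane_ge0 => // y Uy y0; rewrite H.
rewrite -oppr_ge0; apply: (halfplane_ge0 (contN gc)) => // y Uy y0.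
by rewrite H// oppr0.
Qed.

End vector_fields.

(** * Chain rule for maps given by two coordinate functions *)

Section chain_rule.
Variable R : realType.
Notation plane := 'rV[R]_2.
Implicit Types (x v w : plane) (U W : set plane).
Notation e0 := (e0 R).
Notation e1 := (e1 R).

Lemma ptE (s t : R) : pt s t = s *: e0 + t *: e1.
Proof. by apply: plane_eqP; rewrite !mxE/= ?mulr1 ?mulr0 ?addr0 ?add0r. Qed.

Section param.
Variables (V : normedModType R) (P0 P1 : V -> R) (y : V).
Hypotheses (d0 : dif P0 y) (d1 : dif P1 y).

Lemma differentiable_pt : differentiable (fun z => pt (P0 z) (P1 z) : plane) y.
Proof.
have -> : (fun z => pt (P0 z) (P1 z) : plane) = fun z => P0 z *: e0 + P1 z *: e1.
  by apply/funext => z; rewrite ptE.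
by apply: differentiableD; apply: differentiableZl.
Qed.

Lemma derive_pt (v : V) : 'D_v (fun z => pt (P0 z) (P1 z) : plane) y = pd v P0 y *: e0 + pd v P1 y *: e1.
Proof.
have scal (P : V -> R) (a : plane) : dif P y -> 'D_v (fun z => P z *: a) y = pd v P y *: a.
  move=> dP; have dPa : differentiable (fun z => P z *: a) y by exact: differentiableZl.
  by rewrite (deriveE _ dPa) (diffZl _ dP) pdE (deriveE _ dP).
have -> : (fun z => pt (P0 z) (P1 z) : plane) = (fun z => P0 z *: e0) + (fun z => P1 z *: e1).
  by apply/funext => z; rewrite ptE.
rewrite deriveD; [|exact/diff_derivable/differentiableZl|exact/diff_derivable/differentiableZl].
by rewrite !scal.
Qed.

Lemma pd_chain (v : V) (g : plane -> R) : dif g (pt (P0 y) (P1 y)) ->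
  pd v (fun z => g (pt (P0 z) (P1 z))) y =
  pd v P0 y * pd e0 g (pt (P0 y) (P1 y)) + pd v P1 y * pd e1 g (pt (P0 y) (P1 y)).
Proof.
move=> dg; rewrite pdE (@derive_compE _ V plane R^o (fun z => pt (P0 z) (P1 z)) g)//.
  by rewrite derive_pt -pdE (pdDv _ _ dg) !(pdZ _ _ dg).
exact: differentiable_pt.
Qed.

Lemma dif_chain (g : plane -> R) : dif g (pt (P0 y) (P1 y)) ->
  dif (fun z => g (pt (P0 z) (P1 z))) y.
Proof.
by move=> dg; apply: (@differentiable_comp _ V plane R^o (fun z => pt (P0 z) (P1 z)) g) => //; exact: differentiable_pt.
Qed.

Lemma cont_chain (g : plane -> R) : cont g (pt (P0 y) (P1 y)) ->
  cont (fun z => g (pt (P0 z) (P1 z))) y.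
Proof.
move=> gc; apply: (@continuous_comp _ plane R^o (fun z => pt (P0 z) (P1 z)) g) => //.
exact/differentiable_continuous/differentiable_pt.
Qed.
End param.

Lemma C1_chain (V : normedModType R) (W : set V) U (P0 P1 : V -> R) (g : plane -> R) :
  open W -> C1 W P0 -> C1 W P1 -> C1 U g -> (forall y, W y -> U (pt (P0 y) (P1 y))) ->
  C1 W (fun z => g (pt (P0 z) (P1 z))).
Proof.
move=> Wo C0 C1' gC WU.
have d0 y (Wy : W y) := C1_dif C0 Wy; have d1 y (Wy : W y) := C1_dif C1' Wy.
have dg y (Wy : W y) := C1_dif gC (WU y Wy).
split => [y Wy|v y Wy]; first exact: (dif_chain (d0 y Wy) (d1 y Wy) (dg y Wy)).
apply: (@cont_near_eq _ _ _ Wo (fun y => pd v P0 y * pd e0 g (pt (P0 y) (P1 y)) + pd v P1 y * pd e1 g (pt (P0 y) (P1 y)))) => //.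
  by move=> z Wz; rewrite (pd_chain (d0 z Wz) (d1 z Wz) _ (dg z Wz)).
apply: contD; apply: contM.
- exact: (C1_pd_cont C0).
- exact: (cont_chain (d0 y Wy) (d1 y Wy) (C1_pd_cont gC (WU y Wy))).
- exact: (C1_pd_cont C1').
- exact: (cont_chain (d0 y Wy) (d1 y Wy) (C1_pd_cont gC (WU y Wy))).
Qed.
End chain_rule.

(** * Unique continuation on curvilinear rectangles *)

Section strip.
Variable R : realType.
Notation plane := 'rV[R]_2.
Notation vec := 'rV[R]_3.
Implicit Types (x v w : plane) (U : set plane) (F G : plane -> vec).
Notation e0 := (e0 R).
Notation e1 := (e1 R).
Notation square := (@square R).

Lemma comp_sqr_le (a : vec) k : a ord0 k * a ord0 k <= dot a a.
Proof.
have s i : 0 <= a ord0 i * a ord0 i by rewrite -expr2 sqr_ge0.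
have := s 0; have := s 1; have := s 2%:R.
by rewrite dotE; case: (ord3P k) => ->; lra.
Qed.

(** The parametrization multiplies the Jacobian of the pair [j, l] by [jac P0 P1] and the squared
    gradient by at most a constant, so the pair stays quasiregular on the square. Once the pair
    vanishes, so does its Jacobian, which dominates the gradient of all of [om]; every component is
    then constant along the lines that start on the initial side. *)
Lemma strip_unique_continuation U W (om : plane -> vec) (j l : 'I_3) (c delta sg : R)
    (P0 P1 : plane -> R) :
  open U -> C1v U om -> 0 < c -> open W -> square `<=` W -> C1 W P0 -> C1 W P1 ->
  (forall y, W y -> U (pt (P0 y) (P1 y))) ->
  (forall y, square y -> let x := pt (P0 y) (P1 y) in
     c * (dot (vpd e0 om x) (vpd e0 om x) + dot (vpd e1 om x) (vpd e1 om x))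
       <= jac (comp om j) (comp om l) x) ->
  0 < delta -> sg = 1 \/ sg = -1 -> (forall y, square y -> delta <= sg * jac P0 P1 y) ->
  (forall y, square y -> y ord0 0 = 0 -> om (pt (P0 y) (P1 y)) = 0) ->
  forall y, square y -> y ord0 0 < 1 -> 0 < y ord0 1 < 1 -> om (pt (P0 y) (P1 y)) = 0.
Proof.
move=> Uo omC c0 Wo KW C0 C1' WU QR delta0 sg1 jacP om0.
pose Psi y := pt (P0 y) (P1 y).
pose w k y := comp om k (Psi y).
have wC k : C1 W (w k) by exact: (C1_chain Wo C0 C1' (omC k) WU).
have wD k v y : W y -> pd v (w k) y =
    pd v P0 y * vpd e0 om (Psi y) ord0 k + pd v P1 y * vpd e1 om (Psi y) ord0 k.
  move=> Wy; rewrite !vpdE.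
  exact: (pd_chain (C1_dif C0 Wy) (C1_dif C1' Wy) v (C1_dif (omC k) (WU y Wy))).
have [B00 B00p H00] := square_cont_bounded KW (fun x => C1_pd_cont (v := e0) C0).
have [B01 B01p H01] := square_cont_bounded KW (fun x => C1_pd_cont (v := e1) C0).
have [B10 B10p H10] := square_cont_bounded KW (fun x => C1_pd_cont (v := e0) C1').
have [B11 B11p H11] := square_cont_bounded KW (fun x => C1_pd_cont (v := e1) C1').
pose B := B00 + B01 + B10 + B11.
have B0 : 0 < B by rewrite !addr_gt0.
have jacW y : W y -> jac (w j) (w l) y = jac P0 P1 y * jac (comp om j) (comp om l) (Psi y).
  by move=> Wy; rewrite /jac !wD// !vpdE; ring.
have bound (p0 p1 a b : R) : `|p0| <= B -> `|p1| <= B ->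
    (p0 * a + p1 * b) * (p0 * a + p1 * b) <= 2 * B ^+ 2 * (a * a + b * b).
  move=> h0 h1.
  have q (x : R) : `|x| <= B -> x ^+ 2 <= B ^+ 2.
    by move=> xK; rewrite -[x ^+ 2]real_normK ?num_real// ler_sqr ?nnegrE// ltW.
  have k0 : p0 ^+ 2 * a ^+ 2 <= B ^+ 2 * a ^+ 2 by rewrite ler_wpM2r ?sqr_ge0// q.
  have k1 : p1 ^+ 2 * b ^+ 2 <= B ^+ 2 * b ^+ 2 by rewrite ler_wpM2r ?sqr_ge0// q.
  have -> : (p0 * a + p1 * b) * (p0 * a + p1 * b) =
     2 * (p0 ^+ 2 * a ^+ 2) + 2 * (p1 ^+ 2 * b ^+ 2) - (p0 * a - p1 * b) ^+ 2 by ring.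
  have -> : 2 * B ^+ 2 * (a * a + b * b) = 2 * (B ^+ 2 * a ^+ 2) + 2 * (B ^+ 2 * b ^+ 2) by ring.
  by have := sqr_ge0 (p0 * a - p1 * b); lra.
pose E x := dot (vpd e0 om x) (vpd e0 om x) + dot (vpd e1 om x) (vpd e1 om x).
have E0 x : 0 <= E x by rewrite addr_ge0// dot_ge0.
(* Four squared partial derivatives, each at most [2 * B ^+ 2 * E]. *)
have gradW y : square y -> grad2 (w j) (w l) y <= 8 * B ^+ 2 * E (Psi y).
  move=> Ky; have Wy := KW _ Ky; rewrite /grad2 !wD//.
  have b00 : `|pd e0 P0 y| <= B by apply: le_trans (H00 _ Ky) _; rewrite /B; lra.
  have b01 : `|pd e1 P0 y| <= B by apply: le_trans (H01 _ Ky) _; rewrite /B; lra.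
  have b10 : `|pd e0 P1 y| <= B by apply: le_trans (H10 _ Ky) _; rewrite /B; lra.
  have b11 : `|pd e1 P1 y| <= B by apply: le_trans (H11 _ Ky) _; rewrite /B; lra.
  set a := vpd e0 om (Psi y); set b := vpd e1 om (Psi y).
  have kk k : 2 * B ^+ 2 * (a ord0 k * a ord0 k + b ord0 k * b ord0 k) <= 2 * B ^+ 2 * E (Psi y).
    apply: ler_wpM2l; first by rewrite mulr_ge0 ?sqr_ge0.
    by apply: lerD; exact: comp_sqr_le.
  apply: le_trans (lerD (lerD (lerD (le_trans (bound _ _ _ _ b00 b10) (kk j))
    (le_trans (bound _ _ _ _ b01 b11) (kk j))) (le_trans (bound _ _ _ _ b00 b10) (kk l)))
    (le_trans (bound _ _ _ _ b01 b11) (kk l))) _.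
  by rewrite le_eqVlt; apply/orP; left; apply/eqP; ring.
have B2 : 0 < 8 * B ^+ 2 by rewrite mulr_gt0// exprn_gt0.
have c'0 : 0 < c * delta / (8 * B ^+ 2) by rewrite divr_gt0// mulr_gt0.
have QRW y : square y -> c * delta / (8 * B ^+ 2) * grad2 (w j) (w l) y <= sg * jac (w j) (w l) y.
  move=> Ky; rewrite jacW; last exact: KW.
  rewrite mulrA.
  apply: (@le_trans _ _ (delta * (c * E (Psi y)))).
    have -> : delta * (c * E (Psi y)) = c * delta / (8 * B ^+ 2) * (8 * B ^+ 2 * E (Psi y)).
      by field; exact: lt0r_neq0.
    by apply: ler_wpM2l; [exact: ltW|exact: gradW].
  apply: ler_pM; [exact: ltW|by rewrite mulr_ge0// ltW|exact: jacP|exact: QR].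
have w0 y : square y -> y ord0 0 = 0 -> w j y = 0 /\ w l y = 0.
  by move=> Ky y0; rewrite /w /comp (om0 _ Ky y0) !mxE.
have uc y : square y -> y ord0 0 < 1 -> 0 < y ord0 1 < 1 -> w j y = 0 /\ w l y = 0.
  case: sg1 => sgE.
    apply: (square_unique_continuation Wo KW (wC j) (wC l) c'0) => // z Kz.
    by apply: le_trans (QRW _ Kz) _; rewrite sgE mul1r.
  (* When the parametrization reverses orientation, the two components are exchanged. *)
  have QRW' z : square z -> c * delta / (8 * B ^+ 2) * grad2 (w l) (w j) z <= jac (w l) (w j) z.
    move=> Kz; have -> : grad2 (w l) (w j) z = grad2 (w j) (w l) z by rewrite /grad2; ring.
    have -> : jac (w l) (w j) z = sg * jac (w j) (w l) z by rewrite sgE /jac; ring.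
    exact: QRW.
  have w0' z : square z -> z ord0 0 = 0 -> w l z = 0 /\ w j z = 0.
    by move=> Kz z0; have [] := w0 z Kz z0.
  move=> Ky y1 yt.
  by have [] := square_unique_continuation Wo KW (wC l) (wC j) c'0 QRW' w0' Ky y1 yt.
pose Q := [set y : plane | ((0 < y ord0 0) /\ (y ord0 0 < 1)) /\ ((0 < y ord0 1) /\ (y ord0 1 < 1))].
have QK : Q `<=` square by move=> y /= [[a b] [a' b']]; rewrite /square /=; split; rewrite !ltW.
have Qo : open Q.
  have oT (g : plane -> R) (a : R) V : open V -> C1 [set: plane] g -> open [set x | V x /\ g x < a].
    by move=> Vo gC; apply: open_sublevel => // x _; exact: (C1_cont gC).
  have oc i := @C1_coord R [set: plane] i.
  have on i := C1N openT (oc i).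
  have -> : Q = [set x : plane | [set x : plane | [set x : plane | [set x : plane | setT x /\
      - x ord0 0 < 0] x /\ x ord0 0 < 1] x /\ - x ord0 1 < 0] x /\ x ord0 1 < 1].
    apply/seteqP; split => y /=.
      by move=> [[a b] [a' b']]; do !split => //; rewrite oppr_lt0.
    by move=> [[[[_ a] b] a'] b']; rewrite !oppr_lt0 in a a'.
  by do 4!apply: (oT) => //; exact: openT.
have grad0 y k v : Q y -> pd v (w k) y = 0.
  move=> Qy; have Ky := QK _ Qy; have Wy := KW _ Ky.
  have z i : i = j \/ i = l -> forall u, pd u (w i) y = 0.
    move=> ijl u; rewrite -(pd_cst u (0 : R) y); apply: (pd_near_eq Qo) => // z Qz.
    case: (Qz) => [[z0 z1] z'].
    have [a b] := uc z (QK _ Qz) z1 (introT andP z').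
    by case: ijl => ->.
  have zj u : pd u (w j) y = 0 by apply: z; left.
  have J0 : jac (w j) (w l) y = 0 by rewrite /jac !zj !mul0r subrr.
  have jP := lt_le_trans delta0 (jacP _ Ky).
  have J1 : jac (comp om j) (comp om l) (Psi y) = 0.
    have jP0 : jac P0 P1 y != 0 by apply: contraTneq jP => ->; rewrite mulr0 ltxx.
    by move: J0; rewrite jacW// => /eqP; rewrite mulf_eq0 (negbTE jP0) => /eqP.
  have := QR _ Ky; rewrite /= -/(Psi y) J1 pmulr_rle0// => le0.
  have e00' := dot_ge0 (vpd e0 om (Psi y)); have e11' := dot_ge0 (vpd e1 om (Psi y)).
  have a0 : vpd e0 om (Psi y) = 0 by apply: dot_eq0; lra.
  have b0 : vpd e1 om (Psi y) = 0 by apply: dot_eq0; lra.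
  by rewrite wD// a0 b0 !mxE !mulr0 addr0.
move=> y Ky y1 yt; have [/andP[y0 _] _] := Ky.
move: y0; rewrite le_eqVlt => /predU1P[/esym y0|y0]; first by have := om0 _ Ky y0.
have start : square (pt 0 (y ord0 1)).
  by rewrite /square /= pt0 pt1 lexx ler01; split=> //; case: Ky.
apply/rowP => k; rewrite [RHS]mxE -[LHS]/(w k y).
have seg0 (t : R) : (pt 0 (y ord0 1) + t *: (y ord0 0 *: e0)) ord0 0 = t * y ord0 0.
  by rewrite !mxE/=; ring.
have seg1 (t : R) : (pt 0 (y ord0 1) + t *: (y ord0 0 *: e0)) ord0 1 = y ord0 1.
  by rewrite !mxE/=; ring.
have seg (t : R) : 0 <= t <= 1 -> square (pt 0 (y ord0 1) + t *: (y ord0 0 *: e0)).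
  move=> /andP[t0' t1']; rewrite /square /= seg0 seg1; split; last by case: Ky.
  apply/andP; split; first exact: mulr_ge0 t0' (ltW y0).
  by rewrite mulr_ile1 ?(ltW y0) ?(ltW y1).
have [|t t01 E'] := @line_MVT _ _ (w k) (pt 0 (y ord0 1)) (y ord0 0 *: e0).
  by move=> t t01; apply: (C1_dif (wC k)); apply: KW; exact: seg.
have yE : pt 0 (y ord0 1) + y ord0 0 *: e0 = y.
  by apply: plane_eqP; rewrite !mxE/= ?mulr1 ?mulr0 ?add0r ?addr0.
rewrite yE grad0 in E'; last first.
  case/andP: t01 => h0 h1; case/andP: yt => h0' h1'.
  rewrite /Q /= seg0 seg1; do !split => //; first exact: mulr_gt0.
  by rewrite mulr_ilt1 ?(ltW h0) ?(ltW y0).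
move/eqP: E'; rewrite subr_eq0 => /eqP ->.
by rewrite /w /comp om0 ?pt0// mxE.
Qed.
End strip.

(** * The rotation field of two isometric maps *)

Section midsurface.
Variable R : realType.
Notation plane := 'rV[R]_2.
Notation vec := 'rV[R]_3.
Implicit Types (x v w : plane) (U : set plane) (F G : plane -> vec).
Notation e0 := (e0 R).
Notation e1 := (e1 R).

Lemma cont_dot F G x : (forall k, cont (comp F k) x) -> (forall k, cont (comp G k) x) ->
  cont (fun y => dot (F y) (G y)) x.
Proof.
move=> FC GC.
have -> : (fun x => dot (F x) (G x)) = fun x => comp F 0 x * comp G 0 x
   + comp F 1 x * comp G 1 x + comp F 2%:R x * comp G 2%:R x.
  by apply/funext => y; rewrite dotE.
by apply: contD; [apply: contD|]; apply: contM.
Qed.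

Lemma cont_lt (g : plane -> R) x (a : R) : cont g x -> g x < a -> \forall y \near x, g y < a.
Proof.
move=> gc gx; have gap : 0 < a - g x by rewrite subr_gt0.
have /cvgrPdist_lt /(_ _ gap) := gc; apply: filterS => y.
by rewrite distrC => /ltr_normlW; rewrite ltrBlDr subrK.
Qed.

Lemma cont_gt (g : plane -> R) x (a : R) : cont g x -> a < g x -> \forall y \near x, a < g y.
Proof.
move=> gc gx; have := cont_lt (contN gc) (_ : - g x < - a); rewrite ltrN2 => /(_ gx).
by apply: filterS => y; rewrite ltrN2.
Qed.

Lemma open_ball (V : normedModType R) (p : V) (r : R) : open [set x : V | `|p - x| < r].
Proof.
rewrite openE => x /= xr.
suff : \forall y \near x, `|p - y| < r by [].
apply/nbhs_normP; exists (r - `|p - x|) => [|y] /=; first by rewrite subr_gt0.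
by rewrite ltrBrDl; apply: le_lt_trans; rewrite -(subrKA x); exact: ler_normD.
Qed.

(** Determinant of the second form taken with the normal [cross m1 m2], which is not normalized; for
    a regular frame it has the sign of the Gauss curvature. *)
Definition disc (m1 m2 m11 m12 m22 : vec) : R :=
  dot m11 (cross m1 m2) * dot m22 (cross m1 m2) - dot m12 (cross m1 m2) ^+ 2.

Lemma disc_normal_neq0 m1 m2 m11 m12 m22 : 0 < disc m1 m2 m11 m12 m22 ->
  cross m1 m2 != 0.
Proof.
apply: contraTneq => h; rewrite /disc h.
have d0 (a : vec) : dot a 0 = 0 by rewrite !vecE; ring.
by rewrite !d0 mul0r expr0n/= subrr ltxx.
Qed.

(** Derivative of [F + G], twice the midsurface; the factor only rescales the rotation field. *)
Definition mid v F G x : vec := vpd v F x + vpd v G x.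
Definition dif2 v F G x : vec := vpd v F x - vpd v G x.

Definition isometric_at F G x : Prop :=
  [/\ dot (vpd e0 F x) (vpd e0 F x) = dot (vpd e0 G x) (vpd e0 G x),
      dot (vpd e0 F x) (vpd e1 F x) = dot (vpd e0 G x) (vpd e1 G x) &
      dot (vpd e1 F x) (vpd e1 F x) = dot (vpd e1 G x) (vpd e1 G x)].

Definition mid_disc F G x : R := disc (mid e0 F G x) (mid e1 F G x)
  (vpd e0 (mid e0 F G) x) (vpd e1 (mid e0 F G) x) (vpd e1 (mid e1 F G) x).

Definition rot F G x : vec :=
  rotation (mid e0 F G x) (mid e1 F G x) (dif2 e0 F G x) (dif2 e1 F G x).

Section rotation_field.
Variables (U : set plane) (F G : plane -> vec).
Hypotheses (Uo : open U) (FC : C2v U F) (GC : C2v U G).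

Lemma C1v_mid v : C1v U (mid v F G). Proof. exact: C1v_add (C2v_C1v v FC) (C2v_C1v v GC). Qed.
Lemma C1v_dif2 v : C1v U (dif2 v F G). Proof. exact: C1v_sub (C2v_C1v v FC) (C2v_C1v v GC). Qed.

Lemma vpd_mid_sym v w x : U x -> vpd v (mid w F G) x = vpd w (mid v F G) x.
Proof.
move=> Ux; rewrite (vpd_add v (C2v_C1v w FC) (C2v_C1v w GC) Ux).
rewrite (vpd_add w (C2v_C1v v FC) (C2v_C1v v GC) Ux).
by rewrite (vpd_Young Uo w v FC Ux) (vpd_Young Uo w v GC Ux).
Qed.

Lemma vpd_dif2_sym v w x : U x -> vpd v (dif2 w F G) x = vpd w (dif2 v F G) x.
Proof.
move=> Ux; rewrite (vpd_sub v (C2v_C1v w FC) (C2v_C1v w GC) Ux).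
rewrite (vpd_sub w (C2v_C1v v FC) (C2v_C1v v GC) Ux).
by rewrite (vpd_Young Uo w v FC Ux) (vpd_Young Uo w v GC Ux).
Qed.

Let nu x := cross (mid e0 F G x) (mid e1 F G x).

Lemma C1v_nu : C1v U nu. Proof. by apply: C1v_cross => //; exact: C1v_mid. Qed.

Hypothesis nu0 : forall x, U x -> dot (nu x) (nu x) != 0.

Lemma C1v_rot : C1v U (rot F G).
Proof.
have nn := C1_dot Uo C1v_nu C1v_nu.
apply: (C1v_scale Uo); first exact: (C1V Uo nn).
apply: (C1v_add Uo); last first.
  by apply: (C1v_scale Uo) C1v_nu; exact: (C1_dot Uo (C1v_dif2 e0) (C1v_mid e1)).
apply: (C1v_sub Uo); apply: (C1v_scale Uo); (try exact: C1v_mid).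
  exact: (C1_dot Uo (C1v_dif2 e1) C1v_nu).
exact: (C1_dot Uo (C1v_dif2 e0) C1v_nu).
Qed.

(** The symmetrized products of [dF + dG] with [dF - dG] are differences of coefficients of the two
    metrics. *)
Lemma rot_mid x : U x -> isometric_at F G x ->
  cross (rot F G x) (mid e0 F G x) = dif2 e0 F G x /\
  cross (rot F G x) (mid e1 F G x) = dif2 e1 F G x.
Proof.
move=> Ux [i00 i01 i11]; apply: rotationE; first exact: nu0.
- have -> : dot (dif2 e0 F G x) (mid e0 F G x) =
    dot (vpd e0 F x) (vpd e0 F x) - dot (vpd e0 G x) (vpd e0 G x).
    by rewrite /dif2 /mid; move: (vpd e0 F x) (vpd e0 G x) => a b; rewrite !vecE; ring.
  by rewrite i00 subrr.
- have -> : dot (dif2 e1 F G x) (mid e1 F G x) =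
    dot (vpd e1 F x) (vpd e1 F x) - dot (vpd e1 G x) (vpd e1 G x).
    by rewrite /dif2 /mid; move: (vpd e1 F x) (vpd e1 G x) => a b; rewrite !vecE; ring.
  by rewrite i11 subrr.
- have -> : dot (dif2 e0 F G x) (mid e1 F G x) + dot (dif2 e1 F G x) (mid e0 F G x) =
    2 * (dot (vpd e0 F x) (vpd e1 F x) - dot (vpd e0 G x) (vpd e1 G x)).
    rewrite /dif2 /mid; move: (vpd e0 F x) (vpd e0 G x) (vpd e1 F x) (vpd e1 G x) => a b c d.
    by rewrite !vecE; ring.
  by rewrite i01 subrr mulr0.
Qed.

(** [R1] is the symmetry of the second derivatives of [F - G], in which the terms with second
    derivatives of the midsurface cancel. It makes the derivatives of [rot] tangent, so the
    differential of [dot (rot F G) nu] is the product of [rot] with that of [nu]; symmetry of its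
    mixed derivatives is [R2]. Both factors are merely known to be C^1, hence the use of
    [Young_form]. *)
Lemma rot_derivative : (forall x, U x -> isometric_at F G x) -> forall x, U x ->
  let m1 := mid e0 F G x in let m2 := mid e1 F G x in
  exists al be ga : R,
  [/\ vpd e0 (rot F G) x = al *: m1 + be *: m2,
      vpd e1 (rot F G) x = ga *: m1 - al *: m2 &
      dot (vpd e0 (mid e0 F G) x) (nu x) * ga =
      2 * dot (vpd e1 (mid e0 F G) x) (nu x) * al + dot (vpd e1 (mid e1 F G) x) (nu x) * be].
Proof.
move=> iso.
have R1 x : U x -> cross (vpd e0 (rot F G) x) (mid e1 F G x) = cross (vpd e1 (rot F G) x) (mid e0 F G x).
  move=> Ux.
  have E0 : vpd e1 (dif2 e0 F G) x = vpd e1 (fun y => cross (rot F G y) (mid e0 F G y)) x.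
    by apply: (vpd_near_eq Uo) => // y Uy; rewrite (rot_mid Uy (iso _ Uy)).1.
  have E1 : vpd e0 (dif2 e1 F G) x = vpd e0 (fun y => cross (rot F G y) (mid e1 F G y)) x.
    by apply: (vpd_near_eq Uo) => // y Uy; rewrite (rot_mid Uy (iso _ Uy)).2.
  move: E0; rewrite (vpd_dif2_sym e1 e0 Ux) E1.
  rewrite (vpd_cross e1 C1v_rot (C1v_mid e0) Ux) (vpd_cross e0 C1v_rot (C1v_mid e1) Ux).
  by rewrite (vpd_mid_sym e1 e0 Ux) => /addIr.
have tangent x : U x -> dot (vpd e0 (rot F G) x) (nu x) = 0 /\ dot (vpd e1 (rot F G) x) (nu x) = 0.
  move=> /R1; rewrite /nu; move: (mid e0 F G x) (mid e1 F G x) (vpd e0 _ x) (vpd e1 _ x) => m1 m2 a b E.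
  split.
    have -> : dot a (cross m1 m2) = - dot (cross a m2) m1 by rewrite !vecE; ring.
    by rewrite E !vecE; ring.
  have -> : dot b (cross m1 m2) = dot (cross b m1) m2 by rewrite !vecE; ring.
  by rewrite -E !vecE; ring.
have phi x u : u = e0 \/ u = e1 -> U x ->
    pd u (fun y => dot (rot F G y) (nu y)) x = dot (rot F G x) (vpd u nu x).
  move=> ue Ux; rewrite (pd_dot u C1v_rot C1v_nu Ux).
  by have [t0 t1] := tangent _ Ux; case: ue => ->; rewrite ?t0 ?t1 add0r.
have R2 x : U x -> dot (vpd e0 (rot F G) x) (vpd e1 nu x) = dot (vpd e1 (rot F G) x) (vpd e0 nu x).
  move=> Ux; rewrite !dotE !vpdE.
  apply: (Young_form (U := U) (phi := fun y => dot (rot F G y) (nu y))) => //;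
    try exact: C1v_rot; try exact: C1v_nu.
    by move=> y Uy; apply: (C1_dif (C1_dot Uo C1v_rot C1v_nu) Uy).
  move=> u ue y Uy; rewrite phi//; last by case: ue => ->; [right|left].
  by rewrite dotE !vpdE.
move=> x Ux m1 m2.
apply: rotation_derivative; [exact: nu0|exact: R1|].
have := R2 _ Ux.
rewrite (vpd_cross e1 (C1v_mid e0) (C1v_mid e1) Ux) (vpd_cross e0 (C1v_mid e0) (C1v_mid e1) Ux).
by rewrite (vpd_mid_sym e0 e1 Ux).
Qed.
End rotation_field.
End midsurface.

(** * Quasiregularity of the rotation field *)

Section quasiregular.
Variable R : realType.
Notation plane := 'rV[R]_2.
Notation vec := 'rV[R]_3.
Implicit Types (x v w : plane) (U : set plane) (F G : plane -> vec).
Notation e0 := (e0 R).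
Notation e1 := (e1 R).

Lemma rotation_gradient_bound (m1 m2 a b : vec) (al be ga K : R) : 0 <= K ->
  dot m1 m1 <= K -> dot m2 m2 <= K -> a = al *: m1 + be *: m2 -> b = ga *: m1 - al *: m2 ->
  dot a a + dot b b <= 4 * K * (al ^+ 2 + be ^+ 2 + ga ^+ 2).
Proof.
move=> K0 h1 h2 -> ->.
have -> : dot (al *: m1 + be *: m2) (al *: m1 + be *: m2) =
   2 * (al ^+ 2 * dot m1 m1 + be ^+ 2 * dot m2 m2)
   - dot (al *: m1 - be *: m2) (al *: m1 - be *: m2) by rewrite !vecE; ring.
have -> : dot (ga *: m1 - al *: m2) (ga *: m1 - al *: m2) =
   2 * (ga ^+ 2 * dot m1 m1 + al ^+ 2 * dot m2 m2)
   - dot (ga *: m1 + al *: m2) (ga *: m1 + al *: m2) by rewrite !vecE; ring.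
have p1 := dot_ge0 (al *: m1 - be *: m2); have p2 := dot_ge0 (ga *: m1 + al *: m2).
have q1 : al ^+ 2 * dot m1 m1 <= al ^+ 2 * K by rewrite ler_wpM2l ?sqr_ge0.
have q2 : be ^+ 2 * dot m2 m2 <= be ^+ 2 * K by rewrite ler_wpM2l ?sqr_ge0.
have q3 : ga ^+ 2 * dot m1 m1 <= ga ^+ 2 * K by rewrite ler_wpM2l ?sqr_ge0.
have q4 : al ^+ 2 * dot m2 m2 <= al ^+ 2 * K by rewrite ler_wpM2l ?sqr_ge0.
have k1 : 0 <= be ^+ 2 * K by rewrite mulr_ge0 ?sqr_ge0.
have k2 : 0 <= ga ^+ 2 * K by rewrite mulr_ge0 ?sqr_ge0.
have -> : 4 * K * (al ^+ 2 + be ^+ 2 + ga ^+ 2) =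
  4 * (al ^+ 2 * K) + 4 * (be ^+ 2 * K) + 4 * (ga ^+ 2 * K) by ring.
by lra.
Qed.

Lemma rotation_jacobian (m1 m2 a b : vec) (al be ga : R) :
  a = al *: m1 + be *: m2 -> b = ga *: m1 - al *: m2 ->
  cross b a = (al ^+ 2 + be * ga) *: cross m1 m2.
Proof. by move=> -> ->; apply: vec_eqP; rewrite !vecE; ring. Qed.

Lemma jac_cross (om : plane -> vec) (k : 'I_3) x :
  jac (comp om (k + 2%:R)) (comp om (k + 1)) x = cross (vpd e1 om x) (vpd e0 om x) ord0 k.
Proof. by rewrite /jac [RHS]mxE !vpdE; ring. Qed.

Lemma jacC (f g : plane -> R) x : jac f g x = - jac g f x.
Proof. by rewrite /jac; ring. Qed.

(** By [rotation_jacobian] the cross product of the partial derivatives of [rot] is the elliptic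
    quantity [al ^+ 2 + be * ga] times the normal. An index [k] in which the normal at [p] is
    nonzero therefore yields the pair of the other two components, ordered according to the sign
    [sg]. *)
Lemma quasiregular_rot U F G p : open U -> U p -> C2v U F -> C2v U G ->
  (forall x, U x -> 0 <= x ord0 0 -> isometric_at F G x) ->
  0 <= p ord0 0 -> 0 < mid_disc F G p ->
  exists (r c : R) (j l : 'I_3), let B := [set x | `|p - x| < r] in
  [/\ 0 < r, B `<=` U, 0 < c, C1v B (rot F G) &
    forall x, B x -> 0 <= x ord0 0 ->
     [/\ cross (rot F G x) (mid e0 F G x) = dif2 e0 F G x,
         cross (rot F G x) (mid e1 F G x) = dif2 e1 F G x &
     c * (dot (vpd e0 (rot F G) x) (vpd e0 (rot F G) x)
        + dot (vpd e1 (rot F G) x) (vpd e1 (rot F G) x))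
     <= jac (comp (rot F G) j) (comp (rot F G) l) x]].
Proof.
move=> Uo Up FC GC iso p0 disc0.
pose m1 := mid e0 F G; pose m2 := mid e1 F G.
have m1C : C1v U m1 := C1v_mid Uo FC GC e0.
have m2C : C1v U m2 := C1v_mid Uo FC GC e1.
pose nu x := cross (m1 x) (m2 x).
have nuC : C1v U nu by apply: C1v_cross.
pose L x := dot (vpd e0 m1 x) (nu x).
pose M x := dot (vpd e1 m1 x) (nu x).
pose N x := dot (vpd e1 m2 x) (nu x).
have cV v (H : plane -> vec) : C1v U H -> forall k, cont (comp (vpd v H) k) p.
  by move=> HC k; rewrite comp_vpd; exact: (C1_pd_cont (HC k)).
have cnu k : cont (comp nu k) p by exact: (C1_cont (nuC k)).
have Lc : cont L p by apply: cont_dot => //; exact: cV.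
have Mc : cont M p by apply: cont_dot => //; exact: cV.
have Nc : cont N p by apply: cont_dot => //; exact: cV.
pose D x := L x * N x - M x * M x.
have Dc : cont D p by apply: contB; apply: contM.
have Dp : 0 < D p by rewrite /D -expr2; exact: disc0.
have nup : nu p != 0 by exact: disc_normal_neq0 disc0.
have [k nuk] : exists k, nu p ord0 k != 0.
  apply/existsP; apply: contraNT nup => /existsPn h; apply/eqP/rowP => k.
  by rewrite [RHS]mxE; apply/eqP; move: (h k); rewrite negbK.
have [sg sgE sgk] : exists2 sg : R, sg = 1 \/ sg = -1 & 0 < sg * nu p ord0 k.
  have [h|h] := ltP 0 (nu p ord0 k).
    by exists 1; [left|rewrite mul1r].
  exists (-1); first by right.
  by rewrite mulN1r oppr_gt0 lt_neqAle nuk.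
have skc : cont (fun x => sg * comp nu k x) p by apply: contM => //; exact: cont_cst.
pose d := Num.min (D p) (sg * nu p ord0 k) / 2.
have md : 0 < Num.min (D p) (sg * nu p ord0 k) by rewrite lt_min Dp sgk.
have d0 : 0 < d by rewrite divr_gt0.
have dm : d < Num.min (D p) (sg * nu p ord0 k) by rewrite /d; lra.
have [dD dk] : d < D p /\ d < sg * comp nu k p by move: dm; rewrite lt_min => /andP[].
have m11c : cont (fun x => dot (m1 x) (m1 x)) p.
  by apply: cont_dot => i; exact: (C1_cont (m1C i)).
have m22c : cont (fun x => dot (m2 x) (m2 x)) p.
  by apply: cont_dot => i; exact: (C1_cont (m2C i)).
pose K := 1 + `|L p| + `|M p| + `|N p| + dot (m1 p) (m1 p) + dot (m2 p) (m2 p).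
have [[nL nM] nN] := (normr_ge0 (L p), normr_ge0 (M p), normr_ge0 (N p)).
have [n1 n2] := (dot_ge0 (m1 p), dot_ge0 (m2 p)).
have K0 : 0 < K by rewrite /K; lra.
have bound g : cont g p -> `|g p| < K -> \forall x \near p, `|g x| < K.
  move=> gc; rewrite ltr_norml => /andP[h1 h2].
  by apply: filterS2 (cont_gt gc h1) (cont_lt gc h2) => x; rewrite ltr_norml => -> ->.
have [r r0 Hr] : exists2 r : R, 0 < r & forall x, `|p - x| < r ->
   [/\ U x, `|L x| < K, `|M x| < K & `|N x| < K] /\
   [/\ dot (m1 x) (m1 x) < K, dot (m2 x) (m2 x) < K, d < D x & d < sg * comp nu k x].
  suff /nbhs_normP[r /= r0 H] : \forall x \near p,
    [/\ U x, `|L x| < K, `|M x| < K & `|N x| < K] /\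
    [/\ dot (m1 x) (m1 x) < K, dot (m2 x) (m2 x) < K, d < D x & d < sg * comp nu k x].
    by exists r.
  have h1 := near_open Uo Up.
  have h2 : \forall x \near p, `|L x| < K by apply: bound => //; rewrite /K; lra.
  have h3 : \forall x \near p, `|M x| < K by apply: bound => //; rewrite /K; lra.
  have h4 : \forall x \near p, `|N x| < K by apply: bound => //; rewrite /K; lra.
  have h5 : \forall x \near p, dot (m1 x) (m1 x) < K by apply: cont_lt => //; rewrite /K; lra.
  have h6 : \forall x \near p, dot (m2 x) (m2 x) < K by apply: cont_lt => //; rewrite /K; lra.
  have h7 := cont_gt Dc dD; have h8 := cont_gt skc dk.
  near=> x; split; split.
  - exact: (near h1 x).
  - exact: (near h2 x).
  - exact: (near h3 x).
  - exact: (near h4 x).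
  - exact: (near h5 x).
  - exact: (near h6 x).
  - exact: (near h7 x).
  - exact: (near h8 x).
pose B := [set x | `|p - x| < r].
have BU : B `<=` U by move=> x /Hr[[]].
have Bo : open B := @open_ball R _ p r.
have FB := C2v_subset BU FC; have GB := C2v_subset BU GC.
have nuB x : B x -> dot (nu x) (nu x) != 0.
  move=> /Hr[_ [_ _ _ dkx]]; apply/eqP => /dot_eq0 h.
  by move: dkx; rewrite /comp h mxE mulr0 ltNge (ltW d0).
have rotC : C1v B (rot F G) := C1v_rot Bo FB GB nuB.
(* [d] bounds the [k]-th entry of the normal from below, the middle factor is the constant of
   [ellipticity], and [4 * K] is that of [rotation_gradient_bound]. *)
pose q := d * (d ^+ 3 / (10 * K ^+ 6 + 2 * K ^+ 2 * d ^+ 2)) / (4 * K).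
have den : 0 < 10 * K ^+ 6 + 2 * K ^+ 2 * d ^+ 2.
  by rewrite addr_gt0 ?mulr_gt0 ?exprn_gt0.
have q0 : 0 < q by rewrite /q divr_gt0//; [apply: mulr_gt0 => //; apply: divr_gt0 => //; exact: exprn_gt0|exact: mulr_gt0].
pose E x := dot (vpd e0 (rot F G) x) (vpd e0 (rot F G) x)
        + dot (vpd e1 (rot F G) x) (vpd e1 (rot F G) x).
pose J x := sg * jac (comp (rot F G) (k + 2%:R)) (comp (rot F G) (k + 1)) x.
(* Only where [x_0 > 0] are the metrics known to agree on a whole neighborhood, as differentiation
   requires; [main'] reaches the boundary line by continuity. *)
have main x : B x -> 0 < x ord0 0 -> q * E x <= J x.
  move=> Bx x0; have [[Ux Lx Mx Nx] [m1x m2x Dx kx]] := Hr _ Bx.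
  pose O := [set x | B x /\ - x ord0 0 < 0].
  have Oo : open O.
    by apply: open_sublevel => // y _; apply: contN; exact: (C1_cont (@C1_coord R setT 0)).
  have OB : O `<=` B by move=> y [].
  have isoO y : O y -> isometric_at F G y.
    by move=> [By]; rewrite oppr_lt0 => y0; apply: iso; [exact: BU|exact: ltW].
  have Ox : O x by split=> //; rewrite oppr_lt0.
  have [al [be [ga [aE bE LMN]]]] := rot_derivative Oo (C2v_subset OB FB)
    (C2v_subset OB GB) (fun y Oy => nuB _ (OB y Oy)) isoO Ox.
  have el : d ^+ 3 / (10 * K ^+ 6 + 2 * K ^+ 2 * d ^+ 2) * (al ^+ 2 + be ^+ 2 + ga ^+ 2)
      <= al ^+ 2 + be * ga.
    by apply: (@ellipticity _ (L x) (M x) (N x)) LMN => //; rewrite ?expr2; exact: ltW.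
  have gb := rotation_gradient_bound (ltW K0) (ltW m1x) (ltW m2x) aE bE.
  rewrite /J jac_cross (rotation_jacobian aE bE) mxE mulrCA.
  set S := al ^+ 2 + be ^+ 2 + ga ^+ 2 in el gb.
  have S0 : 0 <= S by rewrite !addr_ge0 ?sqr_ge0.
  have c1 : 0 <= d ^+ 3 / (10 * K ^+ 6 + 2 * K ^+ 2 * d ^+ 2) by rewrite divr_ge0 ?exprn_ge0 ?ltW.
  apply: (@le_trans _ _ (q * (4 * K * S))); first by rewrite ler_wpM2l// ltW.
  have -> : q * (4 * K * S) = (d ^+ 3 / (10 * K ^+ 6 + 2 * K ^+ 2 * d ^+ 2) * S) * d.
    by rewrite /q; field; rewrite !lt0r_neq0.
  by apply: ler_pM; [exact: mulr_ge0|exact: ltW|exact: el|exact: ltW].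
have Ec x : B x -> cont E x.
  have cR v i (Bx : B x) : cont (comp (vpd v (rot F G)) i) x.
    by rewrite comp_vpd; exact: (C1_pd_cont (rotC i)).
  by move=> Bx; apply: contD; apply: cont_dot => i; apply: cR.
have Jc x : B x -> cont J x.
  move=> Bx; have cR i v : cont (pd v (comp (rot F G) i)) x by exact: (C1_pd_cont (rotC i)).
  by apply: contM; [exact: cont_cst|apply: contB; apply: contM].
have main' x : B x -> 0 <= x ord0 0 -> q * E x <= J x.
  move=> Bx x0; rewrite -subr_ge0.
  apply: (@halfplane_ge0 R B Bo (fun x => J x - q * E x)) => //.
    by apply: contB; [exact: Jc|apply: contM; [exact: cont_cst|exact: Ec]].
  by move=> y By y0; rewrite subr_ge0 main.
have rm x : B x -> 0 <= x ord0 0 -> cross (rot F G x) (mid e0 F G x) = dif2 e0 F G x /\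
         cross (rot F G x) (mid e1 F G x) = dif2 e1 F G x.
  by move=> Bx x0; apply: (rot_mid nuB Bx); apply: iso => //; exact: BU.
exists r, q.
case: sgE => sgE; [exists (k + 2%:R), (k + 1)|exists (k + 1), (k + 2%:R)]; split => // x Bx x0;
  have [rm1 rm2] := rm x Bx x0; split=> //; apply: le_trans (main' x Bx x0) _.
- by rewrite /J sgE mul1r.
- by rewrite /J sgE mulN1r -jacC.
Unshelve. all: by end_near. Qed.
End quasiregular.

(** * Propagation of coincidence within a chart *)

Section local.
Variable R : realType.
Notation plane := 'rV[R]_2.
Notation vec := 'rV[R]_3.
Implicit Types (x y z v w : plane) (U : set plane) (F G : plane -> vec).
Notation e0 := (e0 R).
Notation e1 := (e1 R).
Notation square := (@square R).

Definition normal F x : vec := cross (vpd e0 F x) (vpd e1 F x).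

Definition curved F x : Prop := 0 < disc (vpd e0 F x) (vpd e1 F x)
  (vpd e0 (vpd e0 F) x) (vpd e1 (vpd e0 F) x) (vpd e1 (vpd e1 F) x).

(** The last condition encodes the orientation: relative to the normals of the coordinate frames,
    the two definite second forms have the same sign. *)
Definition isopair F G x : Prop :=
  [/\ isometric_at F G x, curved F x, curved G x &
      0 < dot (vpd e0 (vpd e0 F) x) (normal F x) * dot (vpd e0 (vpd e0 G) x) (normal G x)].

(** Where the frames coincide, the second form of [F + G] is a multiple of the sum of two definite
    forms of the same sign. Doubling both frame vectors multiplies the normal by 4 and the
    discriminant by 16. *)
Lemma mid_disc_gt0 U F G x : open U -> U x -> C2v U F -> C2v U G -> isopair F G x ->
  vpd e0 F x = vpd e0 G x -> vpd e1 F x = vpd e1 G x -> 0 < mid_disc F G x.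
Proof.
move=> Uo Ux FC GC [_ cF cG sFG] E0 E1.
rewrite /mid_disc /disc !(vpd_add _ (C2v_C1v _ FC) (C2v_C1v _ GC) Ux) /mid -E0 -E1.
move: cF cG sFG; rewrite /curved /disc /normal -E0 -E1.
move: (vpd e0 (vpd e0 F) x) (vpd e1 (vpd e0 F) x) (vpd e1 (vpd e1 F) x) => a b c.
move: (vpd e0 (vpd e0 G) x) (vpd e1 (vpd e0 G) x) (vpd e1 (vpd e1 G) x) => a' b' c'.
have -> : cross (vpd e0 F x + vpd e0 F x) (vpd e1 F x + vpd e1 F x) =
   4 *: cross (vpd e0 F x) (vpd e1 F x).
  by move: (vpd e0 F x) (vpd e1 F x) => p q; apply: vec_eqP; rewrite !vecE; ring.
move: (cross _ _) => n cF cG sFG; have := definite_sum cF cG sFG.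
rewrite !dotZr !dotDl => h.
have -> : 4 * (dot a n + dot a' n) * (4 * (dot c n + dot c' n)) - (4 * (dot b n + dot b' n)) ^+ 2
  = 16 * ((dot a n + dot a' n) * (dot c n + dot c' n) - (dot b n + dot b' n) ^+ 2) by ring.
by rewrite mulr_gt0.
Qed.

(* The tangential parts of the second derivatives are intrinsic (Christoffel
   symbols); at a point of the boundary line this follows by continuity. *)
Lemma second_derivatives_intrinsic U F G x : open U -> U x -> 0 <= x ord0 0 ->
  C2v U F -> C2v U G -> (forall y, U y -> 0 <= y ord0 0 -> isometric_at F G y) ->
  let F1 := vpd e0 F x in let F2 := vpd e1 F x in
  let G1 := vpd e0 G x in let G2 := vpd e1 G x in
  let F11 := vpd e0 (vpd e0 F) x in let F12 := vpd e1 (vpd e0 F) x in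
  let F22 := vpd e1 (vpd e1 F) x in
  let G11 := vpd e0 (vpd e0 G) x in let G12 := vpd e1 (vpd e0 G) x in
  let G22 := vpd e1 (vpd e1 G) x in
  [/\ dot F11 F1 = dot G11 G1, dot F12 F1 = dot G12 G1 & dot F22 F2 = dot G22 G2] /\
  [/\ dot F11 F2 = dot G11 G2, dot F12 F2 = dot G12 G2 & dot F22 F1 = dot G22 G1].
Proof.
move=> Uo Ux x0 FC GC iso F1 F2 G1 G2 F11 F12 F22 G11 G12 G22.
have Fv v := C2v_C1v v FC; have Gv v := C2v_C1v v GC.
have key u v w : (forall y, U y -> 0 <= y ord0 0 ->
      dot (vpd u F y) (vpd v F y) = dot (vpd u G y) (vpd v G y)) ->
    dot (vpd w (vpd u F) x) (vpd v F x) + dot (vpd u F x) (vpd w (vpd v F) x) =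
    dot (vpd w (vpd u G) x) (vpd v G x) + dot (vpd u G x) (vpd w (vpd v G) x).
  move=> E; have CF := C1_dot Uo (Fv u) (Fv v); have CG := C1_dot Uo (Gv u) (Gv v).
  rewrite -(pd_dot w (Fv u) (Fv v) Ux) -(pd_dot w (Gv u) (Gv v) Ux).
  apply/eqP; rewrite -subr_eq0 -(pdB w (C1_dif CF Ux) (C1_dif CG Ux)); apply/eqP.
  have CB := C1B Uo CF CG.
  apply: (halfplane_eq0 Uo (C1_pd_cont (v := w) CB Ux) Ux x0) => y Uy y0.
  pose O := [set z | U z /\ - z ord0 0 < 0].
  have Oo : open O.
    by apply: open_sublevel => // z _; apply: contN; exact: (C1_cont (@C1_coord R setT 0)).
  rewrite -(pd_cst w (0 : R) y); apply: (pd_near_eq Oo); first by split; rewrite ?oppr_lt0.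
  by move=> z [Uz]; rewrite oppr_lt0 => z0; rewrite E ?subrr// ltW.
have k00 w := key e0 e0 w (fun y Uy hy => let: And3 h _ _ := iso y Uy hy in h).
have k01 w := key e0 e1 w (fun y Uy hy => let: And3 _ h _ := iso y Uy hy in h).
have k11 w := key e1 e1 w (fun y Uy hy => let: And3 _ _ h := iso y Uy hy in h).
have := k00 e0; have := k00 e1; have := k01 e0; have := k01 e1; have := k11 e0; have := k11 e1.
rewrite (vpd_Young Uo e1 e0 FC Ux) (vpd_Young Uo e1 e0 GC Ux).
rewrite -/F11 -/F12 -/F22 -/G11 -/G12 -/G22 -/F1 -/F2 -/G1 -/G2.
move: F1 F2 G1 G2 F11 F12 F22 G11 G12 G22 => a b a' b' c d e c' d' e'.
rewrite !(dotC a) !(dotC b) !(dotC a') !(dotC b') => h1 h2 h3 h4 h5 h6.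
by split; split; lra.
Qed.

Section segments.
Variables (U : set plane) (F G : plane -> vec).
Hypotheses (FC : C1v U F) (GC : C1v U G).

Lemma eq_along_segment x v : (forall t : R, 0 <= t <= 1 -> U (x + t *: v)) ->
  (forall t : R, 0 < t < 1 -> vpd e0 F (x + t *: v) = vpd e0 G (x + t *: v) /\
     vpd e1 F (x + t *: v) = vpd e1 G (x + t *: v)) ->
  F x = G x -> F (x + v) = G (x + v).
Proof.
move=> Ut E FG; apply/rowP => k.
have dF t (t01 : 0 <= t <= 1) := C1_dif (FC k) (Ut t t01).
have dG t (t01 : 0 <= t <= 1) := C1_dif (GC k) (Ut t t01).
have [|t t01] := @line_MVT R plane (fun y => comp F k y - comp G k y) x v.
  by move=> t t01; apply: difB; [exact: dF|exact: dG].
have t01' : 0 <= t <= 1 by lra.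
rewrite (pdB v (dF t t01') (dG t t01')) (pd_plane v (dF t t01')) (pd_plane v (dG t t01')).
have [E0 E1] := E t t01.
have FGk : comp F k x = comp G k x by rewrite /comp FG.
rewrite -!vpdE E0 E1 subrr FGk subrr subr0 => /eqP.
by rewrite subr_eq0 => /eqP.
Qed.
End segments.

Lemma vpd_eq_near F G x : (\forall y \near x, F y = G y) ->
  exists2 r : R, 0 < r & forall y, `|x - y| < r ->
    F y = G y /\ forall v, vpd v F y = vpd v G y.
Proof.
move=> /nbhs_normP[r /= r0 Hr]; exists r => // y xy.
split=> [|v]; first exact: Hr.
by apply: (vpd_near_eq (@open_ball R _ x r)) => // z xz; exact: Hr.
Qed.

Lemma rot_dif2_eq0 F G x : cross (rot F G x) (mid e0 F G x) = dif2 e0 F G x ->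
  cross (rot F G x) (mid e1 F G x) = dif2 e1 F G x -> rot F G x = 0 ->
  vpd e0 F x = vpd e0 G x /\ vpd e1 F x = vpd e1 G x.
Proof.
have c0 (a : vec) : cross 0 a = 0 by apply: vec_eqP; rewrite !vecE; ring.
move=> h0 h1 E; move: h0 h1; rewrite E !c0 => /esym/eqP + /esym/eqP.
by rewrite !subr_eq0 => /eqP ? /eqP ?.
Qed.

Lemma rot_eq0 F G x : vpd e0 F x = vpd e0 G x -> vpd e1 F x = vpd e1 G x -> rot F G x = 0.
Proof. by move=> E0 E1; rewrite /rot /dif2 E0 E1 !subrr rotation_eq0. Qed.

(** Equal first derivatives at the single point [p] make the midsurface curved, and hence [rot]
    quasiregular, on a ball. If [F = G] near [q], then [rot] vanishes on the short side of a thin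
    rectangle with axis from [q] towards [z]. The radius [r] does not depend on [q], so that limit
    points of the coincidence set can be treated. *)
Lemma propagation U F G p : open U -> U p -> C2v U F -> C2v U G ->
  (forall x, U x -> 0 <= x ord0 0 -> isopair F G x) -> 0 <= p ord0 0 ->
  vpd e0 F p = vpd e0 G p -> vpd e1 F p = vpd e1 G p ->
  exists2 r : R, 0 < r & [set x | `|p - x| < r] `<=` U /\
   forall q z, `|p - q| < r -> 0 < q ord0 0 -> (\forall y \near q, F y = G y) ->
     `|p - z| < r -> 0 < z ord0 0 -> F z = G z.
Proof.
move=> Uo Up FC GC pair p0 E0 E1.
have iso x : U x -> 0 <= x ord0 0 -> isometric_at F G x by move=> Ux x0; have [] := pair x Ux x0.
have disc0 := mid_disc_gt0 Uo Up FC GC (pair p Up p0) E0 E1.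
have [r [c [j [l [r0 BU c0 rotC qr]]]]] := quasiregular_rot Uo Up FC GC iso p0 disc0.
exists r => //; split=> // q z pq q0 FGq pz z0.
have [rho rho0 Hq] := vpd_eq_near FGq.
(* [z'] prolongs the segment from [q] to [z]. *)
pose mu0 := Num.min (r - `|p - z|) (z ord0 0).
have mu00 : 0 < mu0 by rewrite lt_min z0 subr_gt0 pz.
pose ka := mu0 / 2 / (`|z - q| + 1).
have zq1 : 0 < `|z - q| + 1 by rewrite ltr_wpDl.
have ka0 : 0 < ka by rewrite !divr_gt0.
have kazq : ka * `|z - q| < mu0.
  rewrite /ka mulrAC ltr_pdivrMr//.
  apply: (@lt_le_trans _ _ (mu0 / 2 * (`|z - q| + 1))); first by rewrite ltr_pM2l ?divr_gt0// ltrDl.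
  by apply: ler_wpM2r; [exact: ltW|lra].
have [kr kz] : ka * `|z - q| < r - `|p - z| /\ ka * `|z - q| < z ord0 0.
  by move: kazq; rewrite lt_min => /andP[].
pose e := (1 + ka) *: (z - q).
pose z' := q + e.
have z'E : z' = z + ka *: (z - q) by apply: plane_eqP; rewrite !mxE; ring.
have pz' : `|p - z'| < r.
  have -> : p - z' = (p - z) - ka *: (z - q) by rewrite z'E opprD addrA.
  by apply: le_lt_trans (ler_normB _ _) _; rewrite normrZ (gtr0_norm ka0); lra.
have z'0 : 0 < z' ord0 0.
  have h : `|ka * (z - q) ord0 0| <= ka * `|z - q|.
    by rewrite normrM (gtr0_norm ka0); apply: ler_wpM2l; [exact: ltW|exact: coord0_le].
  have -> : z' ord0 0 = z ord0 0 + ka * (z - q) ord0 0 by rewrite z'E !mxE.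
  by move: h; rewrite ler_norml => /andP[h _]; lra.
(* Bound for the width: below the distances of both ends to the boundary of the ball and to the line
   [x_0 = 0], so that convexity keeps the rectangle inside, and below [rho], so that the initial
   side lies where [F = G]. *)
pose mu := Num.min (Num.min (r - `|p - q|) (r - `|p - z'|)) (Num.min (Num.min (q ord0 0) (z' ord0 0)) rho).
have mu_gt0 : 0 < mu by rewrite !lt_min !subr_gt0 pq pz' q0 z'0.
pose eta := mu / 2 / (`|e| + 1).
have e_gt0 : 0 < `|e| + 1 by rewrite ltr_wpDl.
have eta0 : 0 < eta by rewrite !divr_gt0.
have etae : eta * `|e| < mu.
  rewrite /eta mulrAC ltr_pdivrMr//.
  apply: (@lt_le_trans _ _ (mu / 2 * (`|e| + 1))); first by rewrite ltr_pM2l ?divr_gt0// ltrDl.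
  by apply: ler_wpM2r; [exact: ltW|lra].
have [[etaq etaz'] [[etaq0 etaz'0] etarho]] : (eta * `|e| < r - `|p - q| /\ eta * `|e| < r - `|p - z'|) /\
    (eta * `|e| < q ord0 0 /\ eta * `|e| < z' ord0 0) /\ eta * `|e| < rho.
  by move: etae; rewrite !lt_min => /andP[/andP[-> ->] /andP[/andP[-> ->] ->]].
have [->|zq] := eqVneq z q; first by have [] := Hq q; rewrite ?subrr ?normr0.
(* The sides are [e] and [eta] times [e] turned by a right angle, so the Jacobian is the positive
   constant [eta * (e ord0 0 ^+ 2 + e ord0 1 ^+ 2)]. *)
pose P0 y := q ord0 0 + (y ord0 1 - 1 / 2) * (- (eta * e ord0 1)) + y ord0 0 * e ord0 0.
pose P1 y := q ord0 1 + (y ord0 1 - 1 / 2) * (eta * e ord0 0) + y ord0 0 * e ord0 1.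
pose W := [set y | `|p - pt (P0 y) (P1 y)| < r].
have coC i := @C1_coord R setT i.
have affC (a b k k' : R) : C1 setT (fun y : plane => a + (y ord0 1 - k) * b + y ord0 0 * k').
  have o := @C1_cst R plane setT.
  exact: (C1D openT (C1D openT (o a) (C1M openT (C1B openT (coC 1) (o k)) (o b)))
    (C1M openT (coC 0) (o k'))).
have affD (a b k k' : R) v y : pd v (fun y : plane => a + (y ord0 1 - k) * b + y ord0 0 * k') y =
   v ord0 1 * b + v ord0 0 * k'.
  have o (k : R) := dif_cst k y; have co i := coord_dif i y.
  rewrite (pdD v (difD (o a) (difM (difB (co 1) (o k)) (o b))) (difM (co 0) (o k'))).
  rewrite (pdD v (o a) (difM (difB (co 1) (o k)) (o b))) (pdM v (difB (co 1) (o k)) (o b)).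
  by rewrite (pdM v (co 0) (o k')) (pdB v (co 1) (o k)) !pd_cst !pd_coord; ring.
have P0C : C1 setT P0 by exact: affC.
have P1C : C1 setT P1 by exact: affC.
have Wo : open W.
  have := @open_comp _ _ (fun y => pt (P0 y) (P1 y)) [set x | `|p - x| < r].
  apply; last exact: open_ball.
  move=> y _; apply: differentiable_continuous.
  by apply: differentiable_pt; [exact: (C1_dif P0C)|exact: (C1_dif P1C)].
have psiE y : pt (P0 y) (P1 y) = (1 - y ord0 0) *: q + y ord0 0 *: z' +
    (y ord0 1 - 1 / 2) *: pt (- (eta * e ord0 1)) (eta * e ord0 0).
  rewrite /P0 /P1 /z'; move: (e) => e'.
  by apply: plane_eqP; rewrite !mxE /=; ring.
have perp (k : R) : `|k| <= 1 -> `|k *: pt (- (eta * e ord0 1)) (eta * e ord0 0) : plane| <= eta * `|e|.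
  move=> k1; rewrite normrZ; apply: (@le_trans _ _ (1 * `|pt (- (eta * e ord0 1)) (eta * e ord0 0) : plane|)).
    by rewrite ler_wpM2r.
  have ee : 0 <= eta * `|e| by apply: mulr_ge0; [exact: ltW|].
  rewrite mul1r (plane_norm_le _ ee) pt0 pt1 normrN !(normrM eta) (gtr0_norm eta0).
  by apply/andP; split; apply: ler_wpM2l; rewrite ?coord0_le ?coord1_le//; exact: ltW.
have half y : square y -> `|y ord0 1 - 1 / 2| <= 1.
  by move=> [_ /andP[h1 h2]]; rewrite ler_norml; clear - h1 h2; apply/andP; split; lra.
have convex_lt (t a b k : R) : 0 <= t <= 1 -> a < k -> b < k -> (1 - t) * a + t * b < k.
  move=> /andP[t0 t1] ak bk; apply: (@le_lt_trans _ _ (Num.max a b)); last by rewrite gt_max ak.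
  have ha : (1 - t) * a <= (1 - t) * Num.max a b by rewrite ler_wpM2l ?subr_ge0// le_max lexx.
  have hb : t * b <= t * Num.max a b by rewrite ler_wpM2l// le_max lexx orbT.
  by clear - ha hb; lra.
have [etaq' etaz''] : `|p - q| < r - eta * `|e| /\ `|p - z'| < r - eta * `|e| by clear - etaq etaz'; split; lra.
have KB y : square y -> `|p - pt (P0 y) (P1 y)| < r /\ 0 < pt (P0 y) (P1 y) ord0 0.
  move=> Ky; have [/andP[y0 y1] _] := Ky; have hp := perp _ (half y Ky).
  rewrite psiE; set N := _ *: pt _ _ in hp *; clearbody N.
  split.
    have -> : p - ((1 - y ord0 0) *: q + y ord0 0 *: z' + N) =
      ((1 - y ord0 0) *: (p - q) + y ord0 0 *: (p - z')) - N.
      by apply: plane_eqP; rewrite !mxE; ring.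
    apply: le_lt_trans (ler_normB _ _) _.
    have h : `|(1 - y ord0 0) *: (p - q) + y ord0 0 *: (p - z')| <=
        (1 - y ord0 0) * `|p - q| + y ord0 0 * `|p - z'|.
      apply: le_trans (ler_normD _ _) _; rewrite !normrZ !ger0_norm ?subr_ge0//.
    apply: le_lt_trans (lerD h hp) _; by rewrite -ltrBrDr; apply: convex_lt; rewrite ?y0.
  have hN := le_trans (coord0_le N) hp; move: hN; rewrite ler_norml => /andP[hN _].
  have -> : ((1 - y ord0 0) *: q + y ord0 0 *: z' + N) ord0 0 =
    (1 - y ord0 0) * q ord0 0 + y ord0 0 * z' ord0 0 + N ord0 0 by rewrite !mxE.
  have : (1 - y ord0 0) * - q ord0 0 + y ord0 0 * - z' ord0 0 < - (eta * `|e|).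
    by apply: convex_lt; [rewrite y0|rewrite ltrN2|rewrite ltrN2].
  by rewrite !mulrN => h; clear - h hN; lra.
have KW : square `<=` W by move=> y /KB[].
have WT (g : plane -> R) : C1 setT g -> C1 W g by apply: C1_subset.
have e2 : 0 < e ord0 0 ^+ 2 + e ord0 1 ^+ 2.
  rewrite lt_neqAle addr_ge0 ?sqr_ge0// andbT eq_sym paddr_eq0 ?sqr_ge0// !sqrf_eq0.
  apply: contra zq => /andP[/eqP h0 /eqP h1]; rewrite -subr_eq0.
  have ez : e = 0 by apply: plane_eqP; rewrite ?h0 ?h1 mxE.
  move/eqP: ez; rewrite scaler_eq0 => /orP[|//].
  by rewrite gt_eqF// ltr_wpDl.
have zero : forall y, square y -> y ord0 0 < 1 -> 0 < y ord0 1 < 1 -> rot F G (pt (P0 y) (P1 y)) = 0.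
  apply: (strip_unique_continuation (@open_ball R _ p r) rotC c0 Wo KW (WT _ P0C) (WT _ P1C) (j := j) (l := l)
    (sg := 1) (delta := eta * (e ord0 0 ^+ 2 + e ord0 1 ^+ 2))).
  - by [].
  - by move=> y Ky /=; have [h1 h2] := KB y Ky; have [_ _] := qr _ h1 (ltW h2).
  - exact: mulr_gt0.
  - by left.
  - move=> y Ky; rewrite mul1r /jac !affD !eE le_eqVlt; apply/orP; left; apply/eqP; ring.
  - move=> y Ky y0.
    have [_ h] : F (pt (P0 y) (P1 y)) = G (pt (P0 y) (P1 y)) /\
        forall v, vpd v F (pt (P0 y) (P1 y)) = vpd v G (pt (P0 y) (P1 y)).
      apply: Hq; rewrite psiE y0 subr0 scale1r scale0r addr0 opprD addrA subrr sub0r normrN.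
      exact: le_lt_trans (perp _ (half y Ky)) etarho.
    exact: rot_eq0.
have segE (t : R) : q + t *: (z - q) = pt (P0 (pt (t / (1 + ka)) (1 / 2))) (P1 (pt (t / (1 + ka)) (1 / 2))).
  have k1 : 1 + ka != 0 by rewrite lt0r_neq0// addr_gt0.
  rewrite psiE pt0 pt1 subrr scale0r addr0 /z' /e.
  by apply: plane_eqP; rewrite !mxE; field.
(* [z] sits at the parameter [1 / (1 + ka) < 1], away from the far side of the rectangle, which
   [strip_unique_continuation] does not reach. *)
have segK (t : R) : 0 <= t <= 1 -> square (pt (t / (1 + ka)) (1 / 2)) /\ t / (1 + ka) < 1.
  move=> /andP[t0 t1]; have k1 : 0 < 1 + ka by rewrite addr_gt0.
  have tk : t / (1 + ka) < 1 by rewrite ltr_pdivrMr// mul1r; clear - t1 ka0; lra.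
  rewrite /square /= pt0 pt1 divr_ge0 ?(ltW k1)// (ltW tk); split=> //; split=> //.
  by rewrite divr_ge0//= ler_pdivrMr//; clear - t1 ka0; lra.
rewrite -(subrK q z) addrC.
apply: (eq_along_segment (U := U) FC.1 GC.1); last by have [] := Hq q; rewrite ?subrr ?normr0.
- by move=> t t01; rewrite segE; apply: BU; have [/KB[]] := segK t t01.
- move=> t t01; have t01' : 0 <= t <= 1 by clear - t01; lra.
  rewrite segE; have [Ky y1] := segK t t01'; have [h1 h2] := KB _ Ky.
  have [r1 r2 _] := qr _ h1 (ltW h2).
  apply: (rot_dif2_eq0 r1 r2); apply: zero => //; rewrite ?pt0 ?pt1//.
  by rewrite divr_gt0//= ltr_pdivrMr//; clear - t01 ka0; lra.
Qed.
End local.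

(** * Coincidence next to a curve *)

Section initial.
Variable R : realType.
Notation plane := 'rV[R]_2.
Notation vec := 'rV[R]_3.
Implicit Types (U : set plane) (F G : plane -> vec).
Notation e0 := (e0 R).
Notation e1 := (e1 R).
Notation square := (@square R).
Notation d1 := (@pd R R^o 1).

Section along_curve.
Variables (U : set plane) (F G : plane -> vec) (c0 c1 : R^o -> R) (I : set R^o).
Hypotheses (Uo : open U) (FC : C2v U F) (GC : C2v U G).
Hypothesis pair : forall x : plane, U x -> 0 <= x ord0 0 -> isopair F G x.
Hypotheses (Io : open I) (c0C : C1 I c0) (c1C : C1 I c1).
Hypotheses (d0C : C1 I (d1 c0)) (d1C : C1 I (d1 c1)).
Hypothesis cU : forall t, I t -> U (pt (c0 t) (c1 t)).
Hypothesis c0_ge0 : forall t, I t -> 0 <= c0 t.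
Hypothesis FGc : forall t, I t -> F (pt (c0 t) (c1 t)) = G (pt (c0 t) (c1 t)).

Let vel (f : plane -> R) t : R :=
  d1 c0 t * pd e0 f (pt (c0 t) (c1 t)) + d1 c1 t * pd e1 f (pt (c0 t) (c1 t)).

Lemma agree_along_curve t : I t -> (d1 c0 t != 0) || (d1 c1 t != 0) ->
  vpd e0 F (pt (c0 t) (c1 t)) = vpd e0 G (pt (c0 t) (c1 t)) /\
  vpd e1 F (pt (c0 t) (c1 t)) = vpd e1 G (pt (c0 t) (c1 t)).
Proof.
move=> It cn0; set x := pt (c0 t) (c1 t).
have Ux : U x by exact: cU.
have x0 : 0 <= x ord0 0 by rewrite pt0; exact: c0_ge0.
have velE (f : plane -> R) s : C1 U f -> I s -> d1 (fun r => f (pt (c0 r) (c1 r))) s = vel f s.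
  move=> fC Is; exact: (pd_chain (C1_dif c0C Is) (C1_dif c1C Is) _ (C1_dif fC (cU Is))).
have velEq k s : I s -> vel (comp F k) s = vel (comp G k) s.
  move=> Is; rewrite -(velE _ _ (FC.1 k) Is) -(velE _ _ (GC.1 k) Is).
  by apply: (pd_near_eq Io) => // r Ir; rewrite /comp FGc.
have accE (f : plane -> R) : C1 U f -> C1 U (pd e0 f) -> C1 U (pd e1 f) -> d1 (vel f) t =
    d1 c0 t * vel (pd e0 f) t + pd e0 f x * d1 (d1 c0) t +
    (d1 c1 t * vel (pd e1 f) t + pd e1 f x * d1 (d1 c1) t).
  move=> fC f0 f1.
  have D0 := dif_chain (C1_dif c0C It) (C1_dif c1C It) (C1_dif f0 (cU It)).
  have D1 := dif_chain (C1_dif c0C It) (C1_dif c1C It) (C1_dif f1 (cU It)).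
  have d0 := C1_dif d0C It; have d1' := C1_dif d1C It.
  rewrite (pdD _ (difM d0 D0) (difM d1' D1)) (pdM _ d0 D0) (pdM _ d1' D1).
  by rewrite (velE _ _ f0 It) (velE _ _ f1 It).
have iso y : U y -> 0 <= y ord0 0 -> isometric_at F G y by move=> Uy y0; have [] := pair Uy y0.
have [[C111 C121 C222] [C112 C122 C221]] := second_derivatives_intrinsic Uo Ux x0 FC GC iso.
have [[i00 i01 i11] cF cG sFG] := pair Ux x0.
have YF := vpd_Young Uo e0 e1 FC Ux; have YG := vpd_Young Uo e0 e1 GC Ux.
have comp2 (H : plane -> vec) v w k : pd v (pd w (comp H k)) x = vpd v (vpd w H) x ord0 k.
  by rewrite vpdE comp_vpd.
apply: (frames_agree (p := d1 c0 t) (q := d1 c1 t) (p' := d1 (d1 c0) t) (q' := d1 (d1 c1) t)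
  i00 i01 i11 C111 C112 C121 C122 C221 C222 cF cG sFG cn0).
  by apply/rowP => k; have := velEq k _ It; rewrite /vel -/x !mxE.
have sub (H : plane -> vec) v : C2v U H -> forall k, C1 U (pd v (comp H k)).
  by move=> HC k; rewrite -comp_vpd; exact: (HC.2 v k).
have acc k : d1 (vel (comp F k)) t = d1 (vel (comp G k)) t.
  by apply: (pd_near_eq Io) => // s Is; exact: velEq.
apply/rowP => k; have := acc k.
rewrite (accE _ (FC.1 k) (sub _ e0 FC k) (sub _ e1 FC k)) (accE _ (GC.1 k) (sub _ e0 GC k) (sub _ e1 GC k)).
rewrite /vel -/x !comp2 -YF -YG -!vpdE => E.
rewrite ![(_ + _ : vec) _ _]mxE ![(_ *: _ : vec) _ _]mxE.
move: E; move: (vpd _ _ x ord0 k) (vpd _ _ x ord0 k) (vpd _ _ x ord0 k) (vpd _ _ x ord0 k) (vpd _ _ x ord0 k).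
move=> f1 f11 f12 f2 f22; move: (vpd _ _ x ord0 k) (vpd _ _ x ord0 k) (vpd _ _ x ord0 k) (vpd _ _ x ord0 k) (vpd _ _ x ord0 k).
move=> g1 g11 g12 g2 g22 E.
by apply: (etrans _ (etrans E _)); ring.
Qed.
End along_curve.

(** Range hypothesis of the intermediate value theorem, for an increasing or a decreasing function:
    the end values lie on opposite sides of [e] at distance at least [Z], and [v] is closer than
    that. *)
Lemma between_endpoints (sg e em ep v X Y Z : R) : sg = 1 \/ sg = -1 -> `|v - e| < Z ->
  Z <= X -> Z <= Y -> sg * (ep - e) = X -> sg * (em - e) = - Y ->
  Num.min em ep <= v <= Num.max em ep.
Proof.
rewrite ge_min le_max ltr_norml => -[->|->] /andP[h1 h2] h3 h4 h5 h6.
  by apply/andP; split; apply/orP; [left|right]; lra.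
by apply/andP; split; apply/orP; [right|left]; lra.
Qed.

(** Along the coordinate vector [(A, B)], [x - b] differs from [s / 2] by two errors below
    [s / 8]. *)
Lemma transversal_coordinate (A B s a0 a1 b0 b1 x0 x1 : R) :
  A = 1 /\ B = 0 \/ A = 0 /\ B = 1 ->
  `|a0 - b0| < s / 8 -> `|a1 - b1| < s / 8 ->
  `|a0 + s / 2 * A - x0| < s / 8 -> `|a1 + s / 2 * B - x1| < s / 8 ->
  0 < A * (x0 - b0) + B * (x1 - b1) < s.
Proof.
by rewrite !ltr_norml => -[[-> ->]|[-> ->]] /andP[? ?] /andP[? ?] /andP[? ?] /andP[? ?];
  apply/andP; split; lra.
Qed.

Lemma half_unit : (0 <= 1 / 2 :> R) && (1 / 2 <= 1 :> R).
Proof. by apply/andP; split; lra. Qed.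

Lemma half_itv (z : R) : `|z| <= 1 / 4 -> 0 < 1 / 2 + z < 1.
Proof. by rewrite ler_norml => /andP[lo hi]; clear - lo hi; apply/andP; split; lra. Qed.

Lemma transversal_solve (A B b0 b1 x0 x1 : R) : A = 1 /\ B = 0 \/ A = 0 /\ B = 1 ->
  A * b1 - B * b0 = A * x1 - B * x0 ->
  x0 = b0 + (A * (x0 - b0) + B * (x1 - b1)) * A /\
  x1 = b1 + (A * (x0 - b0) + B * (x1 - b1)) * B.
Proof. by case=> -[-> ->]; split; lra. Qed.

(** A rectangle is swept by translates of the curve in a transversal coordinate direction. The
    frames agree along the curve, so [rot] vanishes on the initial side, hence inside, and
    integration along the direction gives [F = G] there. The swept set still has to be shown to
    contain an open set, one that meets the open half-plane. *)
Lemma initial_vanishing U F G (c0 c1 : R^o -> R) (a : R) : open U -> C2v U F -> C2v U G ->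
  (forall x : plane, U x -> 0 <= x ord0 0 -> isopair F G x) ->
  0 < a -> let I := [set t : R^o | `|0 - t| < a] in
  C1 I c0 -> C1 I c1 -> C1 I (d1 c0) -> C1 I (d1 c1) ->
  (forall t, I t -> [/\ U (pt (c0 t) (c1 t)), 0 <= c0 t &
     F (pt (c0 t) (c1 t)) = G (pt (c0 t) (c1 t))]) ->
  (d1 c0 0 != 0) || (d1 c1 0 != 0) ->
  exists q : plane, [/\ U q, 0 < q ord0 0 & \forall y \near q, F y = G y].
Proof.
move=> Uo FC GC pair a0 I c0C c1C d0C d1C cI cn0.
have Io : open I by exact: open_ball.
have I0 : I 0 by rewrite /I /= subrr normr0.
have cU t : I t -> U (pt (c0 t) (c1 t)) by move=> /cI[].
have c0_ge0 t : I t -> 0 <= c0 t by move=> /cI[].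
have FGc t : I t -> F (pt (c0 t) (c1 t)) = G (pt (c0 t) (c1 t)) by move=> /cI[].
have agree t It n := @agree_along_curve U F G c0 c1 I Uo FC GC pair Io c0C c1C d0C d1C cU c0_ge0 FGc t It n.
set p := pt (c0 0) (c1 0).
have Up : U p by exact: cU.
have p0 : 0 <= p ord0 0 by rewrite pt0; exact: c0_ge0.
have iso x : U x -> 0 <= x ord0 0 -> isometric_at F G x by move=> Ux x0; have [] := pair x Ux x0.
have [E0 E1] := agree 0 I0 cn0.
have disc0 := mid_disc_gt0 Uo Up FC GC (pair p Up p0) E0 E1.
have [r [c [j [l [r0 BU cpos rotC qr]]]]] := quasiregular_rot Uo Up FC GC iso p0 disc0.
(* A coordinate direction transversal to the curve. As its entries are nonnegative, swept points
   stay in the half-plane; for a curve on the boundary line the direction is [e0]. *)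
have [A [B [AB [lam0 AB1]]]] : exists A B : R, [/\ 0 <= A, 0 <= B & A + B = 1] /\
    (A * d1 c1 0 - B * d1 c0 0 != 0 /\ (A = 1 /\ B = 0 \/ A = 0 /\ B = 1)).
  have [h|h] := eqVneq (d1 c1 0) 0.
    exists 0, 1; split; first by split; rewrite ?add0r.
    split; last by right.
    by rewrite mul0r sub0r mul1r oppr_eq0; move: cn0; rewrite h eqxx orbF.
  exists 1, 0; split; first by split; rewrite ?addr0.
  by split; [rewrite mul1r mul0r subr0|left].
have {AB} [A0 B0 AB] := AB.
have A1 : A <= 1 by lra.
have B1 : B <= 1 by lra.
pose lam t := A * d1 c1 t - B * d1 c0 t.
have lamn t : lam t != 0 -> (d1 c0 t != 0) || (d1 c1 t != 0).
  apply: contraNT; rewrite negb_or !negbK => /andP[/eqP h0 /eqP h1].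
  by rewrite /lam h0 h1 !mulr0 subrr.
have [sg sgE sgk] : exists2 sg : R, sg = 1 \/ sg = -1 & 0 < sg * lam 0.
  have [h|h] := ltP 0 (lam 0); first by exists 1; [left|rewrite mul1r].
  exists (-1); first by right.
  by rewrite mulN1r oppr_gt0 lt_neqAle h andbT.
pose ka := sg * lam 0 / 2.
have ka0 : 0 < ka by rewrite divr_gt0.
have kl : ka < sg * lam 0 by rewrite /ka; lra.
have r32 : 0 < r / 32 by rewrite divr_gt0.
have lamc : cont lam 0.
  by apply: contB; apply: contM; (try exact: cont_cst);
    [exact: (C1_cont d1C I0)|exact: (C1_cont d0C I0)].
have [rho rho0 Hrho] : exists2 rho : R, 0 < rho & forall t : R^o, `|0 - t| < rho ->
    [/\ I t, ka < sg * lam t, `|c0 0 - c0 t| < r / 32 & `|c1 0 - c1 t| < r / 32].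
  have /nbhs_normP[r1 /= r10 h1] := near_open Io I0.
  have slc : cont (fun t => sg * lam t) 0 by apply: contM => //; exact: cont_cst.
  have gap : 0 < sg * lam 0 - ka by rewrite subr_gt0.
  have /cvgrPdist_lt /(_ _ gap) /nbhs_normP[r2 /= r20 h2] := slc.
  have /cvgrPdist_lt /(_ _ r32) /nbhs_normP[r3 /= r30 h3] := C1_cont c0C I0.
  have /cvgrPdist_lt /(_ _ r32) /nbhs_normP[r4 /= r40 h4] := C1_cont c1C I0.
  exists (Num.min (Num.min r1 r2) (Num.min r3 r4)) => [|t]; first by rewrite !lt_min r10 r20 r30.
  rewrite !lt_min => /andP[/andP[t1 t2] /andP[t3 t4]]; split.
  - exact: h1.
  - by have /ltr_normlW := h2 t t2; clear; lra.
  - exact: h3.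
  - exact: h4.
(* On [W] the first coordinate is at most 2 in absolute value, so the shift is at most
   [2 * s = r / 2] and, with the error [r / 32], stays below [r]. Moreover [r / 32 = s / 8] is the
   tolerance of [transversal_coordinate]. *)
pose s := r / 4.
have s0 : 0 < s by rewrite divr_gt0.
pose tau (y : plane) : R := (y ord0 1 - 1 / 2) * rho.
pose P0 y := c0 (tau y) + y ord0 0 * (s * A).
pose P1 y := c1 (tau y) + y ord0 0 * (s * B).
pose W := [set y : plane | `|pt (1 / 2) (1 / 2) - y| < 1].
have Wo : open W by exact: open_ball.
have Wt y : W y -> `|0 - tau y| < rho.
  rewrite /W /= plane_norm_lt !mxE/= => /andP[_ h].
  rewrite sub0r normrN /tau normrM (gtr0_norm rho0) distrC.
  by rewrite gtr_pMl.
have KW : square `<=` W.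
  move=> y [/andP[h1 h2] /andP[h3 h4]]; rewrite /W /= plane_norm_lt !mxE/= !ltr_norml.
  by clear - h1 h2 h3 h4; apply/andP; split; apply/andP; split; lra.
have psiB y : W y -> `|p - pt (P0 y) (P1 y)| < r.
  move=> Wy; have [_ _ h0 h1] := Hrho _ (Wt y Wy).
  move: Wy; rewrite /W /= plane_norm_lt !mxE/= => /andP[y0 _].
  have y2 : `|y ord0 0| <= 2.
    by move: y0; rewrite ltr_norml ler_norml => /andP[lo hi]; clear - lo hi; apply/andP; split; lra.
  have sm (X : R) : 0 <= X <= 1 -> `|y ord0 0 * (s * X)| <= r / 2.
    move=> /andP[X0 X1]; rewrite normrM (_ : r / 2 = 2 * s); last by rewrite /s; field.
    apply: ler_pM => //; rewrite ger0_norm; last exact: mulr_ge0 (ltW s0) X0.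
    by apply: ler_piMr => //; exact: ltW.
  rewrite plane_norm_lt !mxE/= /P0 /P1 !opprD !addrA.
  apply/andP; split; apply: le_lt_trans (ler_normB _ _) _.
    by have := sm A (introT andP (conj A0 A1)); clear - h0 r0; lra.
  by have := sm B (introT andP (conj B0 B1)); clear - h1 r0; lra.
have tauC : C1 W tau.
  have o := @C1_cst R plane W.
  exact: (C1M Wo (C1B Wo (@C1_coord R W 1) (o _)) (o _)).
have tauD v y : pd v tau y = rho * v ord0 1.
  have o k := @dif_cst R plane k y; have d := coord_dif (1 : 'I_2) y.
  by rewrite (pdM v (difB d (o _)) (o _)) (pdB v d (o _)) !pd_cst pd_coord; ring.
have isd (f : R^o -> R) t : C1 I f -> I t -> is_derive (t : R^o) 1 (f : R^o -> R^o) (d1 f t).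
  move=> fC It; rewrite pdE; apply/derivableP/diff_derivable.
  exact: (C1_dif fC It).
have IW y : W y -> I (tau y) by move=> /Wt/Hrho[].
have ctC (f : R^o -> R) : C1 I f -> C1 I (d1 f) -> C1 W (fun y => f (tau y)).
  move=> fC dfC; apply: (C1_comp Wo tauC (k' := d1 f)) => y Wy; first exact: isd (IW y Wy).
  exact: (C1_cont dfC (IW y Wy)).
have linC (k : R) : C1 W (fun y : plane => y ord0 0 * k).
  exact: (C1M Wo (@C1_coord R W 0) (C1_cst W k)).
have P0C : C1 W P0 := C1D Wo (ctC _ c0C d0C) (linC _).
have P1C : C1 W P1 := C1D Wo (ctC _ c1C d1C) (linC _).
have PD (f : R^o -> R) k v y : C1 I f -> C1 I (d1 f) -> W y ->
    pd v (fun y : plane => f (tau y) + y ord0 0 * k) y = d1 f (tau y) * (rho * v ord0 1) + k * v ord0 0.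
  move=> fC dfC Wy.
  rewrite (pdD v (C1_dif (ctC _ fC dfC) Wy) (C1_dif (linC k) Wy)).
  rewrite (pd_compR v (C1_dif tauC Wy) (isd _ _ fC (IW y Wy))) tauD.
  by rewrite (pdM v (coord_dif 0 y) (dif_cst k y)) pd_cst pd_coord mulr0 add0r.
have psiH y : square y -> 0 <= pt (P0 y) (P1 y) ord0 0.
  move=> Ky; rewrite pt0 addr_ge0 ?c0_ge0//; first exact: IW (KW _ Ky).
  by case: Ky => /andP[h _] _; rewrite !mulr_ge0// ltW.
have psi0 (y : plane) : y ord0 0 = 0 -> pt (P0 y) (P1 y) = pt (c0 (tau y)) (c1 (tau y)) :> plane.
  by move=> y0; rewrite /P0 /P1 y0 !mul0r !addr0.
have lamt t : `|0 - t| < rho -> lam t != 0.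
  move=> /Hrho[_ h _ _]; have : 0 < sg * lam t by apply: lt_trans h.
  by apply: contraTneq => ->; rewrite mulr0 ltxx.
have zero : forall y, square y -> y ord0 0 < 1 -> 0 < y ord0 1 < 1 -> rot F G (pt (P0 y) (P1 y)) = 0.
  apply: (strip_unique_continuation (@open_ball R _ p r) rotC cpos Wo KW P0C P1C (j := j) (l := l)
    (sg := sg) (delta := s * rho * ka)).
  - by move=> y /psiB.
  - by move=> y Ky /=; have [_ _] := qr _ (psiB y (KW _ Ky)) (psiH y Ky).
  - exact: mulr_gt0 (mulr_gt0 s0 rho0) ka0.
  - by [].
  - move=> y Ky; have Wy := KW _ Ky; have [_ h _ _] := Hrho _ (Wt y Wy).
    rewrite /jac !PD// !eE.
    have -> : sg * ((d1 c0 (tau y) * (rho * 0) + s * A * 1) * (d1 c1 (tau y) * (rho * 1) + s * B * 0) -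
      (d1 c0 (tau y) * (rho * 1) + s * A * 0) * (d1 c1 (tau y) * (rho * 0) + s * B * 1)) =
      s * rho * (sg * lam (tau y)) by rewrite /lam; ring.
    by apply: ler_wpM2l; [exact: ltW (mulr_gt0 s0 rho0)|exact: ltW].
  - move=> y Ky y0; rewrite (psi0 y y0).
    have Wy := KW _ Ky.
    by have [h0 h1] := agree _ (IW y Wy) (lamn _ (lamt _ (Wt y Wy))); exact: rot_eq0.
have agreeP y : square y -> y ord0 0 < 1 -> 0 < y ord0 1 < 1 ->
    vpd e0 F (pt (P0 y) (P1 y)) = vpd e0 G (pt (P0 y) (P1 y)) /\
    vpd e1 F (pt (P0 y) (P1 y)) = vpd e1 G (pt (P0 y) (P1 y)).
  move=> Ky y1 yt; have [r1 r2 _] := qr _ (psiB y (KW _ Ky)) (psiH y Ky).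
  exact: (rot_dif2_eq0 r1 r2 (zero y Ky y1 yt)).
have eqP' y : square y -> y ord0 0 < 1 -> 0 < y ord0 1 < 1 ->
    F (pt (P0 y) (P1 y)) = G (pt (P0 y) (P1 y)).
  move=> Ky y1 yt; have [/andP[y0 _] yt'] := Ky.
  have Wy := KW _ Ky; have Ity := IW y Wy.
  pose v : plane := y ord0 0 *: pt (s * A) (s * B).
  have segE (t : R) : pt (c0 (tau y)) (c1 (tau y)) + t *: v =
      pt (P0 (pt (t * y ord0 0) (y ord0 1))) (P1 (pt (t * y ord0 0) (y ord0 1))).
    by rewrite /P0 /P1 /tau /v !pt0 !pt1; apply: plane_eqP; rewrite !mxE/=; ring.
  have segK (t : R) : 0 <= t <= 1 -> square (pt (t * y ord0 0) (y ord0 1)).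
    move=> /andP[t0 t1]; rewrite /square /= pt0 pt1; split=> //.
    by rewrite mulr_ge0//= mulr_ile1// ltW.
  have -> : pt (P0 y) (P1 y) = pt (c0 (tau y)) (c1 (tau y)) + v.
    by have := segE 1; rewrite scale1r mul1r ptK.
  apply: (eq_along_segment (U := U) FC.1 GC.1); last exact: FGc.
  - by move=> t t01; rewrite segE; apply: BU; apply: psiB; apply: KW; exact: segK.
  - move=> t t01; have t01' : 0 <= t <= 1 by clear - t01; lra.
    rewrite segE; apply: agreeP; rewrite ?pt0 ?pt1//; first exact: segK.
    by case/andP: t01 => t0 t1; rewrite mulr_ilt1// ltW.
(* The image of the open square contains a neighborhood of [q]. *)
pose q := pt (P0 (pt (1 / 2) (1 / 2))) (P1 (pt (1 / 2) (1 / 2))) : plane.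
have tauq : tau (pt (1 / 2) (1 / 2)) = 0 by rewrite /tau pt1 subrr mul0r.
have qE0 : q ord0 0 = c0 0 + s / 2 * A by rewrite /q pt0 /P0 tauq pt0; ring.
have qE1 : q ord0 1 = c1 0 + s / 2 * B by rewrite /q pt1 /P1 tauq pt0; ring.
(* Lines in the direction [(A, B)] are the level sets of [A * x_1 - B * x_0]. Since [sg * ell] has
   slope at least [ka], the intermediate value theorem finds the point of the curve on the line
   through a given [x], and the position of [x] on that line is the other coordinate. *)
pose ell (t : R^o) : R := A * c1 t - B * c0 t.
have ellC : C1 I ell.
  have o := @C1_cst R R^o I.
  exact: (C1B Io (C1M Io (o _) c1C) (C1M Io (o _) c0C)).
have ellD t : I t -> d1 ell t = lam t.
  move=> It; have o k := @dif_cst R R^o k t.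
  have h0 := C1_dif c0C It; have h1 := C1_dif c1C It.
  by rewrite (pdB _ (difM (o A) h1) (difM (o B) h0)) !pdM// !pd_cst /lam; ring.
(* With [|t| <= rho / 4] the second coordinate [1 / 2 + t / rho] lies between 1/4 and 3/4, inside
   the open square. *)
pose rh := rho / 4.
have rh0 : 0 < rh by rewrite divr_gt0.
have small (t : R) : `|t| <= rh -> `|0 - t| < rho.
  by rewrite sub0r normrN => /le_lt_trans; apply; rewrite /rh; clear - rho0; lra.
have mono (t : R) : `|t| = rh -> exists2 k : R, ka <= k & sg * (ell t - ell 0) = t * k.
  move=> tr.
  have It (u : R) : 0 <= u <= 1 -> `|u * t| <= rh.
    by move=> /andP[u0 u1]; rewrite normrM tr ger0_norm// ler_piMl// ltW.
  have [|u u01 E] := @line_MVT R R^o ell 0 t.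
    move=> u u01; rewrite add0r; apply: (C1_dif ellC).
    by have [] := Hrho _ (small _ (It u u01)).
  have u01' : 0 <= u <= 1 by clear - u01; lra.
  have [Iu hk _ _] := Hrho _ (small _ (It u u01')).
  exists (sg * lam (u * t)); first exact: ltW.
  move: E; rewrite !add0r -[in pd t](mulr1 t) => ->.
  rewrite (@pdZ R R^o ell (u *: (t : R^o)) (1 : R^o) t); last exact: (C1_dif ellC Iu).
  by rewrite ellD//; rewrite mulrCA.
have [k1 k1a k1E] : exists2 k : R, ka <= k & sg * (ell rh - ell 0) = rh * k.
  by apply: mono; rewrite gtr0_norm.
have [k2 k2a k2E] : exists2 k : R, ka <= k & sg * (ell (- rh) - ell 0) = - rh * k.
  by apply: mono; rewrite normrN gtr0_norm.
pose r2 := Num.min (s / 8) (rh * ka).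
have r20 : 0 < r2 by rewrite lt_min divr_gt0// mulr_gt0.
have subE (u v : plane) i : (u - v) ord0 i = u ord0 i - v ord0 i by rewrite !mxE.
have near_q x : `|q - x| < r2 -> F x = G x.
  rewrite plane_norm_lt !subE !lt_min => /andP[/andP[x0s x0k] /andP[x1s x1k]].
  have elq : A * q ord0 1 - B * q ord0 0 = ell 0.
    by rewrite qE0 qE1 /ell; ring.
  have dl : `|A * x ord0 1 - B * x ord0 0 - ell 0| < rh * ka.
    rewrite -elq; case: AB1 => -[-> ->]; rewrite !(mul0r, mul1r, subr0, sub0r).
      by rewrite distrC.
    by rewrite opprK addrC.
  have le_rh : - rh <= rh by clear - rh0; lra.
  have ell_cont : {within `[- rh, rh], continuous ell}.
    apply: continuous_in_subspaceT => t /set_mem /=; rewrite in_itv/= => trh.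
    have trh' : `|t| <= rh by rewrite ler_norml.
    have [It _ _ _] := Hrho t (small t trh').
    exact: (C1_cont ellC It).
  have range : Num.min (ell (- rh)) (ell rh) <= A * x ord0 1 - B * x ord0 0
      <= Num.max (ell (- rh)) (ell rh).
    have h1 : rh * ka <= rh * k1 by rewrite ler_pM2l.
    have h2 : rh * ka <= rh * k2 by rewrite ler_pM2l.
    by apply: (between_endpoints sgE dl h1 h2 k1E); rewrite k2E mulNr.
  have [t trh tE] := IVT le_rh ell_cont range.
  have {}trh : `|t| <= rh by rewrite ler_norml; move: trh; rewrite in_itv.
  have [It _ ct0 ct1] := Hrho t (small t trh).
  pose mu := A * (x ord0 0 - c0 t) + B * (x ord0 1 - c1 t).
  have r8 : r / 32 = s / 8 by rewrite /s; field.
  rewrite r8 in ct0 ct1; rewrite qE0 in x0s; rewrite qE1 in x1s.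
  have /andP[mu0 mu1] : 0 < mu < s := transversal_coordinate AB1 ct0 ct1 x0s x1s.
  pose y : plane := pt (mu / s) (1 / 2 + t / rho).
  have rho_neq0 : rho != 0 by exact: lt0r_neq0.
  have s_neq0 : s != 0 by exact: lt0r_neq0.
  have tauy : tau y = t by rewrite /tau /y pt1; field.
  have xE : x = pt (P0 y) (P1 y).
    have PE k : mu / s * (s * k) = mu * k by rewrite (mulrA (mu / s)) divfK.
    rewrite /P0 /P1 tauy /y pt0 !PE.
    have [? ?] := transversal_solve AB1 tE.
    by apply: plane_eqP; rewrite ?pt0 ?pt1.
  have t4 : `|t / rho| <= 1 / 4.
    by rewrite normrM normfV (gtr0_norm rho0) ler_pdivrMr//; apply: le_trans trh _; rewrite /rh; clear - rho0; lra.
  have y0 : 0 < y ord0 0 by rewrite pt0; exact: divr_gt0.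
  have y1 : y ord0 0 < 1 by rewrite pt0 ltr_pdivrMr// mul1r.
  have yt : 0 < y ord0 1 < 1.
    by rewrite pt1; exact: half_itv.
  have Ky : square y by case/andP: (yt) => h1 h2; split; apply/andP; split; exact: ltW.
  by rewrite xE; exact: eqP'.
have half01 := half_unit.
have sqh : square (pt (1 / 2) (1 / 2)) by rewrite /square /= pt0 pt1.
have qB : `|p - q| < r by exact: psiB (KW _ sqh).
have q0 : 0 <= q ord0 0 by exact: psiH sqh.
pose r3 := Num.min r2 (r - `|p - q|).
have r30 : 0 < r3 by rewrite lt_min r20 subr_gt0.
(* At hand is only [0 <= q ord0 0]; a small move along [e0] enters the open half-plane without
   leaving the neighborhood of [q]. *)
pose q' := q + (r3 / 2) *: e0.
have qq' : `|q - q'| <= r3 / 2.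
  rewrite /q' opprD addrA subrr sub0r normrN normrZ gtr0_norm ?divr_gt0//.
  by rewrite ler_piMr ?divr_ge0 ?(ltW r30)// plane_norm_le// !eE normr1 normr0 lexx ler01.
have r3h : r3 / 2 < r3 by rewrite ltr_pdivrMr// ltr_pMr// ltr1n.
exists q'; split.
- apply: BU => /=; rewrite -(subrKA q).
  apply: le_lt_trans (ler_normD _ _) _; rewrite -ltrBrDl.
  by apply: le_lt_trans qq' _; apply: lt_le_trans r3h _; rewrite ge_min lexx orbT.
- have -> : q' ord0 0 = q ord0 0 + r3 / 2 by rewrite !mxE /= mulr1.
  by rewrite ltr_wpDl// divr_gt0.
- apply/nbhs_normP; exists (r3 / 2) => [|x /= xq]; first by rewrite /= divr_gt0.
  apply: near_q; rewrite -(subrKA q'); apply: le_lt_trans (ler_normD _ _) _.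
  apply: lt_le_trans (_ : r3 <= r2); last by rewrite ge_min lexx.
  by rewrite [X in _ < X](splitr r3); apply: ler_ltD.
Qed.
End initial.

(** * From [Ck_open] and one-sided derivatives to component calculus *)

Section components.
Variables (R : realType) (V : normedModType R) (n : nat).
Implicit Types (g : V -> 'rV[R]_n) (x v : V) (U : set V) (k : 'I_n).

Lemma dif_component g k x : differentiable g x -> dif (fun y => g y ord0 k) x.
Proof.
move=> dg; apply: (@differentiable_comp _ V _ R^o g (fun N : 'rV[R]_n => N ord0 k)) => //.
exact: differentiable_coord.
Qed.

Lemma pd_component g k v x : differentiable g x ->
  pd v (fun y => g y ord0 k) x = ('D_v g x) ord0 k.
Proof. by move=> dg; rewrite derive_mx ?mxE ?pdE//; exact: diff_derivable. Qed.

Lemma cont_component g k x : {for x, continuous g} -> cont (fun y => g y ord0 k) x.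
Proof.
move=> gc; apply: (@continuous_comp _ 'rV[R]_n R^o g (fun N : 'rV[R]_n => N ord0 k)) => //.
exact: coord_continuous.
Qed.

Lemma C1_component U g k : open U -> Ck_open 1 U g -> C1 U (fun y => g y ord0 k).
Proof.
move=> Uo [dg cg]; split => [x Ux|v x Ux]; first exact: dif_component (dg x Ux).
apply: (cont_near_eq Uo Ux (f := fun y => ('D_v g y) ord0 k)).
  by move=> y Uy; rewrite pd_component//; exact: dg.
by apply: cont_component; exact: cg.
Qed.

Lemma Ck_open1 U g : Ck_open 2 U g -> Ck_open 1 U g.
Proof.
move=> [dg cg]; split => // v x Ux.
by apply: differentiable_continuous; exact: (cg v).1.
Qed.

Lemma C1_pd_component U g k v : open U -> Ck_open 2 U g -> C1 U (pd v (fun y => g y ord0 k)).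
Proof.
move=> Uo [dg cg].
have gv := C1_component k Uo (cg v).
have E y : U y -> ('D_v g y) ord0 k = pd v (fun y => g y ord0 k) y.
  by move=> Uy; rewrite pd_component//; exact: dg.
split => [x Ux|w x Ux]; first exact: (dif_near_eq Uo Ux E (C1_dif gv Ux)).
apply: (cont_near_eq Uo Ux _ (C1_pd_cont (v := w) gv Ux)) => y Uy.
exact: (pd_near_eq Uo).
Qed.
End components.

Section one_sided_derivatives.
Variable R : realType.
Notation plane := 'rV[R]_2.
Notation vec := 'rV[R]_3.
Implicit Types (x v w : plane) (U : set plane) (F G : plane -> vec).
Notation e0 := (e0 R).
Notation e1 := (e1 R).

Lemma vpd_derive v F x : differentiable F x -> vpd v F x = 'D_v F x.
Proof. by move=> dF; apply/rowP => k; rewrite vpdE -pd_component. Qed.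

Lemma Ck2_C2v U F : open U -> Ck_open 2 U F -> C2v U F.
Proof.
move=> Uo FC; split=> [|v] k; first exact: (C1_component k Uo (Ck_open1 FC)).
by rewrite comp_vpd; exact: C1_pd_component.
Qed.

Section one_sided.
Variables (A O U : set plane) (g G : plane -> vec) (x : plane).
Hypotheses (Oo : open O) (AE : A = half_plane (R := R) `&` O) (Ax : A x).
Hypotheses (Uo : open U) (Ux : U x) (gG : forall y, A y -> U y -> G y = g y).

Let dir v := within [set h : R | A (x + h *: v)] (0 : R)^'.

Lemma small_direction v : exists2 d : R, 0 < d & forall h : R, `|h| < d ->
  U (x + h *: v) /\ O (x + h *: v).
Proof.
have Ox : O x by move: Ax; rewrite AE => -[].
have /nbhs_normP[r1 /= r10 H1] := near_open Uo Ux.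
have /nbhs_normP[r2 /= r20 H2] := near_open Oo Ox.
have v1 : 0 < `|v| + 1 by rewrite ltr_wpDl.
exists (Num.min r1 r2 / (`|v| + 1)) => [|h]; first by rewrite divr_gt0// lt_min r10.
rewrite ltr_pdivlMr// => hv.
have : `|x - (x + h *: v)| < Num.min r1 r2.
  rewrite opprD addrA subrr sub0r normrN normrZ; apply: le_lt_trans hv.
  by rewrite ler_wpM2l// lerDl.
by rewrite lt_min => /andP[h1 h2]; split; [exact: H1|exact: H2].
Qed.

(** From a point of the half-plane, small positive or small negative multiples of [v] stay in it,
    according to the sign of its first coordinate. Hence the limit in [derive_in] is taken along a
    nontrivial filter. *)
Lemma direction_proper v : ProperFilter (dir v).
Proof.
split; last exact: within_filter.
rewrite /dir => H.
have [d d0 Hd] := small_direction v.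
have /nbhs_normP[e /= ep He] : \forall h \near (0 : R)^', A (x + h *: v) -> False by exact: H.
pose h : R := (if 0 <= v ord0 0 then 1 else -1) * (Num.min d e / 2).
have m0 : 0 < Num.min d e by rewrite lt_min d0.
have hn : `|h| = Num.min d e / 2.
  rewrite /h normrM [X in _ * X]gtr0_norm ?divr_gt0//.
  by case: ifP; rewrite ?normrN normr1 mul1r.
have hlt : `|h| < Num.min d e by rewrite hn ltr_pdivrMr// ltr_pMr// ltr1n.
move: hlt; rewrite lt_min => /andP[hd he].
have [Uh Oh] := Hd h hd.
apply: (He h); rewrite /= ?sub0r ?normrN//.
- by rewrite -normr_eq0 hn mulf_neq0// ?lt0r_neq0.
- rewrite AE; split=> //; rewrite /half_plane /= !mxE.
  move: Ax; rewrite AE => -[+ _]; rewrite /half_plane /= => x0.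
  rewrite addr_ge0// /h; case: ifP => [v0|/negbT]; first by rewrite mul1r mulr_ge0// divr_ge0 ?ltW.
  rewrite -ltNge => v0; rewrite mulN1r mulNr -mulrN mulr_ge0 ?oppr_ge0 ?(ltW v0)//.
  by rewrite divr_ge0 ?ltW.
Qed.

Lemma derive_inE v : differentiable G x -> derive_in A v g x = 'D_v G x.
Proof.
move=> dG; have PF := direction_proper v.
rewrite /derive_in; apply: cvg_lim; first exact: norm_hausdorff.
have C : (fun h : R => h^-1 *: ((G \o shift x) (h *: v) - G x)) @ (0 : R)^' --> 'D_v G x.
  by have dv : derivable G x v := diff_derivable dG.
have C' : (fun h : R => h^-1 *: ((G \o shift x) (h *: v) - G x)) @ dir v --> 'D_v G x.
  by apply: cvg_trans C; apply: cvg_app; exact: cvg_within.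
apply: cvg_trans C'; apply: near_eq_cvg.
have [d d0 Hd] := small_direction v.
rewrite near_withinE.
have := @dnbhs0_lt R R^o d d0; apply: filterS => h hd Ah.
have [Uh _] := Hd h hd.
by rewrite /= /shift/= (addrC (h *: v)) (gG Ah Uh) (gG Ax Ux).
Qed.
End one_sided.
End one_sided_derivatives.

(** * Determinants and rigid motions *)

Section determinants.
Variable R : realType.

Lemma det2E (M : 'M[R]_2) : \det M = M 0 0 * M 1 1 - M 0 1 * M 1 0.
Proof.
(* Entries are read through natural numbers, so that ordinals differing only in their bound proofs
   give identical terms. *)
pose m (i j : nat) := M (inord i) (inord j).
have ME i j : M i j = m (val i) (val j) by rewrite /m !inord_val.
rewrite (expand_det_row _ 0) !big_ord_recl big_ord0 addr0.
rewrite /cofactor !det_mx11 !mxE /= expr0 expr1 mul1r mulN1r mulrN.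
by rewrite !ME.
Qed.

Lemma det3E (M : 'M[R]_3) : \det M =
  M 0 0 * (M 1 1 * M 2%:R 2%:R - M 1 2%:R * M 2%:R 1)
  - M 0 1 * (M 1 0 * M 2%:R 2%:R - M 1 2%:R * M 2%:R 0)
  + M 0 2%:R * (M 1 0 * M 2%:R 1 - M 1 1 * M 2%:R 0).
Proof.
rewrite (expand_det_row _ 0) !big_ord_recl big_ord0 addr0.
rewrite /cofactor !det2E !mxE /= /bump /= expr0 expr1 sqrrN expr1n !mul1r mulN1r.
pose m (i j : nat) := M (inord i) (inord j).
have ME i j : M i j = m (val i) (val j) by rewrite /m !inord_val.
by rewrite !ME /=; ring.
Qed.
End determinants.

Section rigid_motion.
Variable R : realType.
Notation vec := 'rV[R]_3.
Implicit Types (u v w x y b : vec) (A : 'M[R]_3).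

Lemma mulmx3E u A k : (u *m A) ord0 k = u ord0 0 * A 0 k + u ord0 1 * A 1 k + u ord0 2%:R * A 2%:R k.
Proof.
pose a (i : nat) := A (inord i) k; pose c (i : nat) := u ord0 (inord i).
have AE i : A i k = a (val i) by rewrite /a inord_val.
have uE i : u ord0 i = c (val i) by rewrite /c inord_val.
by rewrite mxE !big_ord_recl big_ord0 !AE !uE /=; ring.
Qed.

Lemma triple_mulmx u v w A :
  dot (u *m A) (cross (v *m A) (w *m A)) = \det A * dot u (cross v w).
Proof. by rewrite det3E !dotE !cross0E !cross1E !cross2E !mulmx3E; ring. Qed.

Lemma dot_enorm u v : enorm u = enorm v -> dot u u = dot v v.
Proof.
rewrite /enorm => E; have := congr1 (fun r : R => r ^+ 2) E.
by rewrite !sqr_sqrtr ?dot_ge0.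
Qed.

Lemma linear_differentiable (g : {linear vec -> vec}) x : differentiable g x.
Proof.
have yE y : y = y ord0 0 *: delta_mx ord0 0 + y ord0 1 *: delta_mx ord0 1
    + y ord0 2%:R *: delta_mx ord0 2%:R.
  by apply: vec_eqP; rewrite !mxE/=; ring.
have -> : (g : vec -> vec) = (fun y : vec => y ord0 0 *: g (delta_mx ord0 0))
    + (fun y : vec => y ord0 1 *: g (delta_mx ord0 1))
    + (fun y : vec => y ord0 2%:R *: g (delta_mx ord0 2%:R)).
  by apply/funext => y; rewrite {1}(yE y) !linearD !linearZZ.
by apply: differentiableD; [apply: differentiableD|]; apply: differentiableZl;
  exact: differentiable_coord.
Qed.

Lemma jacobian_affine (g : {linear vec -> vec}) b x : 'J (fun y => g y + b) x = lin1_mx g.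
Proof.
have gcont : continuous g.
  by move=> y; exact/differentiable_continuous/linear_differentiable.
have gd := linear_differentiable g x.
have E : 'd (fun y => g y + b) x = g :> (vec -> vec).
  have L := diff_lin x gcont.
  have K := @diff_cst R vec vec b x.
  apply: (etrans (diffD gd (differentiable_cst b x))).
  apply/funext => y.
  have Ly : 'd g x y = g y by rewrite L.
  have Ky : 'd (cst b) x y = 0 :> vec by exact: (congr1 (fun h : vec -> vec => h y) K).
  by apply: (etrans (congr2 +%R Ly Ky)); exact: addr0.
by apply/matrixP => i j; rewrite [LHS]mxE [RHS]mxE E.
Qed.

(** By polarization [g] preserves products. The squared norm of [g (a *: x + y) - (a *: g x + g y)]
    then expands into the same products as that of [a *: x + y - (a *: x + y)], which is zero. *)
Lemma rigid_motion_affine (rho : vec -> vec) : proper_rigid_motion rho ->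
  exists (A : 'M[R]_3) (b : vec), [/\ forall x, rho x = x *m A + b,
    forall u v, dot (u *m A) (v *m A) = dot u v & 0 < \det A].
Proof.
move=> [iso detJ]; pose g x := rho x - rho 0.
have gg x y : dot (g x - g y) (g x - g y) = dot (x - y) (x - y).
  by apply: dot_enorm; rewrite /g opprB addrA subrK iso.
have g0 : g 0 = 0 by rewrite /g subrr.
have gn x : dot (g x) (g x) = dot x x by have := gg x 0; rewrite g0 !subr0.
have polar (a b : vec) : dot a b = (dot a a + dot b b - dot (a - b) (a - b)) / 2.
  by rewrite !vecE; field.
have gd x y : dot (g x) (g y) = dot x y by rewrite polar gg !gn -polar.
have glin : linear g.
  move=> a x y; apply/eqP; rewrite -subr_eq0; apply/eqP; apply: dot_eq0.
  have expand (p q r : vec) : dot (p - (a *: q + r)) (p - (a *: q + r)) =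
    dot p p + a ^+ 2 * dot q q + dot r r - 2 * a * dot p q - 2 * dot p r + 2 * a * dot q r.
    by rewrite !vecE; ring.
  rewrite expand !gd -expand subrr.
  by rewrite !vecE; ring.
pose gM := GRing.isLinear.Build _ _ _ _ g glin.
pose gL : {linear vec -> vec} := HB.pack g gM.
exists (lin1_mx gL), (rho 0).
have rhoE x : rho x = gL x + rho 0 by rewrite /= /g subrK.
split.
- by move=> x; rewrite mul_rV_lin1 -rhoE.
- by move=> u v; rewrite !mul_rV_lin1 /= gd.
rewrite -(jacobian_affine gL (rho 0) 0).
have -> : (fun x => gL x + rho 0) = rho by apply/funext => x; exact/esym/rhoE.
exact: detJ.
Qed.
End rigid_motion.

(** * Affine images of an isometric pair *)

Section affine_image.
Variable R : realType.
Notation plane := 'rV[R]_2.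
Notation vec := 'rV[R]_3.
Implicit Types (x v w : plane) (U : set plane) (F G : plane -> vec).
Notation e0 := (e0 R).
Notation e1 := (e1 R).
Variables (A : 'M[R]_3) (b : vec) (U : set plane).
Hypothesis Uo : open U.

Definition affine F x : vec := F x *m A + b.

Let comp_affine F k : comp (affine F) k = fun x =>
  (comp F 0 x * A 0 k + comp F 1 x * A 1 k + comp F 2%:R x * A 2%:R k) + b ord0 k.
Proof. by apply/funext => x; rewrite /comp /affine [LHS]mxE mulmx3E. Qed.

Lemma C1v_affine F : C1v U F -> C1v U (affine F).
Proof.
move=> FC k; rewrite comp_affine.
have Ca a := @C1_cst R plane U a.
by apply: C1D => //; apply: C1D; [exact: Uo|apply: C1D; [exact: Uo|..]|]; apply: C1M.
Qed.

Lemma vpd_affine v F x : C1v U F -> U x -> vpd v (affine F) x = vpd v F x *m A.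
Proof.
move=> FC Ux; apply/rowP => k; rewrite vpdE comp_affine mulmx3E !vpdE.
have dF i := C1_dif (FC i) Ux; have dc (a : R) := @dif_cst R plane a x.
have dM i j := difM (dF i) (dc (A j k)).
rewrite (pdD v (difD (difD (dM 0 0) (dM 1 1)) (dM 2%:R 2%:R)) (dc _)).
rewrite (pdD v (difD (dM 0 0) (dM 1 1)) (dM 2%:R 2%:R)) (pdD v (dM 0 0) (dM 1 1)).
by rewrite !(pdM v (dF _) (dc _)) !pd_cst; ring.
Qed.

Lemma C2v_affine F : C2v U F -> C2v U (affine F).
Proof.
move=> FC; split; first by apply: C1v_affine; exact: FC.1.
move=> v k.
have Ca a := @C1_cst R plane U a.
have FvC := FC.2 v.
apply: (@C1_eq R U Uo (fun x => comp (vpd v F) 0 x * A 0 k + comp (vpd v F) 1 x * A 1 k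
   + comp (vpd v F) 2%:R x * A 2%:R k)).
  by move=> y Uy; rewrite [RHS]/comp (vpd_affine v FC.1 Uy) mulmx3E.
by apply: C1D; [exact: Uo|apply: C1D; [exact: Uo|..]|]; apply: C1M.
Qed.

Lemma vpd2_affine v w F x : C2v U F -> U x ->
  vpd v (vpd w (affine F)) x = vpd v (vpd w F) x *m A.
Proof.
move=> FC Ux.
have -> : vpd v (vpd w (affine F)) x = vpd v (fun y => vpd w F y *m A + 0) x.
  apply: (vpd_near_eq Uo v Ux) => y Uy.
  by rewrite addr0 (vpd_affine w FC.1 Uy).
apply/rowP => k; rewrite vpdE mulmx3E !vpdE.
have -> : comp (fun y => vpd w F y *m A + 0) k = fun y => comp (vpd w F) 0 y * A 0 k
  + comp (vpd w F) 1 y * A 1 k + comp (vpd w F) 2%:R y * A 2%:R k.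
  by apply/funext => y; rewrite /comp addr0 mulmx3E.
have dF i := C1_dif (FC.2 w i) Ux; have dc (a : R) := @dif_cst R plane a x.
have dM i j := difM (dF i) (dc (A j k)).
rewrite (pdD v (difD (dM 0 0) (dM 1 1)) (dM 2%:R 2%:R)) (pdD v (dM 0 0) (dM 1 1)).
by rewrite !(pdM v (dF _) (dc _)) !pd_cst; ring.
Qed.

(** Triple products are multiplied by [\det A]. Its square appears in the discriminant; in the last
    condition it appears once, which is where the motion has to be proper. *)
Lemma isopair_affine F G x : (forall u v : vec, dot (u *m A) (v *m A) = dot u v) ->
  0 < \det A -> C2v U G -> U x -> isopair F G x -> isopair F (affine G) x.
Proof.
move=> dotA detA GC Ux [[i0 i1 i2] cF cG or].
rewrite /isopair /isometric_at /curved /normal /disc !(vpd2_affine _ _ GC Ux).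
rewrite !(vpd_affine _ GC.1 Ux) !dotA !triple_mulmx.
split=> //.
- have scale (d l n m : R) : d * l * (d * n) - (d * m) ^+ 2 = d ^+ 2 * (l * n - m ^+ 2).
    by ring.
  by rewrite scale mulr_gt0// exprn_gt0.
- by rewrite mulrCA mulr_gt0.
Qed.
End affine_image.

(** * Algebra of the fundamental forms *)

Section fundamental_forms.
Variable R : realType.
Notation plane := 'rV[R]_2.
Notation vec := 'rV[R]_3.
Implicit Types (a b L M N : vec) (U : set plane).
Notation e0 := (e0 R).
Notation e1 := (e1 R).

Lemma lagrange_identity a b :
  dot (cross a b) (cross a b) = dot a a * dot b b - dot a b ^+ 2.
Proof. by rewrite !dotE !cross0E !cross1E !cross2E; ring. Qed.

Lemma trace_invmx_mul (I II : 'M[R]_2) : \det I != 0 ->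
  \tr (invmx I *m II) =
  (I 1 1 * II 0 0 - I 0 1 * II 1 0 - I 1 0 * II 0 1 + I 0 0 * II 1 1) / \det I.
Proof.
move=> I0; have Iu : I \in unitmx by rewrite unitmxE unitfE.
have adj : \adj I = \matrix_(i, j) (if i == j then I (1 - i) (1 - i) else - I i j).
  pose m (i j : nat) := I (inord i) (inord j).
  have IE i j : I i j = m (val i) (val j) by rewrite /m !inord_val.
  apply/matrixP => i j; rewrite !mxE /cofactor det_mx11 !mxE.
  by case: i => [[|[|//]] Hi]; case: j => [[|[|//]] Hj];
    rewrite !IE /= ?expr0 ?expr1 ?sqrrN ?expr1n ?mul1r ?mulN1r.
rewrite /invmx Iu adj /mxtrace !big_ord_recl big_ord0 !mxE !big_ord_recl !big_ord0 !mxE.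
pose m (i j : nat) := I (inord i) (inord j).
have IE i j : I i j = m (val i) (val j) by rewrite /m !inord_val.
pose n (i j : nat) := II (inord i) (inord j).
have IIE i j : II i j = n (val i) (val j) by rewrite /n !inord_val.
by rewrite !IE !IIE /=; ring.
Qed.

(** The trace of a definite form relative to the metric has the sign of its first coefficient: after
    multiplication by [E], the product becomes a combination of squares with positive weights. *)
Lemma trace_form_sign (E F G L M N : R) : 0 < E -> 0 < E * G - F ^+ 2 ->
  0 < L * N - M ^+ 2 -> 0 < L * (G * L - F * M - F * M + E * N).
Proof.
move=> E0 d0 d1.
have h : E * (L * (G * L - F * M - F * M + E * N)) =
  E ^+ 2 * (L * N - M ^+ 2) + (E * M - F * L) ^+ 2 + (E * G - F ^+ 2) * L ^+ 2 by ring.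
rewrite -(pmulr_rgt0 _ E0) h.
rewrite -addrA ltr_pwDl//; first by rewrite mulr_gt0// exprn_gt0.
by rewrite addr_ge0 ?sqr_ge0// mulr_ge0 ?sqr_ge0// ltW.
Qed.
End fundamental_forms.

(** * Chart representatives of a map on the surface *)

Section representatives.
Variables (R : realType) (M : smooth_surface R).
Notation plane := 'rV[R]_2.
Notation vec := 'rV[R]_3.
Implicit Types (f : M -> vec) (c : chart R M) (p : M) (x v w : plane) (U : set plane) (F : plane -> vec).
Notation e0 := (e0 R).
Notation e1 := (e1 R).

(** [U] is small enough for all of its points with [x_0 >= 0] to lie in the chart image, so
    conditions on the surface become conditions on that part of [U]; elsewhere [F] is just some
    extension. *)
Definition represents c U F f : Prop :=
  [/\ open U, Ck_open 2 U F, forall x, U x -> 0 <= x ord0 0 -> cimg c x &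
      forall x, cimg c x -> U x -> F x = f (cinv c x)].

Lemma cimg_half_plane c x : cimg c x -> 0 <= x ord0 0.
Proof. by have [W _ E] := cmap_relopen c; rewrite /cimg E => -[]. Qed.

Lemma represents_subset c U U' F f : open U' -> U' `<=` U -> represents c U F f ->
  represents c U' F f.
Proof.
move=> U'o U'U [Uo [dF cF] UA UF]; split => //.
- split=> [x /U'U|v]; first exact: dF.
  split=> [x /U'U|w x /U'U]; first exact: (cF v).1.
  exact: (cF v).2.
- by move=> x /U'U; exact: UA.
- by move=> x Ax /U'U; exact: UF.
Qed.

Lemma represents_C2v c U F f : represents c U F f -> C2v U F.
Proof. by move=> [Uo FC _ _]; exact: Ck2_C2v. Qed.

Lemma C21_represents f c p : C21 f -> chart_at p c ->
  exists U F, U (cmap c p) /\ represents c U F f.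
Proof.
move=> fC [ac cp].
have [W Wo AE] := cmap_relopen c.
have Ap : cimg c (cmap c p) by exists p.
have [U [F [Uo Up [FC _] FE]]] := fC c ac _ Ap.
have Wp : W (cmap c p) by move: Ap; rewrite /cimg AE => -[].
exists (U `&` W), F; split=> //.
have [dF cF] := FC; split; first exact: openI.
- split=> [x [/dF//]|v].
  split=> [x [Ux _]|w x [Ux _]]; first exact: (cF v).1.
  exact: (cF v).2.
- by move=> x [_ Wx] x0; rewrite /cimg AE; split.
- by move=> x Ax [Ux _]; exact: FE.
Qed.

Section derivatives.
Variables (c : chart R M) (U : set plane) (F : plane -> vec) (f : M -> vec) (p : M).
Hypotheses (rF : represents c U F f) (cp : cdom c p) (Up : U (cmap c p)).

Let derive_in_E v x : cimg c x -> U x -> derive_in (cimg c) v (f \o cinv c) x = 'D_v F x.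
Proof.
move=> Ax Ux; have [W Wo AE] := cmap_relopen c; have [Uo [dF _] _ FE] := rF.
by apply: (derive_inE Wo AE Ax Uo Ux) => //; exact: dF.
Qed.

Lemma diff1E v : diff1 f c p v = vpd v F (cmap c p).
Proof.
have [_ [dF _] _ _] := rF.
by rewrite (vpd_derive v (dF _ Up)) /diff1 derive_in_E//; exists p.
Qed.

Lemma diff2E v w : diff2 f c p v w = vpd v (vpd w F) (cmap c p).
Proof.
have [W Wo AE] := cmap_relopen c; have [Uo [dF cF] _ FE] := rF.
have Ap : cimg c (cmap c p) by exists p.
have dwF := (cF w).1 _ Up.
rewrite /diff2 (derive_inE Wo AE Ap Uo Up _ v dwF); last first.
  by move=> y Ay Uy; rewrite derive_in_E.
rewrite -(vpd_derive v dwF); apply: (vpd_near_eq Uo) => // y Uy.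
by rewrite vpd_derive//; exact: dF.
Qed.
End derivatives.
End representatives.

(** * The curvature hypotheses in terms of representatives *)

Section curvature.
Variables (R : realType) (M : smooth_surface R).
Notation plane := 'rV[R]_2.
Notation vec := 'rV[R]_3.
Implicit Types (f : M -> vec) (x v w : plane) (U : set plane) (F : plane -> vec).
Notation e0 := (e0 R).
Notation e1 := (e1 R).
Variables (c : chart R M) (p : M).
Hypothesis cp : chart_at p c.
Notation x := (cmap c p).

Section one_immersion.
Variables (U : set plane) (F : plane -> vec) (f : M -> vec).
Hypotheses (rF : represents c U F f) (Up : U x).

Let n := normal F x.
Let F0 := vpd e0 F x.
Let F1 := vpd e1 F x.
Let L := dot (vpd e0 (vpd e0 F) x) n.
Let N := dot (vpd e1 (vpd e1 F) x) n.
Let K := dot (vpd e1 (vpd e0 F) x) n.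

Let Uo : open U. Proof. by case: rF. Qed.

Let normal_diff1 : cross (diff1 f c p (coord_vec R 0)) (diff1 f c p (coord_vec R 1)) = n.
Proof. by rewrite !(diff1E rF cp.2 Up). Qed.

Let unit_normalE : unit_normal f c p = (enorm n)^-1 *: n.
Proof. by rewrite /unit_normal normal_diff1. Qed.

Let first_formE i j : first_form f c p i j = dot (vpd (coord_vec R i) F x) (vpd (coord_vec R j) F x).
Proof. by rewrite mxE !(diff1E rF cp.2 Up). Qed.

Let second_formE i j : second_form f c p i j =
  (enorm n)^-1 * dot (vpd (coord_vec R i) (vpd (coord_vec R j) F) x) n.
Proof. by rewrite mxE unit_normalE dotZr (diff2E rF cp.2 Up). Qed.

Let mixed : vpd e0 (vpd e1 F) x = vpd e1 (vpd e0 F) x.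
Proof. exact: (vpd_Young Uo _ _ (represents_C2v rF) Up). Qed.

Let det_first : \det (first_form f c p) = dot n n.
Proof. by rewrite det2E !first_formE /n /normal lagrange_identity [dot F1 F0]dotC. Qed.

Let det_second : \det (second_form f c p) = (enorm n)^-1 ^+ 2 * (L * N - K ^+ 2).
Proof.
by rewrite det2E !second_formE -/e0 -/e1 mixed -/K -/L -/N; ring.
Qed.

Lemma curved_represents : 0 < gauss_curvature f c p -> curved F x.
Proof.
rewrite /gauss_curvature det_first det_second mulrAC => h.
rewrite /curved /disc -/L -/N -/K.
have s0 : 0 <= (enorm n)^-1 ^+ 2 / dot n n.
  by rewrite mulr_ge0 ?sqr_ge0// invr_ge0 dot_ge0.
by rewrite ltNge; apply/negP => d; move: h; rewrite ltNge mulr_ge0_le0.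
Qed.

(** By [trace_form_sign] the mean curvature vector points to the side of [n] given by the sign of
    [L]; this links it to the last condition of [isopair]. *)
Lemma mean_curvature_represents : curved F x ->
  exists2 k : R, mean_curvature_vector f c p = k *: n & 0 < k * L.
Proof.
move=> cF; have n0 := disc_normal_neq0 cF.
have nn : 0 < dot n n.
  by rewrite lt_neqAle dot_ge0 andbT eq_sym; apply: contra n0 => /eqP/dot_eq0/eqP.
have F00 : 0 < dot F0 F0.
  rewrite lt_neqAle dot_ge0 andbT eq_sym; apply: contra n0 => /eqP/dot_eq0.
  rewrite /F0 => ->; apply/eqP; apply: vec_eqP; rewrite !vecE; ring.
have en : 0 < enorm n by rewrite /enorm sqrtr_gt0.
rewrite /mean_curvature_vector unit_normalE trace_invmx_mul det_first ?gt_eqF//.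
rewrite !first_formE !second_formE -/e0 -/e1 mixed -/K -/L -/N -/F0 -/F1.
rewrite scalerA; eexists; first by [].
have := trace_form_sign (F := dot F0 F1) (G := dot F1 F1) F00 _ (cF : 0 < L * N - K ^+ 2).
rewrite -lagrange_identity -/n => /(_ nn) T0.
have factor (s d a b e l m r : R) :
    2^-1 * ((e * (s * l) - b * (s * m) - b * (s * m) + a * (s * r)) / d) * s * l =
    2^-1 / d * s ^+ 2 * (l * (e * l - b * m - b * m + a * r)) by ring.
rewrite [dot F1 F0]dotC factor mulr_gt0//.
by rewrite !mulr_gt0 ?invr_gt0// exprn_gt0// invr_gt0.
Qed.
End one_immersion.

Lemma isopair_represents U F G (f g : M -> vec) :
  represents c U F f -> represents c U G g -> U x ->
  positively_curved f -> positively_curved g -> isometric f g ->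
  same_mean_curvature_orientation f g -> isopair F G x.
Proof.
move=> rF rG Up pf pg iso or.
have cF : curved F x by apply: (curved_represents rF) => //; exact: pf.
have cG : curved G x by apply: (curved_represents rG) => //; exact: pg.
split => //.
- have I v w := iso p c cp v w.
  by split; rewrite -!(diff1E rF cp.2 Up) -!(diff1E rG cp.2 Up).
have [k fk kL] := mean_curvature_represents rF Up cF.
have [l gl lL] := mean_curvature_represents rG Up cG.
have n0 := disc_normal_neq0 cF.
have dF v := diff1E rF cp.2 Up v; have dG v := diff1E rG cp.2 Up v.
have free2 (i j : 'I_2) : i != j -> free [:: coord_vec R i; coord_vec R j].
  move=> ij; rewrite free_cons seq1_free span_seq1; apply/andP; split.
    apply/vlineP => -[r /rowP/(_ i)]; rewrite !mxE !eqxx (negbTE ij) mulr0.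
    by move/eqP; rewrite oner_eq0.
  by apply/eqP => /rowP/(_ j); rewrite !mxE !eqxx => /eqP; rewrite oner_eq0.
have scale (r s : R) : r *: normal F x = s *: normal F x -> r = s.
  by move/eqP; rewrite -subr_eq0 -scalerBl scaler_eq0 (negbTE n0) orbF subr_eq0 => /eqP.
have kl : 0 < k * l.
  have l0 : l != 0 by apply: contraTneq lL => ->; rewrite mul0r ltxx.
  (* The orientation hypothesis speaks only of frames positively aligned with the mean curvature
     vector of [g]; the sign of [l] decides whether that is [e0, e1] or [e1, e0]. *)
  case: (ltgtP l 0) l0 => // ls _.
  - have [|m m0] := or p c cp e1 e0 (free2 1 0 isT).
      exists (- l^-1); first by rewrite oppr_gt0 invr_lt0.
      by rewrite gl !dG scalerA mulNr mulVf ?lt_eqF// scaleN1r crossC.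
    rewrite fk !dF scalerA crossC -scaleN1r => /scale E.
    by rewrite nmulr_lgt0// -(pmulr_rlt0 k m0) -E ltrN10.
  - have [|m m0] := or p c cp e0 e1 (free2 0 1 isT).
      exists l^-1; first by rewrite invr_gt0.
      by rewrite gl !dG scalerA mulVf ?gt_eqF// scale1r.
    rewrite fk !dF scalerA -[LHS]scale1r => /scale E.
    by rewrite pmulr_lgt0// -(pmulr_rgt0 k m0) -E ltr01.
have := mulr_gt0 kL lL; rewrite mulrACA => h.
by rewrite -(pmulr_rgt0 _ kl).
Qed.
End curvature.

(** * Neighborhoods in the half-plane and in charts *)

Section half_plane_neighbourhoods.
Variable R : realType.
Notation plane := 'rV[R]_2.
Notation vec := 'rV[R]_3.
Implicit Types (x y z v w q : plane) (U : set plane) (F G : plane -> vec).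
Notation e0 := (e0 R).
Notation e1 := (e1 R).

Lemma near_interior_point (P : plane -> Prop) y : 0 <= y ord0 0 -> (\forall z \near y, P z) ->
  exists q, [/\ 0 < q ord0 0, P q & \forall z \near q, P z].
Proof.
move=> y0 /nbhs_normP[d /= d0 Hd].
have yq : `|y - (y + (d / 2) *: e0)| < d.
  rewrite opprD addrA subrr add0r normrN normrZ gtr0_norm ?divr_gt0//.
  have e0n : `|e0| <= 1 by rewrite plane_norm_le ?ler01// e00 e01 normr1 normr0 lexx ler01.
  apply: (@le_lt_trans _ _ (d / 2)); last by rewrite gtr_pMr// invf_lt1// ltr1n.
  by rewrite ler_piMr// ltW// divr_gt0.
exists (y + (d / 2) *: e0); split.
- by rewrite !mxE/= mulr1 ltr_wpDl// divr_gt0.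
- exact: Hd.
- have := near_open (@open_ball R _ y d) yq.
  by apply: filterS => z; exact: Hd.
Qed.

Lemma jets_agree U F G y : open U -> U y -> C1v U F -> C1v U G -> 0 <= y ord0 0 ->
  (forall z, U z -> 0 < z ord0 0 -> F z = G z) ->
  F y = G y /\ forall v, vpd v F y = vpd v G y.
Proof.
move=> Uo Uy FC GC y0 FG; split=> [|v]; apply/rowP => k; apply/eqP; rewrite -subr_eq0; apply/eqP.
  apply: (halfplane_eq0 Uo (g := fun z => comp F k z - comp G k z)) => //.
    by apply: contB; apply: dif_cont; [exact: C1_dif (FC k) Uy|exact: C1_dif (GC k) Uy].
  by move=> z Uz z0; rewrite /comp FG// subrr.
rewrite !vpdE.
apply: (halfplane_eq0 Uo (g := fun z => pd v (comp F k) z - pd v (comp G k) z)) => //.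
  by apply: contB; [exact: C1_pd_cont (FC k) Uy|exact: C1_pd_cont (GC k) Uy].
move=> z Uz z0; apply/eqP; rewrite subr_eq0 -!vpdE.
have z0c : cont (fun w => w ord0 0) z by exact/dif_cont/coord_dif.
have /nbhs_normP[d /= d0 Hd] : \forall w \near z, U w /\ 0 < w ord0 0.
  by apply: filterI; [exact: (near_open Uo Uz)|exact: (cont_gt z0c z0)].
have Bz : [set w | `|z - w| < d] z by rewrite /= subrr normr0.
have E : vpd v F z = vpd v G z.
  apply: (@vpd_near_eq R _ (open_ball z d) v F G z Bz) => w /Hd[]; exact: FG.
by rewrite E.
Qed.
End half_plane_neighbourhoods.

Section charts.
Variables (R : realType) (M : smooth_surface R).
Notation plane := 'rV[R]_2.
Variables (c : chart R M) (p : M).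
Hypothesis cp : cdom c p.

Lemma near_cmap (P : plane -> Prop) : (\forall x \near cmap c p, P x) ->
  \forall q \near p, cdom c q /\ P (cmap c q).
Proof.
move=> HP; apply: filterI; first exact: (open_nbhs_nbhs (conj (cdom_open c) cp)).
have := cmap_continuous (c := c); rewrite (continuous_open_subspace _ (cdom_open c)).
by move=> /(_ p); rewrite inE => /(_ cp); apply.
Qed.

Lemma near_cinv (P : M -> Prop) : (\forall q \near p, P q) ->
  \forall x \near cmap c p, cimg c x -> P (cinv c x).
Proof.
move=> HP; have /subspace_continuousP := cinv_continuous (c := c).
move=> /(_ (cmap c p) (ex_intro2 _ _ p cp erefl)) H.
have : nbhs (cinv c (cmap c p)) P by rewrite (cmapK cp).
exact: H.
Qed.
End charts.

(** * The interior of the coincidence set *)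

Section coincidence_set.
Variables (R : realType) (M : smooth_surface R).
Notation plane := 'rV[R]_2.
Notation vec := 'rV[R]_3.
Implicit Types (f h : M -> vec) (c : chart R M) (p q : M) (x y z : plane) (U : set plane).
Notation e0 := (e0 R).
Notation e1 := (e1 R).

(** [h] stands for [rho \o ft], so that the rigid motion disappears from the rest of the
    argument. *)
Definition locally_isopaired f h : Prop := forall p c, chart_at p c -> exists U F G,
  [/\ represents c U F f, C2v U G, U (cmap c p),
      forall x, cimg c x -> U x -> G x = h (cinv c x) &
      forall x, U x -> 0 <= x ord0 0 -> isopair F G x].

Lemma locally_isopaired_rigid f ft rho : C21 f -> C21 ft ->
  positively_curved f -> positively_curved ft -> isometric f ft ->
  same_mean_curvature_orientation f ft -> proper_rigid_motion rho ->
  locally_isopaired f (rho \o ft).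
Proof.
move=> fC gC fp gp iso or /rigid_motion_affine[A [b [rhoE dotA detA]]] p c cp.
have [U [F [UF rF]]] := C21_represents fC cp.
have [W [G [WG rG]]] := C21_represents gC cp.
have Uo : open U by case: rF.
have Wo : open W by case: rG.
have rF' : represents c (U `&` W) F f.
  by apply: represents_subset rF; [exact: openI|exact: subIsetl].
have rG' : represents c (U `&` W) G ft.
  by apply: represents_subset rG; [exact: openI|exact: subIsetr].
have GC := represents_C2v rG'.
have UWo : open (U `&` W) by exact: openI.
exists (U `&` W), F, (affine A b G); split => //; first exact: C2v_affine.
- by move=> x Ax UWx; case: rG' => _ _ _ /(_ x Ax UWx) E; rewrite /affine E /= rhoE.
- move=> x UWx x0; apply: (isopair_affine b UWo dotA detA GC UWx).
  have [q cq qx] : cimg c x by case: rF' => _ _ + _; apply.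
  rewrite -qx in UWx *.
  exact: (isopair_represents (conj cp.1 cq) rF' rG' UWx fp gp iso or).
Qed.

Variables f h : M -> vec.
Hypothesis fh : locally_isopaired f h.

Let Z : set M := [set p | f p = h p]°.

Section in_chart.
Variables (c : chart R M) (U : set plane) (F G : plane -> vec).
Hypotheses (cA : atlas c) (rF : represents c U F f).
Hypothesis GE : forall x, cimg c x -> U x -> G x = h (cinv c x).

Let Uo : open U. Proof. by case: rF. Qed.

Lemma coincidence_to_chart q : cdom c q -> U (cmap c q) -> Z q ->
  \forall x \near cmap c q, [/\ U x & 0 <= x ord0 0 -> F x = G x].
Proof.
move=> cq Uq Zq.
have := near_cinv cq Zq; have := near_open Uo Uq.
apply: filterS2 => x Ux E; split => // x0.
have [_ _ UA FE] := rF.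
have Ax := UA x Ux x0.
by rewrite (FE x Ax Ux) (GE Ax Ux); exact: E.
Qed.

Lemma coincidence_from_chart q : cdom c q -> U (cmap c q) ->
  (\forall x \near cmap c q, 0 <= (x : plane) ord0 0 -> F x = G x) -> Z q.
Proof.
move=> cq Uq E.
suff : \forall r \near q, f r = h r by [].
have /near_cmap : \forall x \near cmap c q, U x /\ (0 <= x ord0 0 -> F x = G x).
  by apply: filterI => //; exact: (near_open Uo Uq).
move=> /(_ cq); apply: filterS => r [cr [Ur Er]].
have Ar : cimg c (cmap c r) by exists r.
have [_ _ _ FE] := rF.
rewrite -(cmapK cr) -(FE _ Ar Ur) -(GE Ar Ur).
exact/Er/(cimg_half_plane Ar).
Qed.
End in_chart.

(** At a limit point of [Z] the first derivatives agree by continuity, so [propagation] gives a ball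
    around that point itself. The ball meets the interior of the coincidence set, hence [F = G] on
    its open half, and up to the boundary line by [jets_agree]. *)
Lemma coincidence_closed : closed Z.
Proof.
move=> p clp.
have [c cA cp] := atlas_cover p.
have [U [F [G [rF GC Up GE pair]]]] := fh (conj cA cp).
have FC := represents_C2v rF.
have Uo : open U by case: rF.
have Ap : cimg c (cmap c p) by exists p.
have p0 := cimg_half_plane Ap.
have acc (P : plane -> Prop) : (\forall x \near cmap c p, P x) ->
    exists y, [/\ P y, U y, 0 <= y ord0 0 &
      \forall x \near y, U x /\ (0 <= x ord0 0 -> F x = G x)].
  move=> HP; have /near_cmap : \forall x \near cmap c p, U x /\ P x.
    by apply: filterI => //; exact: (near_open Uo Up).
  move=> /(_ cp)/clp[q [Zq [cq [Uq Pq]]]].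
  exists (cmap c q); split => //; first by apply: (@cimg_half_plane _ _ c); exists q.
  exact: (coincidence_to_chart rF GE cq Uq Zq).
(* If the first derivatives differed at the limit point, they would differ at nearby points around
   which the two maps coincide on the half-plane. *)
have jets v : vpd v F (cmap c p) = vpd v G (cmap c p).
  apply/rowP => k; rewrite !vpdE; apply/eqP; rewrite -subr_eq0; apply/negPn/negP => neq.
  pose D x := pd v (comp F k) x - pd v (comp G k) x.
  have Dc : cont D (cmap c p).
    by apply: contB; [exact: C1_pd_cont (FC.1 k) Up|exact: C1_pd_cont (GC.1 k) Up].
  have : \forall x \near cmap c p, D x != 0 by exact: (cvgr_neq0 _ Dc neq).
  move=> /acc[y [Dy Uy y0 near_y]].
  have /nbhs_normP[d /= d0 Hd] := near_y.
  have By : [set z | `|y - z| < d] y by rewrite /= subrr normr0.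
  have BU : [set z | `|y - z| < d] `<=` U by move=> z /Hd[].
  have [|_ /(_ v) /rowP/(_ k)] := jets_agree (open_ball y d) By (C1v_subset BU FC.1) (C1v_subset BU GC.1) y0.
    by move=> z /Hd[_ H] z0; apply: H; exact: ltW.
  by rewrite !vpdE => E; move: Dy; rewrite /D E subrr eqxx.
have [r r0 [BU prop]] := propagation Uo Up FC GC pair p0 (jets e0) (jets e1).
have Bnear : \forall x \near cmap c p, `|cmap c p - x| < r.
  have Bp : [set x | `|cmap c p - x| < r] (cmap c p) by rewrite /= subrr normr0.
  exact: (near_open (open_ball (cmap c p) r) Bp).
have [y [yr Uy y0 near_y]] := acc _ Bnear.
have [q [q0 [qr _] near_q]] : exists q : plane, [/\ 0 < q ord0 0,
    `|cmap c p - q| < r /\ (U q /\ (0 <= q ord0 0 -> F q = G q)) &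
    \forall x \near q, `|cmap c p - x| < r /\ (U x /\ (0 <= x ord0 0 -> F x = G x))].
  apply: near_interior_point y0 _; apply: filterI => //.
  exact: (near_open (open_ball (cmap c p) r) yr).
have FGq : \forall x \near q, F x = G x.
  have := cont_gt (dif_cont (coord_dif 0 q)) q0.
  by move: near_q; apply: filterS2 => x [_ [_ H]] x0; apply: H; exact: ltW.
apply: (coincidence_from_chart rF GE cp Up).
move: Bnear; apply: filterS => x xr x0.
have [E _] := jets_agree (open_ball (cmap c p) r) xr (C1v_subset BU FC.1) (C1v_subset BU GC.1) x0
  (fun z near_z pos_z => prop q z qr q0 FGq near_z pos_z).
exact: E.
Qed.

Lemma coincidence_nonempty (Gamma : set M) : curve_segment Gamma ->
  (forall p, Gamma p -> f p = h p) -> Z !=set0.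
Proof.
move=> [e [g [e_gt0 [gc gS gD _] ->]]] fhG.
pose I := `]- e, e[%classic : set R.
have I0 : I 0 by rewrite /I /= in_itv/= e_gt0 oppr_lt0 e_gt0.
have Io : open I by exact: interval_open.
have [c cA cp] := atlas_cover (g 0).
have [U [F [G [rF GC Up GE pair]]]] := fh (conj cA cp).
have FC := represents_C2v rF.
have Uo : open U by case: rF.
(* The curve is handled through its smooth extension [ga]; on the interval [|0 - t| < a] found
   below, [ga] is the coordinate expression itself. *)
have [T [ga [To T0 gaS gaE]]] := gS c cA 0 (conj I0 cp).
have gaC : Ck_open 2 T ga := gaS 2%N.
have ga0 : ga 0 = cmap c (g 0) by exact: gaE.
have near_cdom : \forall t \near (0 : R), cdom c (g t).
  have g0 : {for 0, continuous g}.
    by move: gc; rewrite (continuous_open_subspace _ Io) => /(_ 0); rewrite inE => /(_ I0).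
  by apply: g0; apply: open_nbhs_nbhs; split => //; exact: cdom_open.
have near_U : \forall t \near (0 : R^o), U (ga t).
  have gac : {for (0 : R^o), continuous ga}.
    by apply: differentiable_continuous; exact: gaC.1.
  by apply: gac; rewrite ga0; exact: (near_open Uo Up).
have near_I : \forall t \near (0 : R), I t by exact: (near_open Io I0).
have near_T : \forall t \near (0 : R^o), T t by exact: (near_open To T0).
have /nbhs_normP[a /= a0 Ha] : \forall t \near (0 : R^o), [/\ I t, cdom c (g t), T t & U (ga t)].
  near=> t; split; near: t; [exact: near_I|exact: near_cdom|exact: near_T|exact: near_U].
have aT : [set t : R^o | `|0 - t| < a] `<=` T by move=> t /Ha[].
have gat t : `|0 - t| < a -> ga t = cmap c (g t) by move=> /Ha[It ct Tt _]; exact: gaE.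
have near_ball0 : \forall t \near (0 : R^o), `|0 - t| < a.
  have B0 : [set t : R^o | `|0 - t| < a] 0 by rewrite /= subrr normr0.
  exact: (near_open (@open_ball R R^o 0 a) B0).
have Dga : 'D_1 (ga : R^o -> plane) 0 != 0.
  have -> : 'D_1 (ga : R^o -> plane) 0 = 'D_1 (cmap c \o g : R^o -> plane) 0.
    apply: near_eq_derive; near=> t; have : `|0 - t| < a by near: t; exact: near_ball0.
    by move=> /gat.
  exact: gD.
have dga : differentiable (ga : R^o -> plane) 0 by exact: gaC.1.
pose co k : R^o -> R := fun t => ga t ord0 k.
have [q [Uq q0 FGq]] : exists q : plane, [/\ U q, 0 < q ord0 0 & \forall y \near q, F y = G y].
  apply: (initial_vanishing Uo FC GC pair a0 (c0 := co 0) (c1 := co 1)).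
  - by apply: (C1_subset aT); exact: (C1_component 0 To (Ck_open1 gaC)).
  - by apply: (C1_subset aT); exact: (C1_component 1 To (Ck_open1 gaC)).
  - by apply: (C1_subset aT); exact: C1_pd_component To gaC.
  - by apply: (C1_subset aT); exact: C1_pd_component To gaC.
  - move=> t ta; rewrite /co ptK (gat t ta).
    have [It ct Tt] := Ha t ta; rewrite (gat t ta) => Ut.
    have At : cimg c (cmap c (g t)) by exists (g t).
    have [_ _ _ FE] := rF.
    split => //; first exact: cimg_half_plane At.
    by rewrite (FE _ At Ut) (GE _ At Ut) (cmapK ct); apply: fhG; exists t.
  - rewrite /co !(pd_component _ _ dga); move: Dga; apply: contraR.
    rewrite negb_or !negbK => /andP[/eqP d0 /eqP d1].
    by apply/eqP; apply: plane_eqP; rewrite [RHS]mxE.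
have Aq : cimg c q by have [_ _ UA _] := rF; apply: UA => //; exact: ltW.
have [r cr rq] := Aq; rewrite -rq in Uq FGq.
exists r; apply: (coincidence_from_chart rF GE cr Uq).
by apply: filterS FGq.
Unshelve. all: end_near.
Qed.
End coincidence_set.

Theorem theorem1p1 (R : realType) (M : smooth_surface R)
    (connected_M : connected [set: M])
    (f ft : M -> 'rV[R]_3)
    (f_C21 : C21 f) (ft_C21 : C21 ft)
    (f_imm : immersion f) (ft_imm : immersion ft)
    (f_pos : positively_curved f) (ft_pos : positively_curved ft)
    (f_ft_isometric : isometric f ft)
    (f_ft_orientation : same_mean_curvature_orientation f ft)
    (Gamma : set M) (Gamma_curve : curve_segment Gamma)
    (rho : 'rV[R]_3 -> 'rV[R]_3) (rho_rigid : proper_rigid_motion rho)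
    (f_on_Gamma : forall p : M, Gamma p -> f p = rho (ft p)) :
  forall p : M, f p = rho (ft p).
Proof.
have fh := locally_isopaired_rigid f_C21 ft_C21 f_pos ft_pos f_ft_isometric
  f_ft_orientation rho_rigid.
pose Z := [set p | f p = (rho \o ft) p]°.
have Z0 : Z !=set0 := coincidence_nonempty fh Gamma_curve f_on_Gamma.
have ZT : Z = [set: M].
  apply: connected_M => //.
  - by exists Z; [exact: open_interior|rewrite setTI].
  - by exists Z; [exact: coincidence_closed fh|rewrite setTI].
by move=> p; apply: (@interior_subset _ [set p | f p = (rho \o ft) p]); rewrite -/Z ZT.
Qed.
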